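(* Let $g\ge 1$ and let $\Gamma\subset \mathrm{Sp}(2g,\mathbb{Z})$ be a neat subgroup of finite index. Let $k,m$ be positive integers. Then the graded $\mathbb{C}$-algebra $\bigoplus_{\ell\ge 0} J_{\ell k,\ell m}(\Gamma)$ (with multiplication given by the product of functions) is not finitely generated.
   Context: $\mathcal{H}_g$ denotes the Siegel upper half space of complex symmetric $g\times g$ matrices $Z$ with positive definite imaginary part; $\mathbb{C}^{(1,g)}$ denotes row vectors of length $g$. A subgroup $\Gamma\subset \mathrm{Sp}(2g,\mathbb{Z})$ is neat if for every $M\in\Gamma$ the subgroup of $\mathbb{C}^\times$ generated by the eigenvalues of $M$ is torsion free. For integers $k$, $m\ge 0$, a holomorphic $\phi\colon\mathcal{H}_g\times\mathbb{C}^{(1,g)}\to\mathbb{C}$ and $M=\begin{pmatrix}A&B\\C&D\end{pmatrix}\in\mathrm{Sp}(2g,\mathbb{R})$, put $(\phi|_{k,m}M)(Z,W)=\det(CZ+D)^{-k}e^{-2\pi i m W(CZ+D)^{-1}CW^t}\phi((AZ+B)(CZ+D)^{-1},W(CZ+D)^{-1})$, and for $\lambda,\mu\in\mathbb{Z}^{(1,g)}$, $x\in\mathbb{Z}$, put $(\phi|_{k,m}[(\lambda,\mu),x])(Z,W)=e^{2\pi i m(\lambda Z\lambda^t+2\lambda W^t+x+\mu\lambda^t)}\phi(Z,W+\lambda Z+\mu)$. A Siegel--Jacobi form of weight $k$ and index $m$ for $\Gamma$ is a holomorphic $\phi$ such that (1) $\phi|_{k,m}M=\phi$ for all $M\in\Gamma$;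 (2) $\phi|_{k,m}[(\lambda,\mu),x]=\phi$ for all $\lambda,\mu\in\mathbb{Z}^{(1,g)}$, $x\in\mathbb{Z}$; (3) for every $M\in\mathrm{Sp}(2g,\mathbb{Z})$, $\phi|_{k,m}M$ has a Fourier expansion $\sum_{T}\sum_{R\in\mathbb{Z}^{(g,1)}}c(T,R)e^{2\pi i\,\mathrm{tr}(TZ)/\lambda_\Gamma}e^{2\pi i WR}$, the sum over symmetric positive semidefinite half-integral $T$ (i.e. $2T$ integral with integral diagonal), for some integer $\lambda_\Gamma>0$, such that $c(T,R)\neq 0$ implies $\begin{pmatrix}T/\lambda_\Gamma & R/2\\ R^t/2 & m\end{pmatrix}\ge 0$. $J_{k,m}(\Gamma)$ denotes the complex vector space of such forms. *)

(* Defs.v *)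
From HB Require Import structures.
From mathcomp Require Import all_boot all_order all_algebra.
From mathcomp Require Import all_classical all_reals all_analysis.
From mathcomp Require Import complex.
From Stdlib Require List.
Set Implicit Arguments. Unset Strict Implicit. Unset Printing Implicit Defensive.
Import Order.TTheory GRing.Theory Num.Theory.
Import numFieldNormedType.Exports.
Local Open Scope ring_scope.
Local Open Scope complex_scope.
Local Open Scope classical_set_scope.

Section SiegelJacobi.
Variable R : realType.
Local Notation C := (Num.NumField.sort (R[i])).

Definition cexp (z : C) : C :=
  (expR (complex.Re z))%:C * (cos (complex.Im z) +i* sin (complex.Im z)).
Definition eC (z : C) : C := cexp (((2 * pi : R)%:C) * 'i * z).

Definition posdef n (Y : 'M[R]_n) :=
  forall x : 'rV[R]_n, x != 0 -> 0 < (x *m Y *m x^T) 0 0.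
Definition psd n (Y : 'M[R]_n) :=
  Y^T = Y /\ forall x : 'rV[R]_n, 0 <= (x *m Y *m x^T) 0 0.

Variable g : nat.

Definition siegelH (Z : 'M[C]_g) :=
  Z^T = Z /\ posdef (map_mx (@complex.Im R) Z).

Definition Jmat : 'M[int]_(g + g) := block_mx 0 1%:M (- 1%:M) 0.
Definition in_Sp (M : 'M[int]_(g + g)) := M^T *m Jmat *m M = Jmat.

Definition is_subgroup_Sp (G : 'M[int]_(g + g) -> Prop) :=
  [/\ forall M, G M -> in_Sp M, G 1%:M,
      forall M N, G M -> G N -> G (M *m N) &
      forall M, G M -> G (invmx M)].

Definition finite_index_Sp (G : 'M[int]_(g + g) -> Prop) :=
  exists reps : seq 'M[int]_(g + g),
    (forall h, List.In h reps -> in_Sp h) /\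
    forall M, in_Sp M -> exists h, List.In h reps /\ G (invmx h *m M).

Definition intC (z : int) : C := z%:~R.

(* The subgroup of C^x generated by a set S (of nonzero numbers) consists of
   the finite products of integer powers of elements of S; it is torsion free
   if no element other than 1 has finite order. *)
Definition gen_subgroup_torsion_free (S : C -> Prop) :=
  forall (r : nat) (a : 'I_r -> C) (e : 'I_r -> int), (forall i, S (a i)) ->
    let x := \prod_(i < r) (a i) ^ (e i) in
    forall n : nat, (0 < n)%N -> x ^+ n = 1 -> x = 1.

Definition neat (G : 'M[int]_(g + g) -> Prop) :=
  forall M, G M ->
    gen_subgroup_torsion_free (fun a : C => eigenvalue (map_mx intC M) a).

Definition fn := 'M[C]_g -> 'rV[C]_g -> C.

(* holomorphy on H_g x C^(1,g): continuity plus complex differentiability in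
   each of the independent coordinates Z_ij (i <= j) and W_j (Osgood) *)
Definition holo (phi : fn) :=
  {within [set p : 'M[C]_g * 'rV[C]_g | siegelH p.1],
     continuous (fun p : 'M[C]_g * 'rV[C]_g => phi p.1 p.2)} /\
  forall Z W, siegelH Z ->
    (forall i j : 'I_g,
       derivable (fun t : C => phi (Z + t *: (delta_mx i j + delta_mx j i)) W) 0 1) /\
    (forall j : 'I_g, derivable (fun t : C => phi Z (W + t *: delta_mx 0 j)) 0 1).

Definition slash (k m : nat) (M : 'M[int]_(g + g)) (phi : fn) : fn :=
  fun Z W =>
    let Mc := map_mx intC M in
    let A := ulsubmx Mc in let B := ursubmx Mc in
    let Cm := dlsubmx Mc in let D := drsubmx Mc in
    let CZD := Cm *m Z + D in
    let Ci := invmx CZD in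
    (\det CZD) ^- k * eC (- (m%:R * (W *m Ci *m Cm *m W^T) 0 0))
      * phi ((A *m Z + B) *m Ci) (W *m Ci).

Definition heis (m : nat) (lam mu : 'rV[int]_g) (x : int) (phi : fn) : fn :=
  fun Z W =>
    let l := map_mx intC lam in let u := map_mx intC mu in
    eC (m%:R * ((l *m Z *m l^T) 0 0 + 2 * (l *m W^T) 0 0 + intC x
                 + (u *m l^T) 0 0))
      * phi Z (W + l *m Z + u).

Definition has_sum (I : eqType) (u : I -> C) (s : C) :=
  forall eps : R, 0 < eps -> exists F0 : seq I, forall F : seq I,
    uniq F -> {subset F0 <= F} -> `| \sum_(i <- F) u i - s | < eps%:C.

Definition twice_halfint (N : 'M[int]_g) :=
  N^T = N /\ forall i, (2 %| N i i)%Z.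

Definition intR (z : int) : R := z%:~R.

(* the block matrix ( T/lam  R/2 ; R^t/2  m ), with T = N/2 *)
Definition fourier_block (lam m : nat) (N : 'M[int]_g) (Rv : 'cV[int]_g)
  : 'M[R]_(g + 1) :=
  block_mx (map_mx (fun z => intR z / (2 * lam%:R)) N)
           (map_mx (fun z => intR z / 2) Rv)
           (map_mx (fun z => intR z / 2) Rv^T)
           (m%:R)%:M.

(* psi has a Fourier expansion
     sum_{T,R} c(T,R) e(tr(TZ)/lam) e(W R)
   with c(T,R) <> 0 only for half-integral T with fourier_block >= 0 *)
Definition fourier_cond (m lam : nat) (psi : fn) :=
  exists c : 'M[int]_g -> 'cV[int]_g -> C,
    (forall N Rv, c N Rv != 0 -> twice_halfint N /\ psd (fourier_block lam m N Rv)) /\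
    forall Z W, siegelH Z ->
      has_sum (fun p : 'M[int]_g * 'cV[int]_g =>
                 c p.1 p.2
                 * eC (\tr (map_mx (fun z => intC z / 2) p.1 *m Z) / lam%:R)
                 * eC ((W *m map_mx intC p.2) 0 0))
              (psi Z W).

Definition jacobi_form (G : 'M[int]_(g + g) -> Prop) (k m : nat) (phi : fn) :=
  [/\ holo phi,
      forall M, G M -> forall Z W, siegelH Z -> slash k m M phi Z W = phi Z W,
      forall lam mu x Z W, siegelH Z -> heis m lam mu x phi Z W = phi Z W &
      exists lam : nat, (0 < lam)%N /\
        forall M, in_Sp M -> fourier_cond m lam (slash k m M phi)].

(* elements of the graded algebra  (+)_{l >= 0} J_{lk, lm}(G):
   sequences of forms, almost all zero (functions compared on H_g x C^g) *)
Definition gfn := nat -> fn.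

Definition in_galg (G : 'M[int]_(g + g) -> Prop) (k m : nat) (f : gfn) :=
  (forall l, jacobi_form G (l * k) (l * m) (f l)) /\
  exists N, forall l, (N <= l)%N -> forall Z W, siegelH Z -> f l Z W = 0.

Definition gadd (f h : gfn) : gfn := fun l Z W => f l Z W + h l Z W.
Definition gmul (f h : gfn) : gfn :=
  fun l Z W => \sum_(i < l.+1) f i Z W * h (l - i)%N Z W.
Definition gconst (c : C) : gfn := fun l _ _ => if l == 0%N then c else 0.

Inductive gen_by (gens : seq gfn) : gfn -> Prop :=
| gen_in f : List.In f gens -> gen_by gens f
| gen_const c : gen_by gens (gconst c)
| gen_add f h : gen_by gens f -> gen_by gens h -> gen_by gens (gadd f h)
| gen_mul f h : gen_by gens f -> gen_by gens h -> gen_by gens (gmul f h).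

Definition galg_fin_gen (G : 'M[int]_(g + g) -> Prop) (k m : nat) :=
  exists gens : seq gfn,
    (forall f, List.In f gens -> in_galg G k m f) /\
    forall f, in_galg G k m f -> exists h, gen_by gens h /\
      forall l Z W, siegelH Z -> f l Z W = h l Z W.

End SiegelJacobi.

(* Main.v *)
(** Write e(x) = exp(2 pi i x).  Along Z = i t I, W = v Z with v rational and
t -> oo, the function e(M v Z v^T) phi(Z, v Z) of a form phi of index M has the
expansion sum c(T, R) exp(-2 pi t E(T, R)); positivity of the block matrices gives
E >= |R + 2 M v|^2 / (4 M) >= 0.  It is bounded, and tends to 0 if M > 0 and
2 M v is not integral.  Given finitely many generators, choose v = e_1 / N with N
larger than 2 m times all their degrees: every component of positive degree of an
element of the algebra they generate then tends to 0, since this normalisation is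
multiplicative.

On the other hand, let A(Z, W) be the sum over al, be mod N of
theta[al/N, be/N](Z, W)^(8 N^2 m), a Jacobi form for Sp(2g, Z) of weight and index
4 N^2 m.  Then f(Z, W) = A(Z, m W) A(Z, 0)^(mk - 1) lies in the algebra, in degree
4 N^2 m^2.  Restricting to the path permutes the summands of A(Z, m W), so f becomes
A(i t I, 0)^(mk), which tends to a nonzero constant. *)

Require Import Defs.
From HB Require Import structures.
From mathcomp Require Import all_boot all_order all_algebra.
From mathcomp Require Import all_classical all_reals all_analysis.
From mathcomp Require Import complex.
From mathcomp Require Import ring lra zify.
Set Implicit Arguments. Unset Strict Implicit. Unset Printing Implicit Defensive.
Import Order.TTheory GRing.Theory Num.Theory.
Import numFieldNormedType.Exports.
Local Open Scope ring_scope.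
Local Open Scope complex_scope.
Local Open Scope classical_set_scope.

(** Forms in the algebra have weight and index in the ratio k : m, whereas A has equal weight and
    index. Replacing W by mW multiplies the index by m^2 and keeps the weight; the factor A(Z,
    0)^(mk - 1) then supplies weight alone, and the result is 4N^2m^2 times (k, m). The main
    obstacle is the invariance of A under all of Sp(2g, Z). It is checked on generators:
    translations Z + S, and partial inversions, which affect one lattice coordinate. Splitting the
    lattice sum along that coordinate reduces a partial inversion to Jacobi's inversion of a
    one-variable theta series. Its constant [kappa] arises as a limit of Riemann sums of a Gaussian;
    the scaling kappa(p^2 tau) = p kappa(tau) for odd p forces kappa' = kappa / (2 tau), hence
    kappa^2 / tau is constant, and its value is read off at tau = i. N is taken even because a
    translation by S moves the second characteristic by half the diagonal of S. The limit of A along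
    the path cannot vanish by cancellation, since every theta constant involved tends to 0 or 1. *)

Section ComplexNorm.
Variable R : realType.
Local Notation C := (Num.NumField.sort (R[i])).
Implicit Types (x y z w : C).

(** The norm of [C] takes values in [C], whose order is partial; a real-valued copy gives a total
    order. *)
Definition nrm z : R := complex.Re `|z|.

Lemma nrmE z : `|z| = (nrm z)%:C.
Proof. by rewrite /nrm normc_def. Qed.

Lemma nrm_def z : nrm z = Num.sqrt ((complex.Re z) ^+ 2 + (complex.Im z) ^+ 2).
Proof. by rewrite /nrm normc_def. Qed.

Lemma nrm_ge0 z : 0 <= nrm z.
Proof. by rewrite nrm_def sqrtr_ge0. Qed.

Lemma nrm0 : nrm 0 = 0.
Proof. by rewrite /nrm normr0. Qed.

Lemma nrm1 : nrm 1 = 1.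
Proof. by rewrite /nrm normr1. Qed.

Lemma nrmM z w : nrm (z * w) = nrm z * nrm w.
Proof. by apply: (@complexI R); rewrite -nrmE normrM !nrmE rmorphM. Qed.

Lemma nrmD z w : nrm (z + w) <= nrm z + nrm w.
Proof. by rewrite -lecR rmorphD /= -!nrmE ler_normD. Qed.

Lemma nrmN z : nrm (- z) = nrm z.
Proof. by rewrite /nrm normrN. Qed.

Lemma nrmB z w : nrm (z - w) <= nrm z + nrm w.
Proof. by rewrite -(nrmN w) nrmD. Qed.

Lemma nrm_distC z w : nrm (z - w) = nrm (w - z).
Proof. by rewrite /nrm distrC. Qed.

Lemma nrm_eq0 z : (nrm z == 0) = (z == 0).
Proof.
by rewrite -(inj_eq (@complexI R)) -nrmE; apply: normr_eq0.
Qed.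

Lemma nrm_gt0 z : (0 < nrm z) = (z != 0).
Proof. by rewrite lt_neqAle nrm_ge0 andbT eq_sym nrm_eq0. Qed.

Lemma nrmX z n : nrm (z ^+ n) = nrm z ^+ n.
Proof. by apply: (@complexI R); rewrite -nrmE normrX nrmE rmorphXn. Qed.

Lemma nrmV z : nrm z^-1 = (nrm z)^-1.
Proof. by apply: (@complexI R); rewrite -nrmE normfV nrmE fmorphV. Qed.

Lemma nrm_real (r : R) : nrm r%:C = `|r|.
Proof. by rewrite nrm_def /= expr0n addr0 sqrtr_sqr. Qed.

Lemma nrm_sum (I : Type) (F : seq I) (P : pred I) (u : I -> C) :
  nrm (\sum_(i <- F | P i) u i) <= \sum_(i <- F | P i) nrm (u i).
Proof.
rewrite -lecR -nrmE rmorph_sum /=.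
apply: (le_trans (ler_norm_sum _ _ _)).
by rewrite le_eqVlt; apply/orP; left; apply/eqP; apply: eq_bigr => i _; rewrite nrmE.
Qed.

Lemma nrm_Re z : `|complex.Re z| <= nrm z.
Proof. by rewrite nrm_def -sqrtr_sqr ler_wsqrtr// lerDl sqr_ge0. Qed.

Lemma nrm_Im z : `|complex.Im z| <= nrm z.
Proof. by rewrite nrm_def -sqrtr_sqr ler_wsqrtr// lerDr sqr_ge0. Qed.

Lemma complexRI z : z = (complex.Re z)%:C + 'i * (complex.Im z)%:C.
Proof. exact: complexE. Qed.

Lemma nrm_i : nrm 'i = 1.
Proof. by rewrite nrm_def /= expr0n add0r expr1n sqrtr1. Qed.

Lemma nrm_le_ReIm z : nrm z <= `|complex.Re z| + `|complex.Im z|.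
Proof.
rewrite {1}(complexRI z); apply: (le_trans (nrmD _ _)).
by rewrite nrmM nrm_i mul1r !nrm_real.
Qed.

End ComplexNorm.

(** * Unconditional summation *)

Section Summation.
Variable R : realType.
Local Notation C := (Num.NumField.sort (R[i])).

Definition psum_le (I : eqType) (f : I -> R) (B : R) :=
  forall F : seq I, uniq F -> \sum_(i <- F) f i <= B.

(** Absolute convergence; for complex families it is equivalent to the existence of a [has_sum]
    value, by [summ_has_sum] and [has_sum_summ]. *)
Definition summ (I : eqType) (u : I -> C) :=
  exists B : R, psum_le (fun i => nrm (u i)) B.

Lemma has_sumP (I : eqType) (u : I -> C) s :
  has_sum u s <-> forall e : R, 0 < e -> exists F0 : seq I, forall F : seq I,
    uniq F -> {subset F0 <= F} -> nrm (\sum_(i <- F) u i - s) < e.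
Proof.
by split=> h e e0; have [F0 h0] := h e e0; exists F0 => F uF sF;
  have := h0 F uF sF; rewrite nrmE ltcR.
Qed.

Lemma eq_has_sum (I : eqType) (u v : I -> C) s : u =1 v -> has_sum u s -> has_sum v s.
Proof. by move=> /funext ->. Qed.

Lemma eq_summ (I : eqType) (u v : I -> C) : u =1 v -> summ u -> summ v.
Proof. by move=> /funext ->. Qed.

(** Sums over supersets of [F0] already approximate [s], so a bound on those alone suffices;
    [tannery] needs this freedom. *)
Lemma has_sum_le_from (I : eqType) (u : I -> C) s b (F0 : seq I) : has_sum u s ->
  (forall F, uniq F -> {subset F0 <= F} -> nrm (\sum_(i <- F) u i) <= b) -> nrm s <= b.
Proof.
move=> /has_sumP h hb; apply/ler_addgt0Pl => e e0.
have [F1 h1] := h e e0.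
set F := undup (F0 ++ F1).
have uF : uniq F by exact: undup_uniq.
have s0 : {subset F0 <= F} by move=> i iF; rewrite mem_undup mem_cat iF.
have s1 : {subset F1 <= F} by move=> i iF; rewrite mem_undup mem_cat iF orbT.
have -> : s = (\sum_(i <- F) u i) - (\sum_(i <- F) u i - s) by rewrite opprB addrC subrK.
apply: (le_trans (nrmB _ _)); rewrite addrC; apply: lerD; last exact: hb.
by apply: ltW; apply: h1.
Qed.

Lemma has_sum_le (I : eqType) (u : I -> C) s b : has_sum u s ->
  psum_le (fun i => nrm (u i)) b -> nrm s <= b.
Proof.
move=> hs hb; apply: (@has_sum_le_from _ _ _ _ [::] hs) => F uF _.
by apply: (le_trans (nrm_sum _ _ _)); apply: hb.
Qed.

Lemma has_sumD (I : eqType) (u v : I -> C) s t : has_sum u s -> has_sum v t ->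
  has_sum (fun i => u i + v i) (s + t).
Proof.
move=> /has_sumP hu /has_sumP hv; apply/has_sumP => e e0.
have e2 : 0 < e / 2 by rewrite divr_gt0.
have [F0 h0] := hu _ e2; have [F1 h1] := hv _ e2.
exists (F0 ++ F1) => F uF sF; rewrite big_split /= opprD addrACA.
apply: (le_lt_trans (nrmD _ _)); rewrite (splitr e); apply: ltrD.
  by apply: h0 => // i iF; apply: sF; rewrite mem_cat iF.
by apply: h1 => // i iF; apply: sF; rewrite mem_cat iF orbT.
Qed.

Lemma has_sumZ (I : eqType) (u : I -> C) s c : has_sum u s ->
  has_sum (fun i => c * u i) (c * s).
Proof.
move=> /has_sumP hu; apply/has_sumP => e e0.
have c0 : 0 < nrm c + 1 by rewrite ltr_wpDl ?nrm_ge0.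
have [F0 h0] := hu _ (divr_gt0 e0 c0).
exists F0 => F uF sF; rewrite -mulr_sumr -mulrBr nrmM.
have := h0 F uF sF; rewrite ltr_pdivlMr// => h.
apply: le_lt_trans h; rewrite mulrC ler_wpM2l ?nrm_ge0// lerDl //.
Qed.

Lemma has_sum0 (I : eqType) : has_sum (fun _ : I => 0 : C) 0.
Proof. by apply/has_sumP => e e0; exists [::] => F _ _; rewrite big1// subr0 nrm0. Qed.

Lemma has_sumB (I : eqType) (u v : I -> C) s t : has_sum u s -> has_sum v t ->
  has_sum (fun i => u i - v i) (s - t).
Proof.
move=> hu hv; rewrite -[- t]mulN1r.
by apply: eq_has_sum (has_sumD hu (has_sumZ (-1) hv)) => i; rewrite mulN1r.
Qed.

Lemma has_sum_big (I : eqType) (J : Type) (r : seq J) (u : J -> I -> C) (s : J -> C) :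
  (forall j, has_sum (u j) (s j)) ->
  has_sum (fun i => \sum_(j <- r) u j i) (\sum_(j <- r) s j).
Proof.
move=> h; elim: r => [|j r IH].
  by rewrite big_nil; apply: eq_has_sum (has_sum0 I) => i; rewrite big_nil.
rewrite big_cons; apply: eq_has_sum (has_sumD (h j) IH) => i.
by rewrite big_cons.
Qed.

Lemma has_sum_val (I : eqType) (u : I -> C) s t : has_sum u s -> has_sum u t -> s = t.
Proof.
move=> hs ht; apply/eqP; rewrite -subr_eq0 -nrm_eq0 eq_le nrm_ge0 andbT.
apply: (@has_sum_le_from _ _ _ _ [::] (has_sumB hs ht)) => F _ _.
by rewrite big1 ?nrm0// => i _; rewrite subrr.
Qed.

Lemma summD (I : eqType) (u v : I -> C) : summ u -> summ v -> summ (fun i => u i + v i).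
Proof.
move=> [B hB] [D hD]; exists (B + D) => F uF.
apply: (@le_trans _ _ (\sum_(i <- F) (nrm (u i) + nrm (v i)))).
  by apply: ler_sum => i _; apply: nrmD.
by rewrite big_split; apply: lerD; [apply: hB|apply: hD].
Qed.

Lemma summZ (I : eqType) (u : I -> C) c : summ u -> summ (fun i => c * u i).
Proof.
move=> [B hB]; exists (nrm c * B) => F uF.
rewrite (eq_bigr (fun i => nrm c * nrm (u i))) => [|i _]; last exact: nrmM.
by rewrite -mulr_sumr ler_wpM2l ?nrm_ge0 ?hB.
Qed.

Lemma summ_le (I : eqType) (u : I -> C) (f : I -> R) B :
  (forall i, nrm (u i) <= f i) -> psum_le f B -> summ u.
Proof. by move=> h hB; exists B => F uF; apply: le_trans (hB F uF); apply: ler_sum. Qed.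

Lemma sum_subset (I : eqType) (f : I -> R) (F G : seq I) : (forall i, 0 <= f i) ->
  uniq F -> uniq G -> {subset F <= G} -> \sum_(i <- F) f i <= \sum_(i <- G) f i.
Proof.
move=> f0 uF uG sFG; rewrite (bigID (mem F) _ (r := G)) /=.
have -> : \sum_(i <- G | i \in F) f i = \sum_(i <- F) f i.
  rewrite -big_filter; apply: perm_big; apply: uniq_perm => //; first exact: filter_uniq.
  move=> i; rewrite mem_filter andb_idr //; exact: sFG.
by rewrite lerDl sumr_ge0.
Qed.

Lemma has_sum_pos (I : eqType) (f : I -> R) B : (forall i, 0 <= f i) -> psum_le f B ->
  exists s : R, [/\ has_sum (fun i => (f i)%:C) s%:C, psum_le f s & s <= B].
Proof.
move=> f0 hB.
pose A := [set x | exists F : seq I, uniq F /\ x = \sum_(i <- F) f i].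
have A0 : A !=set0 by exists 0, [::]; rewrite big_nil.
have ubA : ubound A B by move=> x [F [uF ->]]; exact: hB.
have hA : has_sup A by split => //; exists B.
exists (sup A).
have hs : psum_le f (sup A).
  by move=> F uF; apply: ub_le_sup => //; [exists B|exists F].
split => //; last exact: ge_sup.
apply/has_sumP => e e0.
have [x [F0 [uF0 ->]] hx] := sup_adherent e0 hA.
exists F0 => F uF sF; rewrite -rmorph_sum -rmorphB nrm_real.
rewrite ltr_norml; apply/andP; split; last first.
  by apply: le_lt_trans e0; rewrite subr_le0 hs.
rewrite ltrBrDl; apply: lt_le_trans hx _; exact: sum_subset.
Qed.

Lemma psum_le_le (I : eqType) (f h : I -> R) B :
  (forall i, f i <= h i) -> psum_le h B -> psum_le f B.
Proof. by move=> le hB F uF; apply: le_trans (hB F uF); apply: ler_sum. Qed.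

Lemma has_sum_real_ex (I : eqType) (f : I -> R) B : psum_le (fun i => `|f i|) B ->
  exists s : C, has_sum (fun i => (f i)%:C) s.
Proof.
move=> hB.
have p1 i : 0 <= Num.max (f i) 0 by rewrite le_max lexx orbT.
have p2 i : 0 <= Num.max (- f i) 0 by rewrite le_max lexx orbT.
have q1 i : Num.max (f i) 0 <= `|f i| by rewrite ge_max ler_norm normr_ge0.
have q2 i : Num.max (- f i) 0 <= `|f i| by rewrite ge_max -normrN ler_norm normr_ge0.
have [s1 [h1 _ _]] := has_sum_pos p1 (psum_le_le q1 hB).
have [s2 [h2 _ _]] := has_sum_pos p2 (psum_le_le q2 hB).
exists (s1%:C - s2%:C); apply: eq_has_sum (has_sumB h1 h2) => i.
rewrite -rmorphB; congr (_%:C).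
by case: (leP 0 (f i)) => h; rewrite /Num.max; case: ltP; case: ltP; lra.
Qed.

Lemma summ_has_sum (I : eqType) (u : I -> C) : summ u -> exists s, has_sum u s.
Proof.
move=> [B hB].
have [s1 h1] := has_sum_real_ex (psum_le_le (fun i => nrm_Re (u i)) hB).
have [s2 h2] := has_sum_real_ex (psum_le_le (fun i => nrm_Im (u i)) hB).
exists (s1 + 'i * s2); apply: eq_has_sum (has_sumD h1 (has_sumZ 'i h2)) => i.
by rewrite -complexRI.
Qed.

(** Any finite sum differs from one over a superset of [F0] by a sum over a part of [F0], so all
    finite sums are bounded. Splitting by the signs of real and imaginary parts turns this into a
    bound on the sums of norms. *)
Lemma has_sum_summ (I : eqType) (u : I -> C) s : has_sum u s -> summ u.
Proof.
move=> /has_sumP /(_ 1 ltr01) [F0 h0].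
pose D := \sum_(i <- undup F0) nrm (u i).
pose B := nrm s + 1 + D.
have hB F : uniq F -> nrm (\sum_(i <- F) u i) <= B.
  move=> uF; pose G := undup (F0 ++ F).
  have /(h0 G (undup_uniq _)) hG : {subset F0 <= G}.
    by move=> i iF; rewrite mem_undup mem_cat iF.
  have -> : \sum_(i <- F) u i =
     (\sum_(i <- G) u i - s) + s - \sum_(i <- G | i \notin F) u i.
    rewrite subrK; rewrite (bigID (mem F) _ (r := G)) /= addrK.
    rewrite -[RHS]big_filter; apply: perm_big; apply: uniq_perm => //.
      by rewrite filter_uniq// undup_uniq.
    by move=> i; rewrite mem_filter mem_undup mem_cat; case: (i \in F); rewrite ?orbT.
  apply: (le_trans (nrmB _ _)); apply: lerD.
    by apply: (le_trans (nrmD _ _)); rewrite addrC lerD2l ltW.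
  apply: (le_trans (nrm_sum _ _ _)).
  rewrite -big_filter; apply: sum_subset => [i||| i].
  - exact: nrm_ge0.
  - by rewrite filter_uniq// undup_uniq.
  - exact: undup_uniq.
  - by rewrite mem_filter !mem_undup mem_cat => /andP[/negPf ->]; rewrite orbF.
(* [f] is the real or the imaginary part; the indices where it is nonnegative and those where it is
   negative contribute at most [B] each. *)
have hre (f : C -> R) (fD : {morph f : x y / x + y >-> x + y}) (f0 : f 0 = 0) :
    (forall z, `|f z| <= nrm z) -> psum_le (fun i => `|f (u i)|) (B + B).
  move=> fn F uF.
  have fsum (r : seq I) : f (\sum_(i <- r) u i) = \sum_(i <- r) f (u i).
    exact: (big_morph f fD f0).
  rewrite (bigID (fun i => 0 <= f (u i))) /=; apply: lerD.
  - rewrite -big_filter (eq_big_seq (fun i => f (u i))); last first.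
      by move=> i; rewrite mem_filter => /andP[h _]; rewrite ger0_norm.
    rewrite -fsum; apply: le_trans (hB _ (filter_uniq _ uF)).
    by apply: le_trans (fn _); apply: ler_norm.
  - rewrite -big_filter (eq_big_seq (fun i => - f (u i))); last first.
      by move=> i; rewrite mem_filter -ltNge => /andP[h _]; rewrite ltr0_norm.
    rewrite sumrN -fsum; apply: le_trans (hB _ (filter_uniq _ uF)).
    by apply: le_trans (fn _); rewrite -normrN; apply: ler_norm.
have hR := hre (@complex.Re R) (fun x y => ltac:(by case: x; case: y)) erefl (@nrm_Re R).
have hI := hre (@complex.Im R) (fun x y => ltac:(by case: x; case: y)) erefl (@nrm_Im R).
exists ((B + B) + (B + B)) => F uF.
apply: (@le_trans _ _ (\sum_(i <- F) (`|complex.Re (u i)| + `|complex.Im (u i)|))).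
  by apply: ler_sum => i _; apply: nrm_le_ReIm.
by rewrite big_split; apply: lerD; [apply: hR|apply: hI].
Qed.

Definition csum (I : eqType) (u : I -> C) : C := xget 0 [set s | has_sum u s].

Lemma csumP (I : eqType) (u : I -> C) : summ u -> has_sum u (csum u).
Proof. by move=> /summ_has_sum [s hs]; exact: (xgetPex 0 (ex_intro _ s hs)). Qed.

Lemma csumE (I : eqType) (u : I -> C) s : has_sum u s -> csum u = s.
Proof. by move=> hs; apply: has_sum_val (hs); apply: csumP; apply: has_sum_summ hs. Qed.

Lemma eq_csum (I : eqType) (u v : I -> C) : (forall i, u i = v i) -> csum u = csum v.
Proof. by move=> /funext ->. Qed.

Section Reindex.
Variables (I J : eqType) (f : I -> J) (v : J -> C).
Hypothesis injf : injective f.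
Hypothesis v0 : forall j, v j != 0 -> exists i, f i = j.

(** Partial inverse of [f]: [pmap pinv] carries a list over [J] to one over [I], dropping only
    indices outside the image, where [v] vanishes. *)
Let pinv (j : J) : option I :=
  if pselect (exists i, f i = j) is left h then Some (projT1 (cid h)) else None.

Let pinvE i : pinv (f i) = Some i.
Proof.
rewrite /pinv; case: pselect => [h|[]]; last by exists i.
by congr Some; apply: injf; exact: (projT2 (cid h)).
Qed.

Let pinvK j i : pinv j = Some i -> f i = j.
Proof.
by rewrite /pinv; case: pselect => // h [<-]; exact: (projT2 (cid h)).
Qed.

Let sum_pmap (g : C -> R[i]) (G : seq J) : g 0 = 0 ->
  \sum_(j <- G) g (v j) = \sum_(i <- pmap pinv G) g (v (f i)).
Proof.
move=> g0; elim: G => [|j G IH]; first by rewrite !big_nil.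
rewrite big_cons /=; case E: (pinv j) => [i|] /=.
  by rewrite big_cons IH (pinvK E).
rewrite IH; have [/eqP ->|/v0 [i fi]] := boolP (v j == 0); first by rewrite g0 add0r.
by move: E; rewrite -fi pinvE.
Qed.

Let pmap_uniq' G : uniq G -> uniq (pmap pinv G).
Proof.
elim: G => //= j G IH /andP[jG uG]; case E: (pinv j) => [i|] /=; last exact: IH.
rewrite IH// andbT; apply: contra jG; rewrite mem_pmap => /mapP[j' j'G E'].
by rewrite -(pinvK E) (pinvK (esym E')).
Qed.

Lemma has_sum_reindex s : has_sum (v \o f) s -> has_sum v s.
Proof.
move=> /has_sumP h; apply/has_sumP => e e0; have [F0 h0] := h e e0.
exists (map f F0) => G uG sG; rewrite (sum_pmap (g := id))//; apply: h0.
  exact: pmap_uniq'.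
move=> i iF; rewrite mem_pmap; apply/mapP; exists (f i); last by rewrite pinvE.
by apply: sG; apply: map_f.
Qed.

Lemma summ_reindex : summ (v \o f) -> summ v.
Proof.
move=> [B hB]; exists B => G uG.
have := hB _ (pmap_uniq' uG).
have := @sum_pmap (fun z => `|z|) G (normr0 _).
rewrite (eq_bigr (fun j => (nrm (v j))%:C)); last by move=> *; rewrite nrmE.
rewrite [X in _ = X](eq_bigr (fun i => (nrm (v (f i)))%:C)); last by move=> *; rewrite nrmE.
by rewrite -!rmorph_sum => /complexI ->.
Qed.

Lemma summ_comp_inj : summ v -> summ (v \o f).
Proof.
move=> [B hB]; exists B => F uF.
by have := hB (map f F) (ltac:(by rewrite map_inj_uniq)); rewrite big_map.
Qed.

Lemma has_sum_comp_inj s : has_sum v s -> has_sum (v \o f) s.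
Proof.
move=> hs; have hv := summ_comp_inj (has_sum_summ hs).
by have /has_sum_reindex := csumP hv => /(has_sum_val hs) ->; apply: csumP.
Qed.

End Reindex.

Lemma has_sum_bij (I J : eqType) (f : I -> J) (g : J -> I) (v : J -> C) s :
  cancel f g -> cancel g f -> has_sum v s -> has_sum (v \o f) s.
Proof. by move=> fK gK; apply: has_sum_comp_inj (can_inj fK) _ _ => j _; exists (g j). Qed.

(** On a rectangle A x G with A containing the first projection of [F0], the double sum is near [s];
    G is enlarged until the sum of the finitely many rows indexed by A is near its limit. *)
Lemma has_sum_pair (I J : eqType) (w : I * J -> C) (t : I -> C) s :
  has_sum w s -> (forall i, has_sum (fun j => w (i, j)) (t i)) -> has_sum t s.
Proof.
move=> /has_sumP hw ht; apply/has_sumP => e e0.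
have e2 : 0 < e / 2 by rewrite divr_gt0.
have [F0 h0] := hw _ e2; exists (map fst F0) => A uA sA.
have /has_sumP /(_ _ e2) [G0 hG] := has_sum_big A ht.
pose G := undup (G0 ++ map snd F0).
have uG : uniq G by exact: undup_uniq.
have /(hG G uG) h1 : {subset G0 <= G} by move=> j jG; rewrite mem_undup mem_cat jG.
pose F := [seq (i, j) | i <- A, j <- G].
have uF : uniq F by apply: allpairs_uniq => // -[? ?] [? ?] _ _ [-> ->].
have /(h0 F uF) h2 : {subset F0 <= F}.
  move=> [i j] ijF; apply/allpairsP; exists (i, j); split => //=.
    by apply: sA; apply: (map_f fst ijF).
  by rewrite mem_undup mem_cat (map_f snd ijF) orbT.
rewrite big_allpairs /= exchange_big /= in h2.
rewrite -[\sum_(i <- A) t i](subrK (\sum_(i <- G) \sum_(j <- A) w (j, i))).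
rewrite -addrA (splitr e); apply: (le_lt_trans (nrmD _ _)); apply: ltrD => //.
by rewrite nrm_distC.
Qed.

Lemma summM (I J : eqType) (u : I -> C) (v : J -> C) : summ u -> summ v ->
  summ (fun p : I * J => u p.1 * v p.2).
Proof.
move=> [B hB] [D hD]; exists (B * D) => F uF.
have B0 : 0 <= B by have := hB [::] isT; rewrite big_nil.
pose F' := [seq (i, j) | i <- undup (map fst F), j <- undup (map snd F)].
apply: (@le_trans _ _ (\sum_(p <- F') nrm (u p.1 * v p.2))).
  apply: sum_subset => // [p||[i j] ijF]; first exact: nrm_ge0.
    by apply: allpairs_uniq => [||[? ?] [? ?] _ _ [-> ->]//]; exact: undup_uniq.
  apply/allpairsP; exists (i, j); split => //=; rewrite mem_undup.
    exact: (map_f fst ijF).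
  exact: (map_f snd ijF).
rewrite big_allpairs /=.
rewrite (eq_bigr (fun i => nrm (u i) * \sum_(j <- undup (map snd F)) nrm (v j))); last first.
  by move=> i _; rewrite mulr_sumr; apply: eq_bigr => j _; rewrite nrmM.
rewrite -mulr_suml; apply: ler_pM.
- by apply: sumr_ge0 => *; apply: nrm_ge0.
- by apply: sumr_ge0 => *; apply: nrm_ge0.
- by apply: hB; apply: undup_uniq.
- by apply: hD; apply: undup_uniq.
Qed.

(** Two evaluations of the family [u i * t] are compared: summing the product family row by row, and
    scaling the sum of [u]. *)
Lemma has_sumM (I J : eqType) (u : I -> C) (v : J -> C) s t : has_sum u s -> has_sum v t ->
  has_sum (fun p : I * J => u p.1 * v p.2) (s * t).
Proof.
move=> hs ht; have hw := csumP (summM (has_sum_summ hs) (has_sum_summ ht)).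
have h1 : has_sum (fun i => u i * t) (csum (fun p : I * J => u p.1 * v p.2)).
  by apply: has_sum_pair hw _ => i /=; apply: has_sumZ.
have h2 : has_sum (fun i => u i * t) (s * t).
  by rewrite mulrC; apply: eq_has_sum (has_sumZ t hs) => i; rewrite mulrC.
by rewrite (has_sum_val h2 h1).
Qed.

Definition tends0 (x : nat -> C) :=
  forall e : R, 0 < e -> exists N, forall n, (N <= n)%N -> nrm (x n) < e.

Lemma tends0_sum (I : Type) (r : seq I) (x : nat -> I -> C) :
  (forall i, tends0 (x ^~ i)) -> tends0 (fun n => \sum_(i <- r) x n i).
Proof.
move=> h; elim: r => [|i r IH] e e0.
  by exists 0%N => n _; rewrite big_nil nrm0.
have e2 : 0 < e / 2 by rewrite divr_gt0.
have [N1 h1] := h i _ e2; have [N2 h2] := IH _ e2.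
exists (maxn N1 N2) => n; rewrite geq_max => /andP[l1 l2]; rewrite big_cons.
by apply: (le_lt_trans (nrmD _ _)); rewrite (splitr e); apply: ltrD; [apply: h1|apply: h2].
Qed.

(** Dominated convergence for series: outside a finite set [F1] the majorant contributes at most e /
    4, and on [F1] the convergence is termwise. *)
Lemma tannery (I : eqType) (D : I -> R) B (v : nat -> I -> C) (s : nat -> C) :
  psum_le D B -> (forall n i, nrm (v n i) <= D i) -> (forall i, tends0 (v ^~ i)) ->
  (forall n, has_sum (v n) (s n)) -> tends0 s.
Proof.
move=> hB hD hv hs e e0.
have e2 : 0 < e / 2 by rewrite divr_gt0.
have e4 : 0 < e / 2 / 2 by rewrite divr_gt0.
have D0 i : 0 <= D i by apply: le_trans (nrm_ge0 _) (hD 0%N i).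
have [S [/has_sumP hS leS _]] := has_sum_pos D0 hB.
have [F0 h0] := hS _ e4; pose F1 := undup F0.
have [N hN] := tends0_sum F1 hv e4.
exists N => n Nn.
apply: (@le_lt_trans _ _ (nrm (\sum_(i <- F1) v n i) + e / 2 / 2)); last first.
  by have := hN n Nn; have := e4; lra.
apply: (@has_sum_le_from _ _ _ _ F1 (hs n)) => F uF sF.
have s1 : {subset F0 <= F1} by move=> i; rewrite mem_undup.
have := h0 F1 (undup_uniq _) s1.
rewrite -rmorph_sum -rmorphB nrm_real ltr_norml => /andP[+ _] => hF1.
have split_sum (V : nmodType) (z : I -> V) :
    \sum_(i <- F) z i = \sum_(i <- F1) z i + \sum_(i <- F | i \notin F1) z i.
  rewrite (bigID (mem F1)) /=; congr (_ + _).
  rewrite -big_filter; apply: perm_big; apply: uniq_perm; first exact: filter_uniq.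
    exact: undup_uniq.
  by move=> i; rewrite mem_filter andb_idr //; apply: sF.
rewrite split_sum; apply: (le_trans (nrmD _ _)); rewrite lerD2l.
apply: (le_trans (nrm_sum _ _ _)).
apply: (@le_trans _ _ (\sum_(i <- F | i \notin F1) D i)); first exact: ler_sum.
have := leS F uF; rewrite (split_sum _ D) => hF.
by have := e4; lra.
Qed.

End Summation.

(** * The complex exponential *)

Section Exponential.
Variable R : realType.
Local Notation C := (Num.NumField.sort (R[i])).
Implicit Types (x y : R) (z w : C).

Lemma expR_sub1_bound x : `|expR x - 1| <= `|x| * expR `|x|.
Proof.
have h1 := expR_ge1Dx x; have h2 := expR_ge1Dx (- x).
have h3 : 1 <= expR `|x| by rewrite -expR0 ler_expR.
have h4 : expR x <= expR `|x| by rewrite ler_expR ler_norm.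
have h5 : expR x * expR (- x) = 1 by rewrite expRxMexpNx_1.
have h6 := expR_gt0 x.
have [x0|x0] := leP 0 x.
- rewrite ger0_norm; last by lra.
  by rewrite ger0_norm// in h3 h4 *; nra.
- by rewrite ltr0_norm ?expR_lt1 ?subr_lt0 ?expR_lt1// ltr0_norm// in h3 h4 *; nra.
Qed.

Lemma expR_sub1x_bound x : `|expR x - 1 - x| <= x ^+ 2 * expR `|x|.
Proof.
have h1 := expR_ge1Dx x; have h2 := expR_ge1Dx (- x).
have h5 : expR x * expR (- x) = 1 by rewrite expRxMexpNx_1.
have h6 := expR_gt0 x.
have hb : expR x - 1 - x <= x * (expR x - 1) by nra.
have h0 : 0 <= expR x - 1 - x by lra.
rewrite (ger0_norm h0); apply: (le_trans hb).
apply: (le_trans (ler_norm _)); rewrite normrM.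
rewrite -real_normK ?num_real// expr2 -mulrA ler_wpM2l//.
exact: expR_sub1_bound.
Qed.

Lemma sin_le_norm x : `|sin x| <= `|x|.
Proof.
have pos y : 0 < y -> `|sin y| <= y.
  move=> y0.
  have [c _] : exists2 c, c \in `]0, y[%R & sin y - sin 0 = cos c * (y - 0).
    by apply: (@MVT _ sin cos) => //; apply: continuous_subspaceT; exact: continuous_sin.
  rewrite sin0 !subr0 => ->; rewrite normrM (gtr0_norm y0) ler_piMl ?(ltW y0)//.
  exact: cos_max.
have [x0|x0|->] := ltgtP x 0; last by rewrite sin0.
- by rewrite (ltr0_norm x0) -normrN -sinN pos// oppr_gt0.
- by rewrite (gtr0_norm x0) pos.
Qed.

Lemma cos_sub1_bound x : `|cos x - 1| <= x ^+ 2 / 2.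
Proof.
have -> : cos x - 1 = - (2 * sin (x / 2) ^+ 2).
  have -> : cos x = cos ((x / 2) *+ 2) by congr cos; rewrite mulr2n -splitr.
  by rewrite cos_mulr2n cos2sin2 mulr2n; ring.
rewrite normrN normrM normrX (@ger0_norm _ 2)//.
have h := sin_le_norm (x / 2).
have : `|sin (x / 2)| ^+ 2 <= `|x / 2| ^+ 2 by rewrite lerXn2r ?nnegrE.
rewrite (real_normK (num_real (x / 2))).
by have := sqr_ge0 x; lra.
Qed.

Lemma sin_subx_cubic x : 0 <= x -> `|sin x - x| <= x ^+ 3 / 2.
Proof.
rewrite le_eqVlt => /predU1P[<-|x0].
  by rewrite sin0 subrr normr0 expr0n mul0r.
have [c cI] : exists2 c, c \in `]0, x[%R &
    (sin x - x) - (sin 0 - 0) = (cos c - 1) * (x - 0).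
  apply: (@MVT _ (fun t => sin t - t) (fun t => cos t - 1)) => //.
  apply: continuous_subspaceT => t; apply: continuousB; last exact: cvg_id.
  exact: continuous_sin.
rewrite sin0 !subr0 => ->; rewrite normrM (gtr0_norm x0) exprSr mulrAC ler_wpM2r ?(ltW x0)//.
apply: (le_trans (cos_sub1_bound c)); rewrite ler_wpM2r ?invr_ge0//.
move: cI; rewrite in_itv/= => /andP[c0 cx].
by rewrite lerXn2r ?nnegrE ?ltW.
Qed.

Lemma sin_subx_bound x : `|sin x - x| <= x ^+ 2.
Proof.
have pos y : 0 <= y -> `|sin y - y| <= y ^+ 2.
  move=> y0; have [y1|y1] := leP y 2.
    apply: (le_trans (sin_subx_cubic y0)); rewrite exprSr ler_pdivrMr// ler_wpM2l//.
    exact: sqr_ge0.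
  apply: (le_trans (ler_normB _ _)); rewrite (ger0_norm y0).
  by have := sin_max y; nra.
have [x0|x0] := ltP x 0; last exact: pos.
by rewrite -normrN opprD -sinN -(sqrrN x) pos// oppr_ge0 ltW.
Qed.

Lemma cexpD z w : cexp (z + w) = cexp z * cexp w.
Proof.
case: z w => [a b] [c d]; rewrite /cexp /= expRD rmorphM /=.
rewrite cosD sinD mulrACA; congr (_ * _).
by apply/eqP; rewrite eq_complex /=; apply/andP; split; apply/eqP; ring.
Qed.

Lemma cexp0 : cexp (0 : C) = 1.
Proof. by rewrite /cexp /= expR0 cos0 sin0 mul1r. Qed.

Lemma nrm_cexp z : nrm (cexp z) = expR (complex.Re z).
Proof.
by rewrite /cexp nrmM nrm_real nrm_def /= cos2Dsin2 sqrtr1 mulr1 ger0_norm ?expR_ge0.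
Qed.

Lemma cexp_sub1x_bound z : nrm (cexp z - 1 - z) <= 4 * nrm z ^+ 2 * expR (nrm z).
Proof.
case: z => [x y]; set N := nrm (x +i* y).
have xN : `|x| <= N := nrm_Re (x +i* y).
have yN : `|y| <= N := nrm_Im (x +i* y).
have N0 : 0 <= N by apply: nrm_ge0.
(* The four summands of the real and imaginary parts are each at most N^2 e^N, whence the constant
   4. *)
have -> : cexp (x +i* y) - 1 - (x +i* y) =
   (expR x - 1 - x + expR x * (cos y - 1)) +i*
   ((expR x - 1) * sin y + (sin y - y)) :> C.
  rewrite /cexp /=; apply/eqP; rewrite eq_complex /=.
  by apply/andP; split; apply/eqP; ring.
apply: (le_trans (nrm_le_ReIm _)) => /=.
have E : expR `|x| <= expR N by rewrite ler_expR.
have E1 : 1 <= expR N by rewrite -expR0 ler_expR.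
have Ex : expR x <= expR N by rewrite ler_expR (le_trans (ler_norm x)).
have x2 : x ^+ 2 <= N ^+ 2 by rewrite -(real_normK (num_real x)) lerXn2r ?nnegrE.
have y2 : y ^+ 2 <= N ^+ 2 by rewrite -(real_normK (num_real y)) lerXn2r ?nnegrE.
have N2 := sqr_ge0 N.
have b1 : `|expR x - 1 - x| <= N ^+ 2 * expR N.
  apply: (le_trans (expR_sub1x_bound x)).
  by apply: ler_pM; rewrite ?sqr_ge0 ?expR_ge0.
have b2 : `|expR x * (cos y - 1)| <= N ^+ 2 * expR N.
  rewrite normrM (ger0_norm (expR_ge0 x)) mulrC; apply: ler_pM; rewrite ?expR_ge0//.
  by apply: (le_trans (cos_sub1_bound y)); lra.
have b3 : `|(expR x - 1) * sin y| <= N ^+ 2 * expR N.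
  rewrite normrM expr2 -mulrA [N * expR N]mulrC mulrA; apply: ler_pM => //; last first.
    by apply: (le_trans (sin_le_norm y)).
  by apply: (le_trans (expR_sub1_bound x)); apply: ler_pM; rewrite ?expR_ge0.
have b4 : `|sin y - y| <= N ^+ 2 * expR N.
  apply: (le_trans (sin_subx_bound y)); apply: (le_trans y2).
  by rewrite ler_peMr.
apply: (le_trans (lerD (ler_normD _ _) (ler_normD _ _))).
by lra.
Qed.

(** Doubling the rate of the exponential absorbs one power of |z|, so that a bound linear in |z|
    remains. *)
Lemma cexp_sub1_bound z : nrm (cexp z - 1) <= 5 * nrm z * expR (2 * nrm z).
Proof.
have -> : cexp z - 1 = (cexp z - 1 - z) + z by rewrite subrK.
apply: (le_trans (nrmD _ _)).
have h := cexp_sub1x_bound z; have N0 := nrm_ge0 z; set N := nrm z in h N0 *.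
have e1 : 1 <= expR N by rewrite -expR0 ler_expR.
have e2 : expR (2 * N) = expR N * expR N by rewrite -expRD; congr expR; ring.
have e3 := expR_ge1Dx N.
have e4 : N * expR N <= expR (2 * N) by rewrite e2; nra.
have e5 : N ^+ 2 * expR N <= N * expR (2 * N) by rewrite expr2 -mulrA ler_wpM2l.
have e6 : N <= N * expR (2 * N).
  by rewrite ler_peMr// e2; nra.
by lra.
Qed.

Lemma eCD z w : eC (z + w) = eC z * eC w.
Proof. by rewrite /eC mulrDr cexpD. Qed.

Lemma eC0 : eC (0 : C) = 1.
Proof. by rewrite /eC mulr0 cexp0. Qed.

Lemma nrm_eC z : nrm (eC z) = expR (- (2 * pi * complex.Im z)).
Proof.
rewrite /eC nrm_cexp; congr expR; case: z => x y /=.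
by ring.
Qed.

Lemma eC_neq0 z : eC z != 0.
Proof. by rewrite -nrm_gt0 nrm_eC expR_gt0. Qed.

Lemma eCN z : eC (- z) = (eC z)^-1.
Proof.
by apply: (mulIf (eC_neq0 z)); rewrite -eCD addNr eC0 mulVf ?eC_neq0.
Qed.

Lemma eCB z w : eC (z - w) = eC z / eC w.
Proof. by rewrite eCD eCN. Qed.

Lemma eCX z n : eC z ^+ n = eC (n%:R * z).
Proof.
elim: n => [|n IH]; first by rewrite expr0 mul0r eC0.
by rewrite exprS IH -eCD; congr eC; rewrite mulrS mulrDl mul1r.
Qed.

Lemma eC_nat n : eC (n%:R : C) = 1.
Proof.
suff h : eC (1 : C) = 1 by rewrite -[n%:R]mulr1 -eCX h expr1n.
rewrite /eC /cexp /=.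
rewrite (_ : (2 * pi * 0 - 0 * 1) * 1 - (2 * pi * 1 + 0 * 0) * 0 = 0 :> R); last by ring.
rewrite (_ : (2 * pi * 0 - 0 * 1) * 0 + (2 * pi * 1 + 0 * 0) * 1 = pi *+ 2 :> R); last by rewrite mulr2n; ring.
by rewrite expR0 cos2pi sin2pi mul1r.
Qed.

Lemma eC_int (n : int) : eC (n%:~R : C) = 1.
Proof.
case: n => n; first by rewrite -pmulrn eC_nat.
by rewrite NegzE mulrNz eCN -pmulrn eC_nat invr1.
Qed.

Lemma eC_addint z (n : int) : eC (z + n%:~R) = eC z.
Proof. by rewrite eCD eC_int mulr1. Qed.

Lemma eC_eqint z w (n : int) : z - w = n%:~R -> eC z = eC w.
Proof. by move=> h; rewrite -(subrK w z) h addrC eC_addint. Qed.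

Lemma two_pi_gt0 : 0 < 2 * pi :> R.
Proof. by have := pi_gt0 R; lra. Qed.

Lemma nrm_2pii z : nrm ((2 * pi : R)%:C * 'i * z) = 2 * pi * nrm z.
Proof. by rewrite !nrmM nrm_i mulr1 nrm_real ger0_norm// ltW// two_pi_gt0. Qed.

Lemma eC_sub1x_bound z :
  nrm (eC z - 1 - (2 * pi : R)%:C * 'i * z) <= 4 * (2 * pi * nrm z) ^+ 2 * expR (2 * pi * nrm z).
Proof. by rewrite -nrm_2pii; apply: cexp_sub1x_bound. Qed.

Lemma eC_sub1_bound z : nrm (eC z - 1) <= 5 * (2 * pi * nrm z) * expR (2 * (2 * pi * nrm z)).
Proof. by rewrite -nrm_2pii; apply: cexp_sub1_bound. Qed.

(** The norm is 2 |sin(pi x)|. The constant is crude but suffices to bound the symbol of a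
    difference operator from below in [dft_decay] and to separate roots of unity in
    [eC_frac_eq1]. *)
Lemma eC_sub1_ge (x : R) : `|x| <= 2^-1 -> `|x| <= nrm (eC x%:C - 1).
Proof.
move=> hx.
have -> : nrm (eC x%:C - 1 : C) = 2 * `|sin (pi * x)|.
  have -> : eC x%:C - 1 = (cos (pi * x *+ 2) - 1) +i* sin (pi * x *+ 2) :> C.
    rewrite /eC /cexp /=.
    rewrite (_ : (2 * pi * 0 - 0 * 1) * x - (2 * pi * 1 + 0 * 0) * 0 = 0 :> R); last by ring.
    rewrite (_ : (2 * pi * 0 - 0 * 1) * 0 + (2 * pi * 1 + 0 * 0) * x = pi * x *+ 2 :> R);
      last by rewrite mulr2n; ring.
    by rewrite expR0 mul1r; apply/eqP; rewrite eq_complex /= subr0 !eqxx.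
  rewrite nrm_def /= cos_mulr2n sin_mulr2n !mulr2n.
  rewrite (_ : _ + _ = (2 * sin (pi * x)) ^+ 2); last by have := cos2Dsin2 (pi * x); nra.
  by rewrite sqrtr_sqr normrM (@ger0_norm _ 2).
wlog x0 : x hx / 0 <= x.
  move=> H; have [|x0] := leP 0 x; first exact: H.
  have := H (- x); rewrite normrN mulrN sinN normrN; apply => //.
  by rewrite oppr_ge0 ltW.
rewrite ger0_norm// in hx *.
have pi2 := pi_ge2 R; have pi4 := pihalf_lt2 R.
have y0 : 0 <= pi * x by rewrite mulr_ge0// pi_ge0.
have s1 : sin 1 >= 2^-1 :> R.
  by have := @sin_subx_cubic 1 ler01; rewrite ler_norml => /andP[]; rewrite expr1n; lra.
have [y1|y1] := leP (pi * x) 1.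
  have := sin_subx_cubic y0; rewrite ler_norml => /andP[h _].
  have y2 : (pi * x) ^+ 2 <= 1 by nra.
  have y3 : (pi * x) ^+ 3 <= pi * x by rewrite exprS; nra.
  have := ler_norm (sin (pi * x)); have : 2 * x <= pi * x by nra.
  by lra.
have : sin 1 <= sin (pi * x).
  by rewrite leNgt ltr_sin -?leNgt ?ltW// in_itv/=; apply/andP; split; nra.
by have := ler_norm (sin (pi * x)); lra.
Qed.

End Exponential.

(** * Summable majorants and families of exponentials *)

Section Estimates.
Variable R : realType.
Local Notation C := (Num.NumField.sort (R[i])).

Lemma psum_le_int (f : nat -> R) B : (forall n, 0 <= f n) ->
  (forall M, \sum_(i < M) f i <= B) -> psum_le (fun n : int => f `|n|%N) (B + B).
Proof.
move=> f0 hB F uF.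
have key (P : pred int) : {in [pred n | P n] &, injective absz} ->
    \sum_(n <- F | P n) f `|n|%N <= B.
  move=> inj; rewrite -big_filter.
  rewrite -(big_map absz predT f).
  set G := map _ _; have uG : uniq G.
    rewrite map_inj_in_uniq ?filter_uniq// => a b; rewrite !mem_filter.
    by move=> /andP[Pa _] /andP[Pb _]; apply: inj.
  apply: le_trans (hB (\max_(k <- G) k).+1).
  rewrite -(big_mkord predT) /index_iota subn0.
  apply: sum_subset => // [|k kG]; first exact: iota_uniq.
  rewrite mem_iota /= add0n ltnS.
  exact: (leq_bigmax_seq (F := id)).
rewrite (bigID (fun n : int => 0 <= n)) /=; apply: lerD; apply: key.
  by move=> [a|a] [b|b] //= _ _ ->.
by move=> [a|a] [b|b] //= _ _ [->].
Qed.

Lemma geom_le (s : R) M : 0 < s -> \sum_(i < M) expR (- (s * i%:R)) <= 1 + s^-1.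
Proof.
move=> s0; set q := expR (- s).
have q1 : q < 1 by rewrite expR_lt1 oppr_lt0.
have q0 : 0 < q by apply: expR_gt0.
have E i : expR (- (s * i%:R)) = q ^+ i by rewrite -expRM_natr; congr expR; ring.
rewrite (eq_bigr (fun i : 'I_M => q ^+ i)) => [|i _]; last exact: E.
have h : (1 - q) * (\sum_(i < M) q ^+ i) = 1 - q ^+ M.
  by rewrite -[1 in RHS](expr1n _ M) subrXX; congr (_ * _);
    apply: eq_bigr => i _; rewrite expr1n mul1r.
have h1 : (1 - q) * (\sum_(i < M) q ^+ i) <= 1.
  by rewrite h gerBl exprn_ge0// ltW.
have h2 : 1 <= (1 - q) * (1 + s^-1).
  have e1 : q * expR s = 1 by rewrite /q -expRD addNr expR0.
  have e2 := expR_ge1Dx s.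
  have e3 : q * (1 + s) <= 1 by have := ler_wpM2l (ltW q0) e2; rewrite e1.
  have e4 : s^-1 * s = 1 by rewrite mulVf// gt_eqF.
  have e5 : 0 < s^-1 by rewrite invr_gt0.
  by nra.
by rewrite -(ler_pM2l (x := 1 - q)) ?subr_gt0//; apply: le_trans h1 h2.
Qed.

Lemma psum_le_exp_int (s : R) : 0 < s ->
  psum_le (fun n : int => expR (- (s * `|n|%:~R))) (2 * (1 + s^-1)).
Proof.
move=> s0; have := @psum_le_int (fun i => expR (- (s * i%:R))) (1 + s^-1)
  (fun n => expR_ge0 _) (fun M => geom_le M s0).
rewrite mulr2n mulrDl mul1r => h F uF; have := h F uF.
by under eq_bigr do rewrite pmulrn abszE.
Qed.

Lemma psum_le_invsq : psum_le (fun n : int => ((1 + `|n|%:~R : R) ^+ 2)^-1) 4.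
Proof.
have h : psum_le (fun n : int => ((1 + `|n|%N%:R : R) ^+ 2)^-1) (2 + 2).
  apply: (@psum_le_int (fun i => ((1 + i%:R : R) ^+ 2)^-1)) => [n|].
    by rewrite invr_ge0 exprn_ge0.
  (* Telescoping comparison with 1/m - 1/(m+1). *)
  have key M : \sum_(i < M.+1) ((1 + i%:R : R) ^+ 2)^-1 <= 2 - (M.+1%:R)^-1.
    elim: M => [|M IH]; first by rewrite big_ord1 addr0 expr1n invr1; lra.
    rewrite big_ord_recr /=; apply: (le_trans (lerD IH (lexx _))).
    have m0 : 0 < M.+1%:R :> R by [].
    have -> : M.+2%:R = 1 + M.+1%:R :> R by rewrite -nat1r.
    move: m0; set m : R := M.+1%:R => m0.
    have m1 : 0 < 1 + m by lra.
    have E : m^-1 - (1 + m)^-1 = (m * (1 + m))^-1.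
      by field; rewrite !gt_eqF.
    have : ((1 + m) ^+ 2)^-1 <= (m * (1 + m))^-1.
      by rewrite lef_pV2 ?posrE ?mulr_gt0 ?exprn_gt0// expr2 ler_wpM2r ?ltW//; lra.
    rewrite -E; set z := (_ ^+ 2)^-1; set a := m^-1; set b := (1 + m)^-1.
    by move=> h; lra.
  case=> [|M]; first by rewrite big_ord0.
  by apply: (le_trans (key M)); rewrite gerBl invr_ge0.
have -> : 4 = 2 + 2 :> R by lra.
move=> F uF; apply: le_trans (h F uF); rewrite le_eqVlt; apply/orP; left; apply/eqP.
by apply: eq_bigr => n _; rewrite pmulrn abszE.
Qed.

Lemma quad_bound (c d : R) : 0 < c -> exists K : R,
  forall x : R, 0 <= x -> - (c * x ^+ 2) + d * x <= K - x.
Proof.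
move=> c0; exists ((d + 1) ^+ 2 / (4 * c)) => x x0.
rewrite -subr_ge0.
have -> : (d + 1) ^+ 2 / (4 * c) - x - (- (c * x ^+ 2) + d * x) =
  (2 * c * x - (d + 1)) ^+ 2 / (4 * c) by field; rewrite gt_eqF.
by rewrite divr_ge0 ?sqr_ge0// mulr_ge0// ltW.
Qed.

Lemma le_expR_scale (a q : R) : 0 < a -> q <= a^-1 * expR (a * q).
Proof.
move=> a0; rewrite ler_pdivlMl//; have := expR_ge1Dx (a * q); lra.
Qed.

(** Half of the rate [r] pays for the growth of e(d), the other half for the factor [q] in the bound
    on d; hence the condition on [t]. *)
Lemma eC_sub1_weight (r t q : R) (d : C) : 0 < r -> 0 <= q -> 0 <= t ->
  nrm d <= t * q -> 2 * (2 * pi * t) <= r / 2 ->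
  nrm (eC d - 1) <= 5 * (2 * pi) * (2 / r) * t * expR (r * q).
Proof.
move=> r0 q0 t0 hd ht; have p0 := two_pi_gt0 R; apply: (le_trans (eC_sub1_bound d)); move: p0 ht; set p := 2 * pi => p0 ht; clearbody p.
have e1 : expR (2 * (p * nrm d)) <= expR (r / 2 * q).
  rewrite ler_expR; apply: (@le_trans _ _ (2 * (p * t) * q)); last by rewrite ler_wpM2r.
  by have := ler_wpM2l (ltW p0) hd; lra.
have r2 : 0 < r / 2 by rewrite divr_gt0.
have e2 := le_expR_scale q r2.
have -> : expR (r * q) = expR (r / 2 * q) * expR (r / 2 * q).
  by rewrite -expRD; congr expR; lra.
move: e1 e2; have := expR_gt0 (r / 2 * q); set E := expR (r / 2 * q) => E0 e1 e2.
rewrite invf_div in e2.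
have e3 : nrm d <= t * (2 / r * E) by apply: (le_trans hd); rewrite ler_wpM2l.
have -> : 5 * p * (2 / r) * t * (E * E) = 5 * (p * (t * (2 / r * E))) * E by ring.
apply: ler_pM => //; last by rewrite ler_wpM2l// ler_wpM2l// ltW.
by rewrite !mulr_ge0 ?nrm_ge0// ltW.
Qed.

(** The square of d costs two factors [q], each paid by a quarter of the rate; the remaining half
    pays for the growth of e(d). *)
Lemma eC_sub1x_weight (r t q : R) (d : C) : 0 < r -> 0 <= q -> 0 <= t ->
  nrm d <= t * q -> 2 * (2 * pi * t) <= r / 2 ->
  nrm (eC d - 1 - (2 * pi : R)%:C * 'i * d) <=
    4 * (2 * pi) ^+ 2 * (4 / r) ^+ 2 * t ^+ 2 * expR (r * q).
Proof.
move=> r0 q0 t0 hd ht; have p0 := two_pi_gt0 R.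
apply: (le_trans (eC_sub1x_bound d)); move: p0 ht; set p := 2 * pi => p0 ht; clearbody p.
have e1 : expR (p * nrm d) <= expR (r / 2 * q).
  rewrite ler_expR; apply: (@le_trans _ _ (2 * (p * t) * q)); last by rewrite ler_wpM2r.
  have : p * nrm d <= p * (t * q) by rewrite ler_wpM2l// ltW.
  have h0 : 0 <= p * (t * q) by rewrite !mulr_ge0// ltW.
  by move=> h1; lra.
have r2 : 0 < r / 4 by rewrite divr_gt0.
have e2 := le_expR_scale q r2.
have -> : expR (r * q) = expR (r / 4 * q) ^+ 2 * expR (r / 2 * q).
  by rewrite expr2 -!expRD; congr expR; lra.
move: e2; have := expR_gt0 (r / 4 * q); set E := expR (r / 4 * q) => E0 e2.
rewrite invf_div in e2.
have e3 : nrm d <= t * (4 / r * E) by apply: (le_trans hd); rewrite ler_wpM2l.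
rewrite mulrA; apply: ler_pM; rewrite ?expR_ge0//.
  by rewrite mulr_ge0// sqr_ge0.
have -> : 4 * p ^+ 2 * (4 / r) ^+ 2 * t ^+ 2 * E ^+ 2 = 4 * (p * (t * (4 / r * E))) ^+ 2 by ring.
rewrite ler_wpM2l// lerXn2r ?nnegrE ?mulr_ge0 ?nrm_ge0 ?invr_ge0 ?(ltW p0) ?(ltW r0) ?(ltW E0)//.
by rewrite ler_wpM2l// ltW.
Qed.

Lemma derivable_quad (f : C -> C) (D : C) (K r : R) : 0 < r ->
  (forall s : C, nrm s <= r -> nrm (f s - f 0 - s * D) <= K * nrm s ^+ 2) ->
  is_derive (0 : C) (1 : C) f D.
Proof.
move=> r0 hf.
have K0 : 0 <= K.
  have := hf r%:C; rewrite nrm_real (gtr0_norm r0) => /(_ (lexx _)) h.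
  by rewrite -(@pmulr_lge0 _ (r ^+ 2)) ?exprn_gt0//; apply: le_trans (nrm_ge0 _) h.
have cv : (fun h : C => h^-1 *: ((f \o shift 0) (h *: 1) - f 0)) @ 0^' --> D.
  apply/cvgrPdist_le => /= e e0.
  have [a a0 ea] : exists2 a : R, 0 < a & e = a%:C.
    exists (complex.Re e); last by rewrite RRe_real// gtr0_real.
    by move: e0; rewrite ltcE => /andP[].
  have K1 : 0 < K + 1 by lra.
  have dl0 : 0 < Num.min r (a / (K + 1)) by rewrite lt_min r0 divr_gt0.
  exists (Num.min r (a / (K + 1)))%:C; first by rewrite /= ltcR.
  move=> s /=; rewrite sub0r normrN nrmE ltcR => hs s0.
  rewrite addr0 [s *: 1]mulr1 nrmE ea lecR.
  have ns : 0 < nrm s by rewrite nrm_gt0.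
  have -> : D - s^-1 *: (f s - f 0) = - (s^-1 * (f s - f 0 - s * D)).
    by rewrite /GRing.scale /= [in RHS]mulrBr mulKf// opprB.
  rewrite nrmN nrmM nrmV ler_pdivrMl//.
  move: hs; rewrite lt_min => /andP[h1 h2].
  apply: (le_trans (hf s (ltW h1))); rewrite expr2 mulrCA ler_wpM2l ?nrm_ge0//.
  apply: (@le_trans _ _ ((K + 1) * nrm s)); first by rewrite ler_wpM2r ?nrm_ge0//; lra.
  by move: h2; rewrite ltr_pdivlMr// mulrC => /ltW.
by apply: DeriveDef; [apply/cvg_ex; exists D|apply: cvg_lim].
Qed.

Section ExpFamily.
Variables (I : eqType) (u : I -> C) (q : I -> R) (r B : R).
Hypotheses (r0 : 0 < r) (q0 : forall i, 0 <= q i).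
Hypothesis hB : psum_le (fun i => nrm (u i) * expR (r * q i)) B.

(** The weight e^(r q_i) leaves room for multiplying each term by e(d_i) with |d_i| <= t q_i. The
    Lipschitz estimate for theta functions below is an instance. *)
Lemma expfam_le (d : I -> C) (t : R) : 0 <= t -> 2 * (2 * pi * t) <= r / 2 ->
  (forall i, nrm (d i) <= t * q i) ->
  psum_le (fun i => nrm (u i * eC (d i) - u i)) (5 * (2 * pi) * (2 / r) * t * B).
Proof.
move=> t0 ht hd F uF; rewrite -[X in _ <= _ * X]mul1r.
apply: (@le_trans _ _ (\sum_(i <- F) 5 * (2 * pi) * (2 / r) * t * (nrm (u i) * expR (r * q i)))).
  apply: ler_sum => i _; rewrite -[X in nrm (_ - X)]mulr1 -mulrBr nrmM mulrCA.
  by rewrite ler_wpM2l ?nrm_ge0//; apply: eC_sub1_weight.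
rewrite -mulr_sumr mul1r ler_wpM2l ?hB// !mulr_ge0 ?invr_ge0 ?pi_ge0 ?(ltW r0)//.
Qed.

Lemma expfam_summ0 : summ u.
Proof.
apply: summ_le hB => i; rewrite ler_peMr ?nrm_ge0// -expR0 ler_expR.
by rewrite mulr_ge0// ltW.
Qed.

Lemma expfam_summ (d : I -> C) (t : R) : 0 <= t -> 2 * (2 * pi * t) <= r / 2 ->
  (forall i, nrm (d i) <= t * q i) -> summ (fun i => u i * eC (d i)).
Proof.
move=> t0 ht hd; have h : summ (fun i => u i * eC (d i) - u i).
  by eexists; apply: expfam_le ht hd.
by apply: eq_summ (summD h expfam_summ0) => i; rewrite subrK.
Qed.

Lemma expfam_dist (d : I -> C) (t : R) s0 s : 0 <= t -> 2 * (2 * pi * t) <= r / 2 ->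
  (forall i, nrm (d i) <= t * q i) -> has_sum u s0 -> has_sum (fun i => u i * eC (d i)) s ->
  nrm (s - s0) <= 5 * (2 * pi) * (2 / r) * t * B.
Proof.
move=> t0 ht hd h0 h; apply: (has_sum_le (has_sumB h h0)).
exact: expfam_le.
Qed.

(** Termwise differentiation: the second-order remainders are summable against the weight, with
    total O(|s|^2). The radius r / (8 pi) is the condition 2 (2 pi |s|) <= r / 2 solved for |s|. *)
Lemma expfam_derive (b : I -> C) (f : C -> C) :
  (forall i, nrm (b i) <= q i) ->
  (forall s, nrm s <= r / (8 * pi) -> has_sum (fun i => u i * eC (s * b i)) (f s)) ->
  exists D, is_derive (0 : C) (1 : C) f D.
Proof.
move=> hb hf; have p0 := pi_gt0 R.
have r2 : 0 < r / 2 by rewrite divr_gt0.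
have sD : summ (fun i => u i * ((2 * pi : R)%:C * 'i * b i)).
  exists ((2 * pi) * (2 / r) * B) => F uF.
  apply: (@le_trans _ _ (\sum_(i <- F) (2 * pi) * (2 / r) * (nrm (u i) * expR (r * q i)))).
    apply: ler_sum => i _; rewrite nrmM nrm_2pii [leRHS]mulrCA ler_wpM2l ?nrm_ge0//.
    rewrite -[leRHS]mulrA ler_wpM2l ?mulr_ge0 ?(ltW p0)//.
    apply: (le_trans (hb i)); have := le_expR_scale (q i) r2; rewrite invf_div => h.
    apply: (le_trans h); rewrite ler_wpM2l ?divr_ge0 ?(ltW r0)// ler_expR.
    by have := mulr_ge0 (ltW r0) (q0 i); lra.
  by rewrite -mulr_sumr ler_wpM2l ?hB// !mulr_ge0 ?invr_ge0 ?(ltW p0) ?(ltW r0).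
have h0 : has_sum u (f 0).
  apply: eq_has_sum (hf 0 _) => [i|]; first by rewrite mul0r eC0 mulr1.
  by rewrite nrm0 divr_ge0 ?mulr_ge0 ?(ltW r0) ?(ltW p0).
exists (csum (fun i => u i * ((2 * pi : R)%:C * 'i * b i))).
apply: (@derivable_quad f _ (4 * (2 * pi) ^+ 2 * (4 / r) ^+ 2 * B) (r / (8 * pi))).
  by rewrite divr_gt0// mulr_gt0.
move=> s hs.
have ht : 2 * (2 * pi * nrm s) <= r / 2.
  by move: hs; rewrite ler_pdivlMr ?mulr_gt0//; lra.
apply: (has_sum_le (has_sumB (has_sumB (hf s hs) h0) (has_sumZ s (csumP sD)))) => F uF.
apply: (@le_trans _ _ (\sum_(i <- F) (4 * (2 * pi) ^+ 2 * (4 / r) ^+ 2 * nrm s ^+ 2) *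
   (nrm (u i) * expR (r * q i)))).
  apply: ler_sum => i _.
  have -> : u i * eC (s * b i) - u i - s * (u i * ((2 * pi)%:C * 'i * b i)) =
     u i * (eC (s * b i) - 1 - (2 * pi)%:C * 'i * (s * b i)) by ring.
  rewrite nrmM [leRHS]mulrCA ler_wpM2l ?nrm_ge0//; apply: eC_sub1x_weight => //.
    exact: nrm_ge0.
  by rewrite nrmM ler_wpM2l ?nrm_ge0.
rewrite -mulr_sumr [X in _ <= X](_ : _ = 4 * (2 * pi) ^+ 2 * (4 / r) ^+ 2 * nrm s ^+ 2 * B); last by ring.
by rewrite ler_wpM2l ?hB// mulr_ge0 ?sqr_ge0// mulr_ge0 ?sqr_ge0// mulr_ge0 ?sqr_ge0.
Qed.

End ExpFamily.

End Estimates.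

(** * Jacobi inversion in one variable *)

Section Gaussian.
Variable R : realType.
Local Notation C := (Num.NumField.sort (R[i])).

Lemma has_sum_fin (I : eqType) (u : I -> C) (F0 : seq I) : uniq F0 ->
  (forall i, i \notin F0 -> u i = 0) -> has_sum u (\sum_(i <- F0) u i).
Proof.
move=> uF0 h0; apply/has_sumP => e e0; exists F0 => F uF sF.
rewrite (bigID (mem F0) _ (r := F)) /= [X in _ + X - _]big1 ?addr0; last by move=> i /h0.
rewrite -big_filter (_ : \sum_(i <- _) _ = \sum_(i <- F0) u i) ?subrr ?nrm0//.
apply: perm_big; apply: uniq_perm => //; first exact: filter_uniq.
by move=> i; rewrite mem_filter andb_idr//; apply: sF.
Qed.

Definition gau (sg x : C) : C := eC (2^-1 * sg * x ^+ 2).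

Lemma gauD sg x v : gau sg (x + v) = gau sg x * eC (sg * x * v + 2^-1 * sg * v ^+ 2).
Proof. by rewrite /gau -eCD; congr eC; field. Qed.

Lemma nrm_gau_le (sg u : C) (x L : R) : nrm u <= L ->
  nrm (gau sg (u + x%:C)) <=
  expR (- (pi * complex.Im sg * x ^+ 2) + pi * nrm sg * (2 * L * `|x| + L ^+ 2)).
Proof.
move=> hL; rewrite /gau nrm_eC ler_expR.
have -> : 2^-1 * sg * (u + x%:C) ^+ 2 =
   2^-1 * (sg * (x ^+ 2)%:C) + 2^-1 * (sg * (2 * u * x%:C + u ^+ 2)).
  by rewrite rmorphXn /=; field.
have half (z : C) : complex.Im (2^-1 * z) = 2^-1 * complex.Im z.
  have -> : 2^-1 = (2^-1 : R)%:C by rewrite fmorphV /= rmorph_nat.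
  by case: z => a b /=; rewrite mul0r addr0.
rewrite raddfD /= !half.
have -> : complex.Im (sg * (x ^+ 2)%:C) = complex.Im sg * x ^+ 2.
  by case: sg => a b /=; rewrite mulr0 add0r.
set z := sg * _.
have hz : nrm z <= nrm sg * (2 * L * `|x| + L ^+ 2).
  rewrite /z nrmM ler_wpM2l ?nrm_ge0//; apply: (le_trans (nrmD _ _)).
  have L0 : 0 <= L by apply: le_trans (nrm_ge0 _) hL.
  apply: lerD; last by rewrite nrmX lerXn2r ?nnegrE ?nrm_ge0.
  rewrite !nrmM nrm_real ler_wpM2r// (_ : 2 = (2 : R)%:C); last by rewrite rmorph_nat.
  by rewrite nrm_real ger0_norm// ler_wpM2l.
have := nrm_Im z; rewrite ler_norml => /andP[h1 _].
have p0 := pi_gt0 R.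
have : - (pi * complex.Im z) <= pi * (nrm sg * (2 * L * `|x| + L ^+ 2)).
  by rewrite -mulrN ler_wpM2l ?(ltW p0)//; apply: le_trans hz; lra.
by lra.
Qed.

(** The quadratic decay outweighs any linear exponent r |x|, uniformly for [u] in a disc; a factor
    e^(-|x|) is kept for summation over a mesh. *)
Lemma gau_decay (sg : C) (L r : R) : 0 < complex.Im sg -> exists2 K : R, 0 < K &
  forall (u : C) (x : R), nrm u <= L ->
    nrm (gau sg (u + x%:C)) * expR (r * `|x|) <= K * expR (- `|x|).
Proof.
move=> sg0; have p0 := pi_gt0 R.
have [K hK] := @quad_bound R (pi * complex.Im sg) (2 * pi * nrm sg * L + r) (mulr_gt0 p0 sg0).
exists (expR (K + pi * nrm sg * L ^+ 2)); first exact: expR_gt0.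
move=> u x hu; apply: (le_trans (ler_wpM2r (expR_ge0 _) (nrm_gau_le sg x hu))).
rewrite -!expRD ler_expR; have := hK `|x| (normr_ge0 _).
by rewrite real_normK ?num_real//; lra.
Qed.

Definition dgau (sg x : C) : C := gau sg x * ((2 * pi : R)%:C * 'i * (sg * x)).

Lemma gau_taylor (sg : C) (L : R) : 0 < complex.Im sg -> 0 < L -> exists2 K : R, 0 < K &
  forall (u v : C) (x : R), nrm u <= L -> nrm v <= L ->
    nrm (gau sg (u + x%:C + v) - gau sg (u + x%:C) - v * dgau sg (u + x%:C)) <=
    nrm v ^+ 2 * K * expR (- `|x|).
Proof.
move=> sg0 L0; have p0 := pi_gt0 R; have s0 := nrm_ge0 sg.
(* Chosen so that |v| <= L gives 2 (2 pi |v|) <= r / 2, as [eC_sub1x_weight] demands. *)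
pose r := 8 * pi * L.
have r0 : 0 < r by rewrite /r !mulr_gt0.
have [K K0 hK] := gau_decay L (r * nrm sg) sg0.
pose A := 4 * (2 * pi) ^+ 2 * (4 / r) ^+ 2 * expR (r * nrm sg * (2 * L)) + pi * nrm sg.
have hA : 0 <= A.
  apply: addr_ge0; last by apply: mulr_ge0 => //; exact: ltW.
  by apply: mulr_ge0; rewrite ?expR_ge0// mulr_ge0 ?sqr_ge0// mulr_ge0 ?sqr_ge0.
exists (A * K + 1); first by rewrite ltr_wpDl// mulr_ge0// ltW.
move=> u v x hu hv; set y := u + x%:C.
set d := sg * y * v + 2^-1 * sg * v ^+ 2.
have -> : gau sg (y + v) - gau sg y - v * dgau sg y =
   gau sg y * (eC d - 1 - (2 * pi)%:C * 'i * d + (2 * pi)%:C * 'i * (2^-1 * sg * v ^+ 2)).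
  by rewrite gauD -/d /dgau /d; ring.
rewrite nrmM.
pose q := nrm sg * (`|x| + 2 * L).
have q0 : 0 <= q by rewrite /q mulr_ge0// addr_ge0// mulr_ge0// ltW.
have hy : nrm y <= `|x| + L.
  by apply: (le_trans (nrmD _ _)); rewrite nrm_real addrC lerD2l.
have n2 : nrm (2^-1 : C) = 2^-1.
  have -> : 2^-1 = (2^-1 : R)%:C :> C by rewrite fmorphV /= rmorph_nat.
  by rewrite nrm_real ger0_norm.
have hd : nrm d <= nrm v * q.
  rewrite /d; have -> : sg * y * v + 2^-1 * sg * v ^+ 2 = v * (sg * (y + 2^-1 * v)) by ring.
  rewrite nrmM ler_wpM2l ?nrm_ge0// nrmM ler_wpM2l//.
  apply: (le_trans (nrmD _ _)); rewrite nrmM n2.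
  by have := nrm_ge0 v; lra.
have ht : 2 * (2 * pi * nrm v) <= r / 2.
  by rewrite /r; have := ler_wpM2l (ltW p0) hv; lra.
have b1 := @eC_sub1x_weight R r (nrm v) q d r0 q0 (nrm_ge0 v) hd ht.
have b2 : nrm ((2 * pi)%:C * 'i * (2^-1 * sg * v ^+ 2)) = pi * nrm sg * nrm v ^+ 2.
  by rewrite nrm_2pii nrmM [nrm (2^-1 * sg)]nrmM nrmX n2; lra.
set E := expR (r * nrm sg * `|x|).
have E1 : 1 <= E by rewrite -expR0 ler_expR !mulr_ge0// ltW.
have b3 : nrm (eC d - 1 - (2 * pi)%:C * 'i * d + (2 * pi)%:C * 'i * (2^-1 * sg * v ^+ 2))
   <= nrm v ^+ 2 * A * E.
  apply: (le_trans (nrmD _ _)); rewrite b2.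
  apply: (le_trans (lerD b1 (lexx _))).
  have -> : r * q = r * nrm sg * (2 * L) + r * nrm sg * `|x| by rewrite /q; ring.
  rewrite expRD -/E /A.
  have : pi * nrm sg * nrm v ^+ 2 <= pi * nrm sg * nrm v ^+ 2 * E.
    by rewrite ler_peMr// mulr_ge0 ?sqr_ge0// mulr_ge0// ltW.
  by lra.
apply: (le_trans (ler_wpM2l (nrm_ge0 _) b3)).
have := hK u x hu; rewrite -/y -/E => h.
have -> : nrm (gau sg y) * (nrm v ^+ 2 * A * E) = nrm v ^+ 2 * A * (nrm (gau sg y) * E) by ring.
apply: (le_trans (ler_wpM2l _ h)); first by rewrite mulr_ge0// sqr_ge0.
rewrite mulrA ler_wpM2r ?expR_ge0// -mulrA ler_wpM2l ?sqr_ge0//.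
by rewrite lerDl.
Qed.

(** Riemann sum of mesh 1 / (n + 1) for the integral of [gau sg (u + x)] over the real line; the
    integral itself is never formed. *)
Definition rsum (sg : C) (n : nat) (u : C) : C :=
  n.+1%:R^-1 * csum (fun j : int => gau sg (u + (j%:~R / n.+1%:R : R)%:C)).

Lemma mesh_psum (n : nat) (K : R) : 0 <= K ->
  psum_le (fun j : int => K * expR (- `|j%:~R / n.+1%:R : R|)) (K * (4 * n.+1%:R)).
Proof.
move=> K0 F uF; rewrite -mulr_sumr ler_wpM2l//.
have n0 : 0 < n.+1%:R^-1 :> R by rewrite invr_gt0.
have -> : \sum_(i <- F) expR (- `|i%:~R / n.+1%:R : R|) =
          \sum_(i <- F) expR (- (n.+1%:R^-1 * `|i|%:~R)) :> R.
  apply: eq_bigr => i _; rewrite normrM (gtr0_norm n0) mulrC.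
  by rewrite -intr_norm.
apply: (le_trans (psum_le_exp_int n0 uF)); rewrite invrK.
have : 1 <= n.+1%:R :> R by rewrite ler1n.
by lra.
Qed.

Lemma summ_gau (sg u : C) n : 0 < complex.Im sg ->
  summ (fun j : int => gau sg (u + (j%:~R / n.+1%:R : R)%:C)).
Proof.
move=> sg0; have [K K0 hK] := gau_decay (nrm u) 0 sg0.
apply: summ_le (mesh_psum n (ltW K0)) => j.
by have := hK u (j%:~R / n.+1%:R) (lexx _); rewrite mul0r expR0 mulr1.
Qed.

Lemma nrm_natV n : nrm (n.+1%:R^-1 : C) = n.+1%:R^-1.
Proof.
have -> : n.+1%:R^-1 = (n.+1%:R^-1 : R)%:C :> C by rewrite fmorphV /= rmorph_nat.
by rewrite nrm_real ger0_norm.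
Qed.

Lemma mesh_mean_le n (u : int -> C) s (K : R) : 0 <= K -> has_sum u s ->
  (forall j, nrm (u j) <= K * expR (- `|j%:~R / n.+1%:R : R|)) ->
  nrm (n.+1%:R^-1 * s) <= 4 * K.
Proof.
move=> K0 hs hu; rewrite nrmM nrm_natV ler_pdivrMl//.
apply: (le_trans (has_sum_le hs (psum_le_le hu (mesh_psum n K0)))).
by rewrite le_eqVlt; apply/orP; left; apply/eqP; ring.
Qed.

Lemma rsum_bound (sg : C) (L : R) : 0 < complex.Im sg -> exists2 K : R, 0 < K &
  forall n u, nrm u <= L -> nrm (rsum sg n u) <= K.
Proof.
move=> sg0; have [K K0 hK] := gau_decay L 0 sg0; exists (4 * K); first by rewrite mulr_gt0.
move=> n u hu; apply: mesh_mean_le (ltW K0) (csumP (summ_gau u n sg0)) _ => j.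
by have := hK u (j%:~R / n.+1%:R) hu; rewrite mul0r expR0 mulr1.
Qed.

Lemma mesh_step n (j : int) :
  ((j + 1)%:~R / n.+1%:R : R)%:C = (j%:~R / n.+1%:R : R)%:C + n.+1%:R^-1 :> C.
Proof.
by rewrite rmorphD /= mulrDl mul1r rmorphD /= [X in _ + X]fmorphV /= rmorph_nat.
Qed.

Lemma has_sum_shift (u : int -> C) s (k : int) : has_sum u s ->
  has_sum (fun j => u (j + k)) s.
Proof.
by apply: (@has_sum_bij _ _ _ (fun j => j + k) (fun j => j - k)) => j; rewrite ?addrK ?subrK.
Qed.

Lemma rsum_step (sg : C) (L : R) : 0 < complex.Im sg -> 1 <= L -> exists2 K : R, 0 < K &
  forall n u v, nrm u <= L -> nrm v <= L ->
    nrm (rsum sg n (u + v) - rsum sg n u) <= K * (nrm v ^+ 2 + nrm v / n.+1%:R).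
Proof.
move=> sg0 L1; have L0 : 0 < L by lra.
have [K K0 hK] := gau_taylor sg0 L0; exists (4 * K); first by rewrite mulr_gt0.
move=> n u v hu hv.
have Nv : nrm (n.+1%:R^-1 : C) <= L.
  by rewrite nrm_natV; apply: le_trans L1; rewrite invf_le1// ler1n.
have h0 := csumP (summ_gau u n sg0).
have h1 := csumP (summ_gau (u + v) n sg0).
have h2 := has_sum_shift 1 h0.
have := has_sumB (has_sumB h1 h0) (has_sumZ (v * n.+1%:R) (has_sumB h2 h0)).
rewrite subrr mulr0 subr0 => hs.
rewrite /rsum -mulrBr -mulrA; set e := nrm v ^+ 2 + _.
have e0 : 0 <= e by rewrite addr_ge0 ?sqr_ge0// divr_ge0// nrm_ge0.
apply: mesh_mean_le hs _ => [|j]; first by rewrite mulr_ge0// ltW.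
rewrite mesh_step; set x := j%:~R / n.+1%:R.
have -> : u + v + x%:C = u + x%:C + v by ring.
rewrite addrA; set y := u + x%:C.
have Nn0 : n.+1%:R != 0 :> C by rewrite pnatr_eq0.
have -> : gau sg (y + v) - gau sg y - v * n.+1%:R * (gau sg (y + n.+1%:R^-1) - gau sg y) =
  (gau sg (y + v) - gau sg y - v * dgau sg y) - v * n.+1%:R *
  (gau sg (y + n.+1%:R^-1) - gau sg y - n.+1%:R^-1 * dgau sg y) by field.
apply: (le_trans (nrmB _ _)).
have a1 := hK u v x hu hv.
have a2 := hK u n.+1%:R^-1 x hu Nv.
rewrite nrm_natV in a2.
have -> : K * e * expR (- `|x|) = nrm v ^+ 2 * K * expR (- `|x|) +
    nrm v * n.+1%:R * (n.+1%:R^-1 ^+ 2 * K * expR (- `|x|)).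
  have : n.+1%:R != 0 :> R by rewrite pnatr_eq0.
  by rewrite /e; move: (n.+1%:R) => a a0; field.
apply: lerD; first exact: a1.
rewrite nrmM; have -> : nrm (v * n.+1%:R) = nrm v * n.+1%:R.
  rewrite nrmM; congr (_ * _); have -> : n.+1%:R = (n.+1%:R : R)%:C :> C by rewrite rmorph_nat.
  by rewrite nrm_real ger0_norm.
by apply: ler_wpM2l a2; rewrite mulr_ge0 ?nrm_ge0.
Qed.

Lemma tends0_inv (x : nat -> C) (K : R) :
  (forall n, nrm (x n) <= K / n.+1%:R) -> tends0 x.
Proof.
move=> h e e0.
have [N hN] : exists N : nat, K / e < N.+1%:R.
  exists (Num.truncn `|K / e|).+1; apply: (le_lt_trans (ler_norm _)).
  apply: (lt_trans (truncnS_gt _)).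
  by rewrite ltr_nat.
exists N => n Nn; apply: (le_lt_trans (h n)).
rewrite ltr_pdivrMr// -ltr_pdivrMl//; rewrite mulrC.
by apply: (lt_le_trans hN); rewrite ler_nat.
Qed.

(** From 0 to [u] in n + 1 equal steps, each costing O(1 / (n + 1)^2) by [rsum_step]. This replaces
    the shift of contour for the Gaussian integral. *)
Lemma rsum_const (sg u : C) : 0 < complex.Im sg ->
  tends0 (fun n => rsum sg n u - rsum sg n 0).
Proof.
move=> sg0; pose L := nrm u + 1; have u0 := nrm_ge0 u.
have [|K K0 hK] := @rsum_step sg L sg0; first by rewrite /L; lra.
apply: (@tends0_inv _ (K * (L ^+ 2 + L))) => n.
pose v := n.+1%:R^-1 * u.
have hv : nrm v = nrm u / n.+1%:R by rewrite nrmM nrm_natV mulrC.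
have N1 : n.+1%:R^-1 <= 1 :> R by rewrite invf_le1// ler1n.
have Ng : 0 < n.+1%:R^-1 :> R by rewrite invr_gt0.
have step k : (k <= n.+1)%N ->
  nrm (rsum sg n (k%:R * v) - rsum sg n 0) <= k%:R * (K * (L ^+ 2 + L) / n.+1%:R ^+ 2).
  elim: k => [|k IH] kn; first by rewrite !mul0r subrr nrm0.
  have -> : k.+1%:R * v = k%:R * v + v by rewrite -natr1 mulrDl mul1r.
  have -> : k.+1%:R = 1 + k%:R :> R by rewrite nat1r.
  rewrite -[_ - rsum sg n 0](subrKA (rsum sg n (k%:R * v))) mulrDl.
  apply: (le_trans (nrmD _ _)); apply: lerD; last exact: IH (ltnW kn).
  have k1 : nrm (k%:R * v) <= L.
    rewrite nrmM hv; have -> : k%:R = (k%:R : R)%:C :> C by rewrite rmorph_nat.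
    rewrite nrm_real ger0_norm// mulrCA.
    have : k%:R / n.+1%:R <= 1 :> R by rewrite ler_pdivrMr// mul1r ler_nat ltnW.
    move=> h; apply: (@le_trans _ _ (nrm u * 1)); first exact: ler_wpM2l.
    by rewrite /L; lra.
  have v1 : nrm v <= L.
    rewrite hv; apply: (@le_trans _ _ (nrm u * 1)); first exact: ler_wpM2l.
    by rewrite /L; lra.
  apply: (le_trans (hK n _ _ k1 v1)); rewrite mul1r -mulrA ler_wpM2l ?(ltW K0)// hv.
  rewrite -exprVn; set y := n.+1%:R^-1 in N1 Ng *.
  have -> : (nrm u * y) ^+ 2 + nrm u * y * y = (nrm u ^+ 2 + nrm u) * y ^+ 2 by ring.
  by rewrite ler_wpM2r ?sqr_ge0// /L; nra.
have Nv : n.+1%:R * v = u by rewrite /v mulrA mulfV ?pnatr_eq0// mul1r.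
have := step n.+1 (leqnn _); rewrite Nv => h.
apply: (le_trans h); rewrite le_eqVlt; apply/orP; left; apply/eqP.
have : n.+1%:R != 0 :> R by rewrite pnatr_eq0.
by move: (n.+1%:R) => a a0; field.
Qed.

End Gaussian.

(** * Poisson summation for the Gaussian *)

Section Poisson.
Variable R : realType.
Local Notation C := (Num.NumField.sort (R[i])).

Definition upper (tau : C) := 0 < complex.Im tau.

Lemma upper_neq0 tau : upper tau -> tau != 0.
Proof. by move=> h; apply/eqP => t0; move: h; rewrite /upper t0 /= ltxx. Qed.

Lemma upper_ninv tau : upper tau -> upper (- tau^-1).
Proof.
rewrite /upper; case: tau => a b /= b0.
rewrite opprK divr_gt0//.
by rewrite ltr_wpDl ?sqr_ge0// exprn_gt0.
Qed.

Lemma int_realC (n : int) : (n%:~R : C) = (n%:~R : R)%:C.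
Proof. by rewrite rmorph_int. Qed.

Lemma nat_realC (n : nat) : (n%:R : C) = (n%:R : R)%:C.
Proof. by rewrite rmorph_nat. Qed.

Lemma nrm_nat n : nrm (n%:R : C) = n%:R.
Proof. by rewrite nat_realC nrm_real ger0_norm. Qed.

Lemma nrm_int (n : int) : nrm (n%:~R : C) = `|n|%:~R.
Proof. by rewrite int_realC nrm_real intr_norm. Qed.

Definition th1 (tau w : C) (n : int) : C := eC (2^-1 * tau * n%:~R ^+ 2 + n%:~R * w).

Lemma th1_gau tau w n : upper tau -> th1 tau w n = gau tau (w / tau + n%:~R) * eC (- (2^-1 * w ^+ 2 / tau)).
Proof.
by move=> /upper_neq0 t0; rewrite /th1 /gau -eCD; congr eC; field.
Qed.

Lemma gau_weight (sg w : C) : upper sg -> exists2 r : R, 0 < r & exists B : R,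
  psum_le (fun n : int => nrm (gau sg (w + n%:~R)) * expR (r * (1 + (n%:~R) ^+ 2))) B.
Proof.
move=> sg0; have p0 := pi_gt0 R.
have c0 : 0 < pi * complex.Im sg / 2 by rewrite divr_gt0// mulr_gt0.
have [K hK] := @quad_bound R _ (2 * pi * nrm sg * nrm w) c0.
exists (pi * complex.Im sg / 2) => //.
exists (expR (K + pi * nrm sg * nrm w ^+ 2 + pi * complex.Im sg / 2) * (4 * 1%:R)).
apply: psum_le_le (@mesh_psum R 0 _ (expR_ge0 _)) => n; rewrite divr1.
have := nrm_gau_le sg (n%:~R) (lexx (nrm w)); rewrite -int_realC => h.
apply: (le_trans (ler_wpM2r (expR_ge0 _) h)).
rewrite -!expRD ler_expR; have := hK `|n%:~R| (normr_ge0 _).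
by rewrite real_normK ?num_real//; lra.
Qed.

Lemma th1_weight (tau w : C) : upper tau -> exists2 r : R, 0 < r & exists B : R,
  psum_le (fun n : int => nrm (th1 tau w n) * expR (r * (1 + (n%:~R) ^+ 2))) B.
Proof.
move=> t0; have [r r0 [B hB]] := gau_weight (w / tau) t0.
exists r => //; exists (nrm (eC (- (2^-1 * w ^+ 2 / tau))) * B) => F uF.
rewrite (eq_bigr (fun n : int => nrm (eC (- (2^-1 * w ^+ 2 / tau))) *
   (nrm (gau tau (w / tau + n%:~R)) * expR (r * (1 + n%:~R ^+ 2))))).
  by rewrite -mulr_sumr ler_wpM2l ?nrm_ge0 ?hB.
by move=> n _; rewrite th1_gau// nrmM; ring.
Qed.

Lemma summ_th1 tau w : upper tau -> summ (th1 tau w).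
Proof.
move=> t0; have [r r0 [B hB]] := th1_weight w t0.
by apply: expfam_summ0 hB => // n; rewrite addr_ge0// sqr_ge0.
Qed.

Lemma summ_gau1 sg w : upper sg -> summ (fun n : int => gau sg (w + n%:~R)).
Proof.
move=> t0; have [r r0 [B hB]] := gau_weight w t0.
by apply: expfam_summ0 hB => // n; rewrite addr_ge0// sqr_ge0.
Qed.

Definition theta1 tau w : C := csum (th1 tau w).
(** The periodisation of a Gaussian, whose Fourier series is to be compared with [theta1 tau]. *)
Definition gsum tau w : C := csum (fun r : int => gau (- tau^-1) (w + r%:~R)).

Lemma eC_frac_eq1 (N : nat) (k : int) : (0 < N)%N ->
  eC (k%:~R / N%:R : C) = 1 -> (N%:Z %| k)%Z.
Proof.
move=> N0 h.
have NR : N%:R != 0 :> C by rewrite pnatr_eq0 -lt0n.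
have NR' : 0 < N%:R :> R by rewrite ltr0n.
have N0z : N%:Z != 0 by rewrite eqz_nat -lt0n.
apply/dvdz_mod0P.
set r := (k %% N%:Z)%Z.
have r0 : 0 <= r by apply: modz_ge0.
have rN : r < N%:Z by apply: ltz_pmod.
have h1 : eC (r%:~R / N%:R : C) = 1.
  rewrite -[RHS]h; apply: (@eC_eqint _ _ _ (- (k %/ N%:Z)%Z)).
  have kE : k%:~R = (k %/ N%:Z)%Z%:~R * N%:R + r%:~R :> C.
    by rewrite {1}(divz_eq k N%:Z) rmorphD rmorphM.
  by rewrite kE rmorphN; field.
(* A representative of absolute value at most N / 2 stays in the range of [eC_sub1_ge]; either r or
   r - N is one. *)
have key (s : int) : eC (s%:~R / N%:R : C) = 1 -> `|s| *+ 2 <= N%:Z -> s = 0.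
  move=> e1 s2.
  have E : (s%:~R / N%:R : C) = (s%:~R / N%:R : R)%:C.
    by rewrite rmorphM /= fmorphV /= rmorph_nat rmorph_int.
  have := @eC_sub1_ge R (s%:~R / N%:R).
  rewrite -E e1 subrr nrm0 normrM (gtr0_norm (x := N%:R^-1)) ?invr_gt0//.
  rewrite -intr_norm ler_pdivrMr// => h2.
  have : `|s|%:~R / N%:R <= 0 :> R.
    have h3 : (`|s| *+ 2)%:~R <= N%:Z%:~R :> R by rewrite ler_int.
    by apply: h2; move: h3; rewrite rmorphMn /= mulr2n -pmulrn; lra.
  rewrite pmulr_lle0 ?invr_gt0//.
  by rewrite (_ : 0 = 0%:~R)// ler_int normr_le0 => /eqP.
have [r2|r2] := leP (r *+ 2) N%:Z.
  by apply: key h1 _; rewrite ger0_norm.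
have : r - N%:Z = 0; last by lia.
apply: key; last by lia.
rewrite -[RHS]h1; apply: (@eC_eqint _ _ _ (-1)).
by rewrite rmorphB /= -pmulrn; field.
Qed.

Lemma sum_eC_frac (N : nat) (k : int) : (0 < N)%N ->
  \sum_(i < N) eC (k%:~R * i%:R / N%:R : C) = if (N%:Z %| k)%Z then N%:R else 0.
Proof.
move=> N0; have NR : N%:R != 0 :> C by rewrite pnatr_eq0 -lt0n.
set z := eC (k%:~R / N%:R : C).
have E i : eC (k%:~R * i%:R / N%:R : C) = z ^+ i by rewrite /z eCX; congr eC; field.
rewrite (eq_bigr (fun i : 'I_N => z ^+ i)) => [|i _]; last exact: E.
case: ifP => hk.
  have -> : z = 1.
    have /dvdzP [q kE] := hk; rewrite /z kE rmorphM /= -pmulrn mulfK//; exact: eC_int.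
  rewrite (eq_bigr (fun _ => 1)) => [|i _]; last exact: expr1n.
  by rewrite sumr_const card_ord.
have z1 : z != 1 by apply/eqP => /(eC_frac_eq1 N0); rewrite hk.
have zN : z ^+ N = 1 by rewrite /z eCX mulrCA mulfV// mulr1 eC_int.
apply: (mulfI (x := z - 1)); first by rewrite subr_eq0.
by rewrite mulr0 -subrX1 zN subrr.
Qed.

Section Fixed.
Variable tau : C.
Hypothesis tau0 : upper tau.
Let sg := - tau^-1.
Let sg0 : upper sg. Proof. exact: upper_ninv. Qed.
Let t0 : tau != 0. Proof. exact: upper_neq0. Qed.

(* The Riemann sum of mesh 1 / N.+1 for the n-th Fourier coefficient of the
   periodic function w |-> gsum tau w. *)
Definition dft (N : nat) (w : C) (n : int) : C :=
  N.+1%:R^-1 * csum (fun j : int => gau sg (w + (j%:~R / N.+1%:R : R)%:C) *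
                                    eC (- (n%:~R * j%:~R / N.+1%:R))).

Lemma mesh_C (j : int) N : (j%:~R / N.+1%:R : R)%:C = j%:~R / N.+1%:R :> C.
Proof. by rewrite rmorphM /= fmorphV /= rmorph_nat rmorph_int. Qed.

(** Completing the square: a character times a Gaussian is a Gaussian shifted by the complex number
    n tau, and the factor left over is a theta term. Thus the Fourier coefficients of [gsum] are
    theta terms times Riemann sums whose dependence on n disappears in the limit. *)
Lemma gau_char (w x : C) (n : int) :
  gau sg (w + x) * eC (- (n%:~R * x)) = th1 tau w n * gau sg (w + n%:~R * tau + x).
Proof. by rewrite /gau /th1 -!eCD; congr eC; rewrite /sg; field. Qed.

Lemma dftE N w n : dft N w n = th1 tau w n * rsum sg N (w + n%:~R * tau).
Proof.
rewrite /dft /rsum mulrCA; congr (_ * _); apply: csumE.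
apply: eq_has_sum (has_sumZ (th1 tau w n) (csumP (summ_gau (w + n%:~R * tau) N sg0))) => j.
by rewrite -gau_char mesh_C; congr (_ * eC (- _)); rewrite mulrA.
Qed.

Lemma has_sum_dft N w n : has_sum (fun j : int => gau sg (w + (j%:~R / N.+1%:R : R)%:C) *
    eC (- (n%:~R * j%:~R / N.+1%:R))) (N.+1%:R * dft N w n).
Proof.
rewrite /dft mulrA mulfV ?pnatr_eq0// mul1r; apply: csumP.
apply: eq_summ (summZ (th1 tau w n) (summ_gau (w + n%:~R * tau) N sg0)) => j.
by rewrite -gau_char mesh_C; congr (_ * eC (- _)); rewrite mulrA.
Qed.

(* Summation by parts, twice. *)
Lemma dft_decay w : exists2 K : R, 0 < K & forall M n, `|n| <= M%:Z ->
  nrm (dft M.*2 w n) <= K * ((1 + `|n|%:~R) ^+ 2)^-1.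
Proof.
have [K1 K10 hK1] := @rsum_bound R sg (nrm w) sg0.
have L0 : 0 < nrm w + 1 by rewrite ltr_wpDl ?nrm_ge0.
have [K K0 hK] := gau_taylor sg0 L0.
exists (K1 + 32 * K) => [|M n nM]; first by rewrite addr_gt0// mulr_gt0.
have [->|n0] := eqVneq n 0.
  rewrite normr0 addr0 expr1n invr1 mulr1 dftE mul0r addr0.
  have -> : th1 tau w 0 = 1 by rewrite /th1 mul0r expr0n mulr0 addr0 eC0.
  by rewrite mul1r; apply: (le_trans (hK1 _ _ (lexx _))); rewrite lerDl mulr_ge0// ltW.
set N := M.*2; set c := dft N w n.
have NR : N.+1%:R != 0 :> C by rewrite pnatr_eq0.
pose a j := gau sg (w + (j%:~R / N.+1%:R : R)%:C).
pose z := eC (- (n%:~R / N.+1%:R) : C).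
pose ch (j : int) := eC (- (n%:~R * j%:~R / N.+1%:R) : C).
have hs := has_sum_dft N w n; rewrite -/c in hs.
have chD j k : ch (j + k) = ch j * ch k.
  by rewrite /ch -eCD; congr eC; rewrite rmorphD /=; field.
have h1 := has_sum_shift 1 hs.
have h2 := has_sum_shift (-1) hs.
have z0 : z != 0 by apply: eC_neq0.
have c1 : ch 1 = z by rewrite /ch mulr1.
have c2 : ch (-1) = z^-1 by rewrite /ch /z -eCN; congr eC; field.
(* The symbol of the second difference. As |n| <= M, the quotient n / (2M + 1) is at most 1/2 in
   absolute value, where [eC_sub1_ge] applies. *)
have hz : nrm (z - 2 + z^-1) >= (`|n|%:~R / N.+1%:R) ^+ 2.
  have -> : z - 2 + z^-1 = (z - 1) ^+ 2 / z by field.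
  have nz : nrm z = 1.
    rewrite /z nrm_eC (_ : complex.Im _ = 0) ?mulr0 ?oppr0 ?expR0//.
    have -> : - (n%:~R / N.+1%:R) = (- (n%:~R / N.+1%:R) : R)%:C :> C.
      by rewrite rmorphN /= mesh_C.
    by [].
  rewrite nrmM nrmV nz invr1 mulr1 nrmX lerXn2r ?nnegrE ?nrm_ge0 ?divr_ge0//.
  have := @eC_sub1_ge R (- (n%:~R / N.+1%:R)).
  rewrite rmorphN /= mesh_C -/z normrN normrM (gtr0_norm (x := N.+1%:R^-1)) ?invr_gt0//.
  rewrite intr_norm; apply; rewrite ler_pdivrMr//.
  rewrite -intr_norm.
  have h : `|n|%:~R <= M%:Z%:~R :> R by rewrite ler_int.
  rewrite -pmulrn in h; apply: (le_trans h).
  have -> : N.+1%:R = M%:R + M%:R + 1 :> R by rewrite /N -addnn -addn1 !natrD.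
  by lra.
have hd := has_sumD (has_sumB (has_sumZ z h2) (has_sumZ 2 hs)) (has_sumZ z^-1 h1).
have hd' : has_sum (fun j => (a (j - 1) - 2 * a j + a (j + 1)) * ch j)
   ((z - 2 + z^-1) * (N.+1%:R * c)).
  rewrite 2!mulrDl mulNr; apply: eq_has_sum hd => j.
  rewrite -!/(ch _) -!/(a _).
  by rewrite !chD c1 c2; field.
have bd : nrm ((z - 2 + z^-1) * (N.+1%:R * c)) <= 2 * K / N.+1%:R ^+ 2 * (4 * N.+1%:R).
  have K20 : 0 <= 2 * K / N.+1%:R ^+ 2 by rewrite divr_ge0 ?sqr_ge0// mulr_ge0// ltW.
  apply: (has_sum_le hd') => F uF; apply: le_trans (mesh_psum N K20 uF).
  apply: ler_sum => j _; rewrite nrmM.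
  have -> : nrm (ch j) = 1.
    rewrite /ch nrm_eC (_ : complex.Im _ = 0) ?mulr0 ?oppr0 ?expR0//.
    have -> : - (n%:~R * j%:~R / N.+1%:R) = (- ((n * j)%:~R / N.+1%:R) : R)%:C :> C.
      by rewrite rmorphN /= mesh_C rmorphM.
    by [].
  rewrite mulr1 /a mesh_step.
  have -> : ((j - 1)%:~R / N.+1%:R : R)%:C = (j%:~R / N.+1%:R : R)%:C - N.+1%:R^-1 :> C.
    by have := @mesh_step R N (j - 1); rewrite subrK => ->; rewrite addrK.
  set x := j%:~R / N.+1%:R; rewrite !addrA; set y := w + x%:C.
  (* The first-order Taylor terms at the two neighbours cancel. *)
  have -> : gau sg (y - N.+1%:R^-1) - 2 * gau sg y + gau sg (y + N.+1%:R^-1) =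
   (gau sg (y - N.+1%:R^-1) - gau sg y - (- N.+1%:R^-1) * dgau sg y) +
   (gau sg (y + N.+1%:R^-1) - gau sg y - N.+1%:R^-1 * dgau sg y) by ring.
  apply: (le_trans (nrmD _ _)).
  have w1 : nrm w <= nrm w + 1 by rewrite lerDl.
  have i1 : nrm (N.+1%:R^-1 : C) <= nrm w + 1.
    rewrite nrm_natV; apply: (@le_trans _ _ 1); first by rewrite invf_le1// ler1n.
    by rewrite lerDr nrm_ge0.
  have i2 : nrm (- N.+1%:R^-1 : C) <= nrm w + 1 by rewrite nrmN.
  apply: (le_trans (lerD (hK w _ x w1 i2) (hK w _ x w1 i1))).
  rewrite nrmN nrm_natV le_eqVlt; apply/orP; left; apply/eqP.
  have : N.+1%:R != 0 :> R by rewrite pnatr_eq0.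
  by move: (N.+1%:R) => b b0; field.
move: bd; rewrite nrmM nrmM nrm_nat.
have nR : 1 <= `|n|%:~R :> R by rewrite ler1z -gtz0_ge1 normr_gt0.
move: hz nR; set m : R := `|n|%:~R; have : 0 < N.+1%:R :> R by [].
move: (N.+1%:R) (nrm (z - 2 + z^-1)) (nrm c) (nrm_ge0 c) => b y cc cc0 b0 hz m1 h.
have b0' : b != 0 by rewrite gt_eqF.
have h3 : (m / b) ^+ 2 * (b * cc) <= 8 * K / b.
  apply: (@le_trans _ _ (y * (b * cc))).
    by apply: ler_wpM2r => //; rewrite mulr_ge0// ltW.
  by apply: (le_trans h); rewrite le_eqVlt; apply/orP; left; apply/eqP; field.
have h4 : m ^+ 2 * cc <= 8 * K.
  have -> : m ^+ 2 * cc = ((m / b) ^+ 2 * (b * cc)) * b by field.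
  have -> : 8 * K = (8 * K / b) * b by field.
  by apply: ler_wpM2r => //; exact: ltW.
rewrite ler_pdivlMr; last by rewrite exprn_gt0//; lra.
have h5 : (1 + m) ^+ 2 <= 4 * m ^+ 2 by nra.
apply: (le_trans (ler_wpM2l cc0 h5)).
by lra.
Qed.

(** Finite Fourier inversion: the sum over all 2M + 1 frequencies keeps only the mesh points that
    are integers. An odd number of points makes the range -M, ..., M of frequencies symmetric. *)
Lemma dft_total M w : \sum_(i < M.*2.+1) dft M.*2 w (i%:Z - M%:Z) = gsum tau w.
Proof.
set N := M.*2.
have NR : N.+1%:R != 0 :> C by rewrite pnatr_eq0.
pose v (j : int) : C := if (N.+1%:Z %| j)%Z then
  N.+1%:R * gau sg (w + (j%:~R / N.+1%:R : R)%:C) else 0.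
have h1 : has_sum v (\sum_(i < N.+1) N.+1%:R * dft N w (i%:Z - M%:Z)).
  apply: eq_has_sum (has_sum_big _ (fun i : 'I_N.+1 => has_sum_dft N w (i%:Z - M%:Z))) => j.
  rewrite -mulr_sumr /v.
  have E (i : 'I_N.+1) : eC (- ((i%:Z - M%:Z)%:~R * j%:~R / N.+1%:R)) =
     eC (M%:R * (j%:~R / N.+1%:R)) * eC ((- j)%:~R * i%:R / N.+1%:R) :> C.
    rewrite -eCD; congr eC; rewrite rmorphB rmorphN /= -!pmulrn; ring.
  rewrite (eq_bigr _ (fun i _ => E i)) -mulr_sumr sum_eC_frac//.
  rewrite (_ : (N.+1%:Z %| - j)%Z = (N.+1%:Z %| j)%Z); last by rewrite !dvdzE abszN.
  case: ifP => [/dvdzP [q ->]|_]; last by rewrite !mulr0.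
  have qE : (q * N.+1%:Z)%:~R / N.+1%:R = q%:~R :> C by rewrite intrM mulfK.
  rewrite qE (_ : eC (M%:R * q%:~R) = 1) ?mul1r 1?mulrC//.
  by rewrite pmulrn -intrM eC_int.
have h2 : has_sum v (N.+1%:R * gsum tau w).
  apply: (@has_sum_reindex _ _ _ (fun r : int => N.+1%:Z * r)).
  - by move=> a b; apply: mulfI.
  - by move=> j; rewrite /v; case: ifP => [/dvdzP [q ->]|]; [exists q; rewrite mulrC|rewrite eqxx].
  apply: eq_has_sum (has_sumZ N.+1%:R (csumP (summ_gau1 w sg0))) => r /=.
  rewrite /v dvdz_mulr ?dvdzz//; congr (_ * gau _ (_ + _)).
  by rewrite mesh_C rmorphM /= -pmulrn mulrC mulKf.
have := has_sum_val h1 h2; rewrite -mulr_sumr; exact: mulfI.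
Qed.

(** Each coefficient is a theta term times a Riemann sum, which may be taken at 0 by [rsum_const];
    [dft_decay] supplies the majorant for [tannery]. *)
Lemma poisson_lim w :
  tends0 (fun M => gsum tau w - rsum sg M.*2 0 * theta1 tau w).
Proof.
have [K K0 hK] := dft_decay w.
have [K1 K10 hK1] := @rsum_bound R sg 0 sg0.
have [B hB] := summ_th1 w tau0.
pose v M (n : int) := (if `|n| <= M%:Z then dft M.*2 w n else 0) -
  rsum sg M.*2 0 * th1 tau w n.
have n00 : nrm (0 : C) <= 0 by rewrite nrm0.
apply: (@tannery R _ (fun n : int => K * ((1 + `|n|%:~R) ^+ 2)^-1 + K1 * nrm (th1 tau w n))
  (K * 4 + K1 * B) v).
- move=> F uF; rewrite big_split -!mulr_sumr; apply: lerD.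
    by rewrite ler_wpM2l ?(ltW K0)// psum_le_invsq.
  by rewrite ler_wpM2l ?(ltW K10)// hB.
- move=> M n; rewrite /v; apply: (le_trans (nrmB _ _)); apply: lerD.
    case: ifP => [|_]; first exact: hK.
    by rewrite nrm0 mulr_ge0 ?(ltW K0)// invr_ge0 sqr_ge0.
  by rewrite nrmM ler_wpM2r ?nrm_ge0// hK1.
- move=> n e e0.
  have d0 : 0 < nrm (th1 tau w n) + 1 by rewrite ltr_wpDl ?nrm_ge0.
  have [N hN] := @rsum_const R sg (w + n%:~R * tau) sg0 _ (divr_gt0 e0 d0).
  exists (maxn N `|n|%N) => M; rewrite geq_max => /andP[NM nM].
  rewrite /v ifT; last by rewrite -abszE lez_nat.
  rewrite dftE [rsum sg M.*2 0 * _]mulrC -mulrBr nrmM.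
  have M2 : (M <= M.*2)%N by rewrite -addnn leq_addr.
  have := hN M.*2 (leq_trans NM M2).
  rewrite ltr_pdivlMr// => h; apply: le_lt_trans h.
  by rewrite mulrC ler_wpM2l ?nrm_ge0// lerDl.
- move=> M; apply: has_sumB; last by apply: has_sumZ; apply: csumP; apply: summ_th1.
  rewrite -(dft_total M w); set N := M.*2.
  pose F0 := [seq i%:Z - M%:Z | i <- iota 0 N.+1].
  have uF0 : uniq F0 by rewrite map_inj_uniq ?iota_uniq// => a b /addIr [].
  have inF0 (n : int) : (n \in F0) = (`|n| <= M%:Z).
    apply/mapP/idP => [[k]|h].
      by rewrite mem_iota /N /= => hk ->; lia.
    by exists (absz (n + M%:Z)); rewrite ?mem_iota /N; lia.
  have off n : n \notin F0 -> (if `|n| <= M%:Z then dft N w n else 0) = 0.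
    by rewrite inF0 => /negPf ->.
  have := has_sum_fin uF0 off.
  rewrite (eq_big_seq (fun n => dft N w n)); last by move=> n; rewrite inF0 => ->.
  by rewrite big_map -[iota 0 _]/(index_iota 0 N.+1) big_mkord.
Qed.

(** Eliminating the common factor [rsum] between the approximations at [w] and [w'] avoids having to
    know that the Riemann sums converge. *)
Lemma gsum_theta_cross w w' : gsum tau w * theta1 tau w' = gsum tau w' * theta1 tau w.
Proof.
apply/eqP; rewrite -subr_eq0 -nrm_eq0 eq_le nrm_ge0 andbT.
apply/ler_addgt0Pl => e e0; rewrite addr0.
pose a := nrm (theta1 tau w) + nrm (theta1 tau w') + 1.
have a0 : 0 < a by rewrite ltr_wpDl// addr_ge0 ?nrm_ge0.
have [N1 h1] := poisson_lim w (divr_gt0 e0 a0).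
have [N2 h2] := poisson_lim w' (divr_gt0 e0 a0).
pose M := maxn N1 N2.
have {}h1 := h1 M (leq_maxl _ _); have {}h2 := h2 M (leq_maxr _ _).
set r := rsum sg M.*2 0 in h1 h2.
have -> : gsum tau w * theta1 tau w' - gsum tau w' * theta1 tau w =
  (gsum tau w - r * theta1 tau w) * theta1 tau w' -
  (gsum tau w' - r * theta1 tau w') * theta1 tau w by ring.
apply: (le_trans (nrmB _ _)); rewrite !nrmM.
move: h1 h2; rewrite !ltr_pdivlMr//.
rewrite /a; move: (nrm_ge0 (theta1 tau w)) (nrm_ge0 (theta1 tau w')).
move: (nrm_ge0 (gsum tau w - r * theta1 tau w)) (nrm_ge0 (gsum tau w' - r * theta1 tau w')).
set x1 := nrm (theta1 tau w); set x2 := nrm (theta1 tau w').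
set x3 := nrm (gsum tau w - _); set x4 := nrm (gsum tau w' - _) => p3 p4 p1 p2 h1 h2.
clearbody x1 x2 x3 x4.
have [h|h] := leP x3 x4; first by have := ler_wpM2r p2 h; lra.
by have := ler_wpM2r p1 (ltW h); lra.
Qed.

(** The mean of [theta1] over the points j / (N + 1) retains only the coefficients of index
    divisible by N + 1, and tends to the one of index 0, which is 1. *)
Lemma theta1_neq0 : exists w, theta1 tau w != 0.
Proof.
apply: contrapT => hn.
have hz w : theta1 tau w = 0 by apply: contrapT => /eqP h; apply: hn; exists w.
have [B hB] := summ_th1 0 tau0.
have key : tends0 (fun N => \sum_(j < N.+1) N.+1%:R^-1 * theta1 tau (j%:R / N.+1%:R) - 1).
  pose v (N : nat) (n : int) := th1 tau 0 n *
     ((if (N.+1%:Z %| n)%Z then 1 else 0) - (if n == 0 then 1 else 0)).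
  apply: (@tannery R _ (fun n => 2 * nrm (th1 tau 0 n)) (2 * B) v).
  - by move=> F uF; rewrite -mulr_sumr ler_wpM2l// hB.
  - move=> N n; rewrite /v nrmM mulrC ler_wpM2r ?nrm_ge0//.
    apply: (le_trans (nrmB _ _)).
    by do 2 case: ifP => _; rewrite ?nrm0 ?nrm1; lra.
  - move=> n e e0; exists `|n|%N => N nN; rewrite /v.
    case: ifP => [/dvdzP [q nq]|hN]; case: ifP => [/eqP n0|n0].
    + by rewrite subrr mulr0 nrm0.
    + by exfalso; have : q != 0 by [apply/eqP => q0; move: n0; rewrite nq q0 mul0r eqxx]; nia.
    + by move: hN; rewrite n0 dvdz0.
    + by rewrite subrr mulr0 nrm0.
  - move=> N; rewrite /v.
    have NR : N.+1%:R != 0 :> C by rewrite pnatr_eq0.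
    apply: (eq_has_sum (u := fun n => (\sum_(j < N.+1) N.+1%:R^-1 * th1 tau (j%:R / N.+1%:R) n)
       - (if n == 0 then 1 else 0))).
      move=> n; rewrite mulrBr; congr (_ - _); last first.
        by case: eqP => [->|_]; rewrite ?mulr0// /th1 mulr0 addr0 expr0n mulr0 eC0 mulr1.
      rewrite -mulr_sumr.
      have E (j : 'I_N.+1) : th1 tau (j%:R / N.+1%:R) n =
           th1 tau 0 n * eC (n%:~R * j%:R / N.+1%:R).
        by rewrite /th1 -eCD mulr0 addr0; congr eC; field.
      rewrite (eq_bigr _ (fun j _ => E j)) -mulr_sumr sum_eC_frac// mulrCA.
      by case: ifP => _; rewrite ?mulr0// mulVf.
    apply: has_sumB.
      by apply: has_sum_big => j; apply: has_sumZ; apply: csumP; apply: summ_th1.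
    have := @has_sum_fin R _ (fun n : int => if n == 0 then 1 else 0) [:: 0] isT.
    by rewrite big_seq1 eqxx; apply => i; rewrite inE => /negPf ->.
have [N hN] := key 1 ltr01; have := hN N (leqnn _).
by rewrite big1 ?sub0r ?nrmN ?nrm1 ?ltxx// => j _; rewrite hz mulr0.
Qed.

End Fixed.
End Poisson.

(** * The constant of the inversion formula *)

Section Kappa.
Variable R : realType.
Local Notation C := (Num.NumField.sort (R[i])).

(* The constant in gsum tau w = kappa tau * theta1 tau w (0 if there is none). *)
Definition kappa (tau : C) : C := xget 0 [set c | forall w, gsum tau w = c * theta1 tau w].

Lemma gsum_kappa tau : upper tau -> forall w, gsum tau w = kappa tau * theta1 tau w.
Proof.
move=> t0; apply: (xgetPex 0 (P := [set c | forall w, gsum tau w = c * theta1 tau w])).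
have [w0 hw0] := theta1_neq0 t0.
exists (gsum tau w0 / theta1 tau w0) => w /=.
by rewrite mulrAC (gsum_theta_cross t0 w0 w) mulfK.
Qed.

(** Convergence of the Riemann sums, along even indices, comes out by dividing [poisson_lim] by a
    nonzero value of [theta1]; [kappa tau] is thus the Gaussian integral of parameter -1 / tau. *)
Lemma rsum_kappa tau : upper tau ->
  tends0 (fun M => rsum (- tau^-1) M.*2 0 - kappa tau).
Proof.
move=> t0; have [w0 hw0] := theta1_neq0 t0; move=> e e0.
have n0 : 0 < nrm (theta1 tau w0) by rewrite nrm_gt0.
have [N hN] := poisson_lim t0 w0 (mulr_gt0 e0 n0).
exists N => M NM; have := hN M NM; rewrite gsum_kappa// -mulrBl nrmM.
by rewrite ltr_pM2r// nrm_distC.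
Qed.

Lemma tends0_val (x : nat -> C) (a b : C) :
  tends0 (fun n => x n - a) -> tends0 (fun n => x n - b) -> a = b.
Proof.
move=> ha hb; apply/eqP; rewrite -subr_eq0 -nrm_eq0 eq_le nrm_ge0 andbT.
apply/ler_addgt0Pl => e e0; rewrite addr0.
have e2 : 0 < e / 2 by rewrite divr_gt0.
have [N1 h1] := ha _ e2; have [N2 h2] := hb _ e2.
have {}h1 := h1 _ (leq_maxl N1 N2); have {}h2 := h2 _ (leq_maxr N1 N2).
have -> : a - b = (x (maxn N1 N2) - b) - (x (maxn N1 N2) - a) by ring.
by apply: (le_trans (nrmB _ _)); rewrite (splitr e) lerD// ltW.
Qed.

Lemma upper_scale (tau : C) (r : R) : 0 < r -> upper tau -> upper (r%:C * tau).
Proof.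
by move=> r0; rewrite /upper; case: tau => a b /= b0; rewrite mul0r addr0 mulr_gt0.
Qed.

(** Rescaling of the variable in the Gaussian integral, done on meshes: 2M + 1 subdivisions for p^2
    tau match p (2M + 1) for tau. Oddness of [p] keeps the latter of the form 2M' + 1, as
    [rsum_kappa] requires. *)
Lemma kappa_scale tau (p : nat) : upper tau -> odd p ->
  kappa ((p ^ 2)%:R * tau) = p%:R * kappa tau.
Proof.
move=> t0 op; have p0 : (0 < p)%N by case: p op.
have pC : p%:R != 0 :> C by rewrite pnatr_eq0 -lt0n.
have t0' := upper_neq0 t0.
have t1 : upper ((p ^ 2)%:R * tau).
  by rewrite nat_realC; apply: upper_scale; rewrite ?ltr0n ?expn_gt0 ?p0.
pose q M := ((p * M.*2.+1).-1)./2.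
have qE M : (q M).*2.+1 = (p * M.*2.+1)%N.
  rewrite /q; have : odd (p * M.*2.+1) by rewrite oddM op /= odd_double.
  by lia.
have E M : rsum (- ((p ^ 2)%:R * tau)^-1) M.*2 0 = p%:R * rsum (- tau^-1) (q M).*2 0.
  have MR : M.*2.+1%:R != 0 :> C by rewrite pnatr_eq0.
  rewrite /rsum mulrA; congr (_ * _).
    by rewrite qE natrM invfM mulVKf.
  apply: (congr1 (@csum R _)); apply: funext => j; rewrite /gau !add0r !(mesh_C R) qE natrM natrX; congr eC.
  by move: MR; move: (M.*2.+1%:R : C) => m MR; field; rewrite MR t0' pC.
apply: (tends0_val (rsum_kappa t1)) => e e0.
have pR : 0 < p%:R :> R by rewrite ltr0n.
have [N hN] := rsum_kappa t0 (divr_gt0 e0 pR).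
exists N => M NM; rewrite E -mulrBr nrmM nrm_nat mulrC -ltr_pdivlMr//.
apply: hN; apply: (leq_trans NM); have := qE M; nia.
Qed.

Lemma complex_pos (e : C) : 0 < e -> exists2 a : R, 0 < a & e = a%:C.
Proof.
move=> e0; exists (complex.Re e); last by rewrite RRe_real// gtr0_real.
by move: e0; rewrite ltcE => /andP[].
Qed.

Lemma is_derive_eps (f : C -> C) D : is_derive (0 : C) (1 : C) f D ->
  forall e : R, 0 < e -> exists2 d : R, 0 < d &
    forall t, nrm t < d -> nrm (f t - f 0 - t * D) <= e * nrm t.
Proof.
case=> df Df e e0.
have cv : (fun h : C => h^-1 *: ((f \o shift 0) (h *: 1) - f 0)) @ 0^' --> D.
  by rewrite -Df; exact: df.
have eC0' : 0 < e%:C :> C by rewrite ltcR.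
have /cvgrPdist_le /(_ _ eC0') [/= d' d'0 hd] := cv.
have [d d0 dE] := complex_pos d'0; exists d => // t td.
have [->|t0] := eqVneq t 0; first by rewrite subrr sub0r mul0r oppr0 !nrm0 mulr0.
have := hd t; rewrite /= sub0r normrN nrmE dE ltcR => /(_ td t0).
rewrite addr0 [t *: 1]mulr1 nrmE lecR.
have -> : D - t^-1 *: (f t - f 0) = - (t^-1 * (f t - f 0 - t * D)).
  by rewrite /GRing.scale /= [in RHS]mulrBr mulKf// opprB.
have nt : 0 < nrm t by rewrite nrm_gt0.
by rewrite nrmN nrmM nrmV ler_pdivrMl// [nrm t * e]mulrC.
Qed.

Lemma derivable_cont_eps (f : C -> C) D : is_derive (0 : C) (1 : C) f D -> f 0 != 0 ->
  exists2 d : R, 0 < d & forall t, nrm t < d -> f t != 0.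
Proof.
move=> df f0; have [d d0 hd] := is_derive_eps df ltr01.
have n0 : 0 < nrm (f 0) by rewrite nrm_gt0.
have K0 : 0 < nrm D + 1 by rewrite ltr_wpDl ?nrm_ge0.
exists (Num.min d (nrm (f 0) / (nrm D + 1))); first by rewrite lt_min d0 divr_gt0.
move=> t; rewrite lt_min => /andP[/hd h1]; rewrite ltr_pdivlMr// => h2.
apply/eqP => ft0; move: h1; rewrite ft0 sub0r mul1r => h1.
have : nrm (f 0) <= nrm (- f 0 - t * D) + nrm (t * D).
  by rewrite -[X in nrm X <= _]opprK nrmN -[X in nrm X <= _](subrK (t * D)) nrmD.
by rewrite nrmM; have := nrm_ge0 t; lra.
Qed.

Lemma theta1_derive tau w : upper tau ->
  exists D, is_derive (0 : C) (1 : C) (fun t => theta1 (tau + t) w) D.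
Proof.
move=> t0; have [r r0 [B hB]] := th1_weight w t0.
have q0 (n : int) : 0 <= 1 + n%:~R ^+ 2 :> R by rewrite addr_ge0// sqr_ge0.
have hb (n : int) : nrm (2^-1 * n%:~R ^+ 2 : C) <= 1 + n%:~R ^+ 2.
  rewrite nrmM nrmX nrm_int intr_norm real_normK ?num_real//.
  have -> : nrm (2^-1 : C) = 2^-1 by rewrite (nrm_natV R 1).
  by have := sqr_ge0 (n%:~R : R); lra.
apply: (expfam_derive r0 q0 hB hb) => s hs.
have E : (fun n => th1 tau w n * eC (s * (2^-1 * n%:~R ^+ 2))) = th1 (tau + s) w.
  by apply: funext => n; rewrite /th1 -eCD; congr eC; ring.
rewrite /theta1 -E; apply: csumP.
apply: (@expfam_summ R _ _ _ r B r0 q0 hB _ (nrm s)); first exact: nrm_ge0.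
  by move: hs; rewrite ler_pdivlMr ?mulr_gt0 ?pi_gt0//; lra.
by move=> n; rewrite nrmM ler_wpM2l ?nrm_ge0.
Qed.

Lemma gau_derive sg w : upper sg ->
  exists D, is_derive (0 : C) (1 : C)
    (fun s => csum (fun r : int => gau (sg + s) (w + r%:~R))) D.
Proof.
move=> t0; have [r r0 [B hB]] := gau_weight w t0.
pose c := 1 + nrm w ^+ 2.
have c0 : 0 < c by rewrite /c ltr_pwDl// sqr_ge0.
pose q (n : int) : R := c * (1 + n%:~R ^+ 2).
have q0 n : 0 <= q n by rewrite mulr_ge0 ?(ltW c0)// addr_ge0// sqr_ge0.
have hB' : psum_le (fun n : int => nrm (gau sg (w + n%:~R)) * expR (r / c * q n)) B.
  move=> F uF; apply: le_trans (hB F uF); rewrite le_eqVlt; apply/orP; left; apply/eqP.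
  by apply: eq_bigr => n _; rewrite /q mulrA divfK// gt_eqF.
have rc0 : 0 < r / c by rewrite divr_gt0.
have hb (n : int) : nrm (2^-1 * (w + n%:~R) ^+ 2 : C) <= q n.
  rewrite nrmM nrmX; have -> : nrm (2^-1 : C) = 2^-1 by rewrite (nrm_natV R 1).
  have h := nrmD w (n%:~R : C); rewrite nrm_int intr_norm in h.
  have h1 : nrm (w + n%:~R) ^+ 2 <= (nrm w + `|n%:~R|) ^+ 2.
    by rewrite lerXn2r ?nnegrE ?nrm_ge0// addr_ge0 ?nrm_ge0.
  have h2 : `|n%:~R| ^+ 2 = (n%:~R : R) ^+ 2 by rewrite real_normK ?num_real.
  pose m : R := `|n%:~R|; pose b := nrm w; rewrite -/m -/b in h1 h2.
  rewrite /q /c -h2 -/b; clearbody m b.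
  have e1 := sqr_ge0 (b - m); have e2 := mulr_ge0 (sqr_ge0 b) (sqr_ge0 m).
  have e3 := sqr_ge0 b; have e4 := sqr_ge0 m.
  by move: h1 e1; rewrite sqrrD sqrrB mulr2n; lra.
apply: (expfam_derive rc0 q0 hB' hb) => s hs.
have E : (fun n : int => gau sg (w + n%:~R) * eC (s * (2^-1 * (w + n%:~R) ^+ 2))) =
   (fun n : int => gau (sg + s) (w + n%:~R)).
  by apply: funext => n; rewrite /gau -eCD; congr eC; ring.
rewrite -E; apply: csumP.
apply: (@expfam_summ R _ _ _ (r / c) B rc0 q0 hB' _ (nrm s)); first exact: nrm_ge0.
  by move: hs; rewrite ler_pdivlMr ?mulr_gt0 ?pi_gt0//; lra.
by move=> n; rewrite nrmM ler_wpM2l ?nrm_ge0.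
Qed.

Lemma derivable_shift0 (tau : C) : is_derive (0 : C) (1 : C) (fun t : C => tau + t) 1.
Proof.
apply: (@derivable_quad R _ 1 0 1 ltr01) => s _.
by rewrite addr0 mulr1 [tau + s]addrC addrK subrr nrm0 mul0r.
Qed.

Lemma gsum_derivable tau w : upper tau ->
  derivable (fun t : C => gsum (tau + t) w) 0 1.
Proof.
move=> t0; have [D dg] := gau_derive w (upper_ninv t0).
have E : (fun t : C => gsum (tau + t) w) =
  (fun s => csum (fun r : int => gau (- tau^-1 + s) (w + r%:~R))) \o
  (fun t : C => tau^-1 - (tau + t)^-1).
  by apply: funext => t; rewrite /gsum /=; congr csum; apply: funext => r; rewrite addKr.
rewrite E; apply/derivable1_diffP; apply: differentiable_comp.
  apply/derivable1_diffP; have ds := derivable_shift0 tau.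
  apply: derivableB; first exact: derivable_cst.
  by apply: derivableV; [rewrite addr0 upper_neq0|case: ds].
rewrite addr0 subrr; apply/derivable1_diffP.
by case: dg.
Qed.

Lemma upper_open tau : upper tau -> exists2 d : R, 0 < d &
  forall t, nrm t < d -> upper (tau + t).
Proof.
rewrite /upper => t0; exists (complex.Im tau) => // t ht.
rewrite raddfD /=; have := nrm_Im t; rewrite ler_norml => /andP[h _].
by lra.
Qed.

(** One and the same [w] keeps [theta1] nonzero near [tau], so [kappa] is locally the quotient of
    [gsum] by [theta1] at that [w]. *)
Lemma kappa_loc tau : upper tau -> exists f : C -> C, exists2 D, is_derive (0 : C) (1 : C) f D &
  exists2 d : R, 0 < d & forall t, nrm t < d -> f t = kappa (tau + t).
Proof.
move=> t0; have [w hw] := theta1_neq0 t0.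
have [D1 h1] := theta1_derive w t0.
have h10 : theta1 (tau + 0) w != 0 by rewrite addr0.
have [d1 d10 hd1] := derivable_cont_eps h1 h10.
have [d2 d20 hd2] := upper_open t0.
pose f (t : C) : C := gsum (tau + t) w / theta1 (tau + t) w.
have df : derivable f 0 1.
  apply: derivableM; first exact: gsum_derivable.
  by apply: derivableV => //; case: h1.
exists f; exists ('D_1 f 0); first exact: DeriveDef.
exists (Num.min d1 d2); first by rewrite lt_min d10.
move=> t; rewrite lt_min => /andP[/hd1 ht1 /hd2 ht2].
by rewrite /f gsum_kappa// mulfK.
Qed.

(** Since the derivative exists by [kappa_loc], one sequence determines it. For rho a quotient of
    odd numbers, [kappa_scale] gives kappa(rho^2 tau) = rho kappa(tau); the difference quotient
    between tau and rho^2 tau is kappa / ((rho + 1) tau), and rho is made to tend to 1. *)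
Lemma kappa_ode tau : upper tau -> exists f : C -> C,
  is_derive (0 : C) (1 : C) f (kappa tau / (2 * tau)) /\
  exists2 d : R, 0 < d & forall t, nrm t < d -> f t = kappa (tau + t).
Proof.
move=> t0; have [f [D hD [d d0 hd]]] := kappa_loc t0.
exists f; split; last by exists d.
suff -> : kappa tau / (2 * tau) = D by [].
have t00 := upper_neq0 t0.
have f0 : f 0 = kappa tau by rewrite hd ?addr0 ?nrm0.
(* Consecutive odd numbers: their quotient is 1 + 2 / q_n. *)
pose p (n : nat) := n.*2.+3; pose q (n : nat) := n.*2.+1.
have opq n : odd (p n) /\ odd (q n) by rewrite /p /q /= !odd_double.
pose rho n : C := (p n)%:R / (q n)%:R.
have q0 n : (q n)%:R != 0 :> C by rewrite pnatr_eq0.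
have qR n : (q n)%:R != 0 :> R by rewrite pnatr_eq0.
have kr n : kappa (rho n ^+ 2 * tau) = rho n * kappa tau.
  have [op oq] := opq n.
  pose s : C := ((q n ^ 2)%:R)^-1 * tau.
  have us : upper s.
    by rewrite /s nat_realC -fmorphV; apply: upper_scale; rewrite ?invr_gt0 ?ltr0n ?expn_gt0.
  have := kappa_scale us op; have := kappa_scale us oq.
  have -> : (q n ^ 2)%:R * s = tau by rewrite /s mulrA mulfV ?mul1r// pnatr_eq0 expn_eq0.
  move=> ->; have -> : (p n ^ 2)%:R * s = rho n ^+ 2 * tau.
    by rewrite /s /rho !natrX; field.
  by move=> ->; rewrite /rho mulrA divfK.
have rhoE n : rho n = 1 + (2 / (q n)%:R : R)%:C.
  rewrite rmorphM /= fmorphV /= !rmorph_nat /rho.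
  have -> : (p n)%:R = (q n)%:R + 2 :> C by rewrite /p /q -[n.*2.+3]addn2 natrD.
  by field.
have qlarge (e : R) : 0 < e -> exists n, 2 / (q n)%:R < e.
  move=> e0; exists (Num.truncn (2 / e)).+1.
  have h1 := truncnS_gt (2 / e).
  have h2 : (Num.truncn (2 / e)).+1%:R <= (q (Num.truncn (2 / e)).+1)%:R :> R.
    by rewrite ler_nat /q -addnn; lia.
  rewrite ltr_pdivrMr// -ltr_pdivrMl// mulrC.
  exact: lt_le_trans h1 h2.
apply/eqP; rewrite -subr_eq0 -nrm_eq0 eq_le nrm_ge0 andbT.
apply/ler_addgt0Pl => e e0; rewrite addr0.
have e2 : 0 < e / 2 by rewrite divr_gt0.
have [d' d'0 hd'] := is_derive_eps hD e2.
have nt : 0 < nrm tau by rewrite nrm_gt0.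
pose A := nrm (kappa tau / tau).
have A0 : 0 <= A by apply: nrm_ge0.
(* Demands on x = 2 / q_n: x < 1 gives |t| <= 3 x |tau|, the second bound puts t inside both radii,
   the third gives A x <= e / 2. *)
pose m := Num.min 1 (Num.min (Num.min d d' / (3 * nrm tau)) (e / 2 / (A + 1))).
have m0 : 0 < m.
  by rewrite /m !lt_min ltr01 !divr_gt0 ?lt_min ?d0 ?d'0 ?mulr_gt0//; lra.
have [n hn] := qlarge _ m0.
pose x : R := 2 / (q n)%:R.
have x0 : 0 < x by rewrite divr_gt0.
have rx : rho n = 1 + x%:C := rhoE n.
move: hn; rewrite -/x /m !lt_min => /andP[x1 /andP[x2 x3]].
pose t := (rho n ^+ 2 - 1) * tau.
have tE : tau + t = rho n ^+ 2 * tau by rewrite /t; ring.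
have nt1 : nrm t = x * (2 + x) * nrm tau.
  rewrite /t rx nrmM; congr (_ * _).
  have -> : (1 + x%:C) ^+ 2 - 1 = (x * (2 + x))%:C :> C.
    by rewrite [in RHS]rmorphM [in RHS]rmorphD /= -(nat_realC R 2); ring.
  by rewrite nrm_real ger0_norm// mulr_ge0//; lra.
have [td td'] : nrm t < d /\ nrm t < d'.
  apply/andP; rewrite -lt_min nt1; move: x2; rewrite ltr_pdivlMr ?mulr_gt0// => x2.
  by apply: le_lt_trans x2; rewrite mulrA ler_wpM2r ?(ltW nt)// ler_wpM2l ?(ltW x0)//; lra.
have := hd' t td'; rewrite f0 hd// tE kr => h.
have xC : x%:C != 0 :> C by rewrite -nrm_gt0 nrm_real normr_gt0 gt_eqF.
have x2C : 2 + x%:C != 0 :> C.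
  have -> : 2 + x%:C = (2 + x)%:C :> C by rewrite rmorphD /= rmorph_nat.
  by rewrite -nrm_gt0 nrm_real normr_gt0 gt_eqF//; lra.
have tn0 : t != 0.
  rewrite /t rx (_ : (1 + x%:C) ^+ 2 - 1 = x%:C * (2 + x%:C)); last by ring.
  by rewrite !mulf_neq0.
have h' : nrm (kappa tau / ((2 + x%:C) * tau) - D) <= e / 2.
  have E : rho n * kappa tau - kappa tau - t * D =
      t * (kappa tau / ((2 + x%:C) * tau) - D).
    by rewrite /t rx; field; rewrite t00 x2C.
  by move: h; rewrite E nrmM mulrC ler_pM2r// nrm_gt0.
have E : kappa tau / (2 * tau) - D = (kappa tau / ((2 + x%:C) * tau) - D) +
   kappa tau / tau * (x%:C / (2 * (2 + x%:C))) by field; rewrite t00 x2C.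
rewrite E; apply: (le_trans (nrmD _ _)); rewrite [leRHS](splitr e) lerD//.
rewrite nrmM -/A.
have -> : nrm (x%:C / (2 * (2 + x%:C))) = x / (2 * (2 + x)).
  have -> : x%:C / (2 * (2 + x%:C)) = (x / (2 * (2 + x)))%:C :> C.
    have -> : 2 + x%:C = (2 + x)%:C :> C by rewrite rmorphD /= rmorph_nat.
    by rewrite (nat_realC R 2) -rmorphM -fmorphV -rmorphM.
  by rewrite nrm_real ger0_norm// divr_ge0 ?(ltW x0)// mulr_ge0//; lra.
have h3 : x / (2 * (2 + x)) <= x.
  by rewrite ler_pdivrMr ?mulr_gt0//; nra.
apply: (le_trans (ler_wpM2l A0 h3)).
move: x3; rewrite ltr_pdivlMr; last by lra.
by lra.
Qed.

(** The points s of [0, 1] with |f s - f 0| <= e s have a supremum; it is one of them and cannot be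
    less than 1. *)
Lemma locally_flat_const (f : R -> C) :
  (forall s, 0 <= s <= 1 -> forall e : R, 0 < e -> exists2 d : R, 0 < d &
     forall s', `|s' - s| < d -> nrm (f s' - f s) <= e * `|s' - s|) ->
  f 1 = f 0.
Proof.
move=> hf; apply/eqP; rewrite -subr_eq0 -nrm_eq0 eq_le nrm_ge0 andbT.
apply/ler_addgt0Pl => e e0; rewrite addr0.
pose A := [set s : R | 0 <= s <= 1 /\ nrm (f s - f 0) <= e * s].
have A0 : A 0 by split; rewrite ?lexx ?ler01// subrr nrm0 mulr0.
have hA : has_sup A by split; [exists 0|exists 1 => s [/andP[]]].
pose c := sup A.
have c1 : 0 <= c <= 1.
  apply/andP; split; first by apply: ub_le_sup => //; exact: hA.2.
  by apply: ge_sup => [|s [/andP[]]//]; exists 0.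
have [d d0 hd] := hf c c1 e e0.
have Ac : A c.
  split => //; have [s As hs] := sup_adherent d0 hA.
  have sc : s <= c by apply: ub_le_sup => //; exact: hA.2.
  have h1 : nrm (f s - f c) <= e * `|s - c|.
    by apply: hd; rewrite distrC ger0_norm ?subr_ge0//; rewrite -/c in hs; lra.
  rewrite distrC ger0_norm ?subr_ge0// nrm_distC in h1.
  have -> : f c - f 0 = (f c - f s) + (f s - f 0) by rewrite subrKA.
  by apply: (le_trans (nrmD _ _)); have := As.2; lra.
have [c1'|c1'] := ltP c 1; last first.
  have cE : c = 1 by apply/eqP; rewrite eq_le c1' (andP c1).2.
  by have := Ac.2; rewrite cE mulr1.
pose s := Num.min 1 (c + d / 2).
have cs : c < s by rewrite /s lt_min c1' ltrDl divr_gt0.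
have sd : s - c < d.
  have : s <= c + d / 2 by rewrite /s ge_min lexx orbT.
  by have := d0; lra.
have As : A s.
  split; first by rewrite (le_trans (andP c1).1 (ltW cs)) /s ge_min lexx.
  have h1 : nrm (f s - f c) <= e * `|s - c|.
    by apply: hd; rewrite ger0_norm// subr_ge0 ltW.
  rewrite ger0_norm ?subr_ge0 ?(ltW cs)// in h1.
  have -> : f s - f 0 = (f s - f c) + (f c - f 0) by rewrite subrKA.
  by apply: (le_trans (nrmD _ _)); have := Ac.2; lra.
have : s <= c by apply: ub_le_sup => //; exact: hA.2.
by rewrite leNgt cs.
Qed.

(** By [kappa_ode] the derivative of kappa^2 / tau is 2 kappa kappa' / tau - kappa^2 / tau^2 = 0. *)
Lemma kappa_sq_flat tau : upper tau -> forall e : R, 0 < e -> exists2 d : R, 0 < d &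
  forall t, nrm t < d ->
    nrm (kappa (tau + t) ^+ 2 / (tau + t) - kappa tau ^+ 2 / tau) <= e * nrm t.
Proof.
move=> t0 e e0; have [f [df [d d0 hd]]] := kappa_ode t0.
have t00 := upper_neq0 t0.
have f0 : f 0 = kappa tau by rewrite hd ?addr0 ?nrm0.
have ds := derivable_shift0 tau.
have t00' : tau + 0 != 0 by rewrite addr0.
pose h := (f ^+ 2) * (fun t : C => (tau + t)^-1).
have dh : is_derive (0 : C) (1 : C) h 0.
  have dv : is_derive (0 : C) (1 : C) (fun t : C => (tau + t)^-1) (- (tau ^- 2)).
    apply: DeriveDef; first by apply: derivableV => //; case: ds.
    by rewrite deriveV ?derive_val ?addr0 /GRing.scale /= ?mulr1//; case: ds.
  have := @is_deriveM _ _ _ _ (0 : C) (1 : C) _ _ (is_deriveX 2 df) dv.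
  suff -> : (f ^+ 2) 0 *: - tau ^- 2 + (tau + 0)^-1 *: ((2 * f 0 ^+ 2.-1) *: (kappa tau / (2 * tau))) = 0 by [].
  rewrite /GRing.scale /= addr0 expr1 f0 -[(f ^+ 2) 0]/(f 0 ^+ 2) f0.
  by field.
have [d' d'0 hd'] := is_derive_eps dh e0.
exists (Num.min d d'); first by rewrite lt_min d0.
move=> t; rewrite lt_min => /andP[td /hd'].
rewrite mulr0 subr0 /h.
rewrite -[X in nrm (X - _)]/(f t ^+ 2 / (tau + t)) -[X in nrm (_ - X)]/(f 0 ^+ 2 / (tau + 0)).
by rewrite f0 addr0 hd.
Qed.

Lemma eC_imag (x : R) : eC ('i%C * x%:C : C) = (expR (- (2 * pi * x)))%:C.
Proof.
rewrite complexiE /eC; have -> : (2 * pi)%:C * 'i * ('i * x%:C) = (- (2 * pi * x))%:C :> C.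
  have -> : (2 * pi)%:C * 'i * ('i * x%:C) = 'i ^+ 2 * ((2 * pi)%:C * x%:C) :> C by ring.
  by rewrite sqr_i mulN1r rmorphN !rmorphM.
by rewrite /cexp /= cos0 sin0 -[1 +i* 0]/(1 : C) mulr1.
Qed.

Lemma invCi : ('i%C : C)^-1 = - 'i%C.
Proof.
have i00 : 'i%C != 0 :> C by apply: upper_neq0; rewrite /upper /= ltr01.
by apply: (mulIf i00); rewrite mulVf// mulNr -expr2 sqr_i opprK.
Qed.

(** As -1 / i = i, the two series agree term by term at w = 0; their value is at least 1, since all
    terms are positive and the one at 0 is 1. *)
Lemma kappa_i : kappa 'i%C = 1.
Proof.
have i0 : upper ('i%C : C) by rewrite /upper /= ltr01.
have E : gsum 'i%C 0 = theta1 'i%C 0 :> C.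
  rewrite /gsum /theta1; congr csum; apply: funext => n.
  rewrite /gau /th1 add0r mulr0 addr0; congr eC; congr (_ * _ * _).
  by rewrite invCi opprK.
have := gsum_kappa i0 0; rewrite E -[X in X = _]mul1r => h.
suff n0 : theta1 ('i%C : C) 0 != 0 by apply/esym; apply: (mulIf n0).
have [B hB] := summ_th1 0 i0.
pose f (n : int) : R := expR (- (2 * pi * (2^-1 * n%:~R ^+ 2))).
have fE n : th1 'i%C 0 n = (f n)%:C.
  rewrite /th1 mulr0 addr0 /f -eC_imag; congr eC.
  by rewrite rmorphM /= fmorphV /= rmorph_nat rmorphXn /= rmorph_int; ring.
have hf : psum_le f B.
  by apply: psum_le_le hB => n; rewrite fE nrm_real ler_norm.
have [s [hs leS _]] := has_sum_pos (fun n => expR_ge0 _) hf.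
have -> : theta1 'i%C 0 = s%:C.
  by apply: csumE; apply: eq_has_sum hs => n; rewrite fE.
have := leS [:: 0] isT; rewrite big_seq1 expr0n !mulr0 oppr0 expR0 => s1.
by rewrite -nrm_gt0 nrm_real normr_gt0 gt_eqF//; lra.
Qed.

(** The upper half plane is convex, so kappa^2 / tau is constant on the segment from i to [tau]; at
    i it equals 1 / i = -i. *)
Lemma kappa_sq tau : upper tau -> kappa tau ^+ 2 = - 'i%C * tau.
Proof.
move=> t0; have t00 := upper_neq0 t0.
have i0 : upper ('i%C : C) by rewrite /upper /= ltr01.
have i00 := upper_neq0 i0.
pose ga (s : R) : C := 'i%C + s%:C * (tau - 'i%C).
pose f s := kappa (ga s) ^+ 2 / ga s.
have : f 1 = f 0.
  apply: locally_flat_const => s /andP[s0 s1] e e0.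
  have us : upper (ga s).
    move: t0; rewrite /upper /ga; case: (tau) => a b /= b0.
    by rewrite mul0r addr0; nra.
  have n0 : 0 < nrm (tau - 'i%C) + 1 by rewrite ltr_wpDl ?nrm_ge0.
  have [d d0 hd] := kappa_sq_flat us (divr_gt0 e0 n0).
  exists (d / (nrm (tau - 'i%C) + 1)); first by rewrite divr_gt0.
  move=> s'; rewrite ltr_pdivlMr// => hs'.
  pose t : C := (s' - s)%:C * (tau - 'i%C).
  have nt : nrm t = `|s' - s| * nrm (tau - 'i%C) by rewrite nrmM nrm_real.
  have E : ga s' = ga s + t by rewrite /ga /t rmorphB /=; ring.
  have td : nrm t < d.
    by rewrite nt; apply: le_lt_trans hs'; rewrite ler_wpM2l// lerDl.
  have -> : f s' - f s = kappa (ga s + t) ^+ 2 / (ga s + t) - kappa (ga s) ^+ 2 / ga s.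
    by rewrite /f E.
  apply: (le_trans (hd t td)); rewrite nt.
  rewrite mulrAC ler_pdivrMr// -mulrA ler_wpM2l ?(ltW e0)// ler_wpM2l// lerDl//.
rewrite /f /ga mul1r mul0r addr0 subrKC kappa_i expr1n mul1r => h.
apply: (mulIf (invr_neq0 t00)); rewrite h mulfK//.
exact: invCi.
Qed.

(* Jacobi's inversion formula; kappa is known only through kappa ^+ 2 = tau / i,
   which is enough because theta functions are later raised to powers divisible by 8. *)
Lemma theta1_inversion (tau v a : C) : upper tau ->
  csum (fun r : int => gau (- tau^-1) (v + r%:~R) * eC (- (r%:~R * a))) =
  kappa tau * csum (fun n : int => eC (2^-1 * tau * (n%:~R + a) ^+ 2 + (n%:~R + a) * v)).
Proof.
move=> t0; have t00 := upper_neq0 t0.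
have -> : csum (fun n : int => eC (2^-1 * tau * (n%:~R + a) ^+ 2 + (n%:~R + a) * v)) =
    eC (2^-1 * tau * a ^+ 2 + a * v) * theta1 tau (v + tau * a).
  apply: csumE; apply: eq_has_sum (has_sumZ _ (csumP (summ_th1 (v + tau * a) t0))) => n.
  by rewrite /th1 -eCD; congr eC; field.
rewrite mulrCA -gsum_kappa//; apply: csumE.
apply: eq_has_sum (has_sumZ _ (csumP (summ_gau1 (v + tau * a) (upper_ninv t0)))) => n.
by rewrite /gau -!eCD; congr eC; field.
Qed.

End Kappa.

Section BlockProduct.
Variables (K : pzRingType) (g : nat).
Implicit Types M N : 'M[K]_(g + g).

Lemma dlsubmx_mul M N : dlsubmx (M *m N) =
  dlsubmx M *m ulsubmx N + drsubmx M *m dlsubmx N.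
Proof. by rewrite -{1}[M]submxK -{1}[N]submxK mulmx_block block_mxKdl. Qed.

Lemma drsubmx_mul M N : drsubmx (M *m N) =
  dlsubmx M *m ursubmx N + drsubmx M *m drsubmx N.
Proof. by rewrite -{1}[M]submxK -{1}[N]submxK mulmx_block block_mxKdr. Qed.

Lemma ulsubmx_mul M N : ulsubmx (M *m N) =
  ulsubmx M *m ulsubmx N + ursubmx M *m dlsubmx N.
Proof. by rewrite -{1}[M]submxK -{1}[N]submxK mulmx_block block_mxKul. Qed.

Lemma ursubmx_mul M N : ursubmx (M *m N) =
  ulsubmx M *m ursubmx N + ursubmx M *m drsubmx N.
Proof. by rewrite -{1}[M]submxK -{1}[N]submxK mulmx_block block_mxKur. Qed.

End BlockProduct.

(** * Generation of Sp(2g, Z) by translations and partial inversions *)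

Section SymplecticGeneration.
Variable g : nat.
Local Notation Mat := 'M[int]_(g + g).
Implicit Types (M N : Mat) (S : 'M[int]_g) (i j l a b : 'I_g).

Definition transl S : Mat := block_mx 1%:M S 0 1%:M.
Definition partial_inv l : Mat :=
  block_mx (1%:M - delta_mx l l) (- delta_mx l l) (delta_mx l l) (1%:M - delta_mx l l).

(** Built by right multiplication only: with [spgenT_inv] and [spgenJ_inv] this suffices to reduce a
    matrix by column operations, and it fits the order of composition in [slash_mul]. *)
Inductive spgen : Mat -> Prop :=
| spgen1 : spgen 1%:M
| spgenT M S : S^T = S -> spgen M -> spgen (M *m transl S)
| spgenJ M l : spgen M -> spgen (M *m partial_inv l).

Lemma spgenT_inv M S : S^T = S -> spgen (M *m transl S) -> spgen M.
Proof.
move=> Ss h; have Sn : (- S)^T = - S by rewrite linearN /= Ss.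
have := spgenT Sn h; rewrite -mulmxA /transl mulmx_block.
by rewrite !mulmx1 !mul1mx !mulmx0 !mul0mx !addr0 !add0r addNr -scalar_mx_block mulmx1.
Qed.

Lemma delta_idem l : delta_mx l l *m delta_mx l l = delta_mx l l :> 'M[int]_g.
Proof. by rewrite mul_delta_mx_cond eqxx. Qed.

Lemma partial_inv_sq l : partial_inv l *m partial_inv l =
  block_mx (1%:M - delta_mx l l *+ 2) 0 0 (1%:M - delta_mx l l *+ 2).
Proof.
rewrite /partial_inv mulmx_block; set E := delta_mx l l.
have EE : E *m E = E by exact: delta_idem.
rewrite !(mulmxBl, mulmxBr, mulmxN, mulNmx) !(mulmx1, mul1mx) EE subrr.
by congr block_mx; apply/matrixP => x y; rewrite !mxE; ring.
Qed.

Lemma partial_inv_4 l :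
  partial_inv l *m partial_inv l *m (partial_inv l *m partial_inv l) = 1%:M.
Proof.
rewrite partial_inv_sq mulmx_block !(mulmx0, mul0mx) !(addr0, add0r).
have -> : (1%:M - delta_mx l l *+ 2) *m (1%:M - delta_mx l l *+ 2) = 1%:M :> 'M[int]_g.
  rewrite mulr2n !(mulmxBl, mulmxBr, mulmx1, mul1mx) !(mulmxDl, mulmxDr) delta_idem.
  by apply/matrixP => x y; rewrite !mxE; ring.
by rewrite -scalar_mx_block.
Qed.

(** The fourth power of a partial inversion is 1, so three more factors undo one. *)
Lemma spgenJ_inv M l : spgen (M *m partial_inv l) -> spgen M.
Proof.
move=> h; have := spgenJ l (spgenJ l (spgenJ l h)).
by rewrite -!mulmxA [X in M *m X]mulmxA partial_inv_4 mulmx1.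
Qed.

Lemma in_SpM M N : in_Sp M -> in_Sp N -> in_Sp (M *m N).
Proof.
rewrite /in_Sp => hM hN.
by rewrite trmx_mul -!mulmxA [M^T *m _]mulmxA [M^T *m _ *m _]mulmxA hM mulmxA.
Qed.

Lemma in_Sp_transl S : S^T = S -> in_Sp (transl S).
Proof.
move=> Ss; rewrite /in_Sp /Jmat /transl tr_block_mx !mulmx_block !trmx1 trmx0 Ss.
rewrite !(mulmx0, mul0mx, mulmx1, mul1mx, mulmxN, mulNmx, addr0, add0r, subr0, sub0r, oppr0).
by rewrite addNr.
Qed.

Lemma in_Sp_partial_inv l : in_Sp (partial_inv l).
Proof.
set E := delta_mx l l : 'M[int]_g; have EE : E *m E = E by exact: delta_idem.
have Et : E^T = E by exact: trmx_delta.
have t1 : (1%:M - E)^T = 1%:M - E by rewrite linearB /= trmx1 Et.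
have t2 : (- E)^T = - E by rewrite linearN /= Et.
rewrite /in_Sp /Jmat /partial_inv -/E tr_block_mx t1 t2 Et !mulmx_block.
rewrite !(mulmx0, mul0mx, mulmx1, mul1mx, mulmxN, mulNmx, addr0, add0r).
rewrite !(mulmxBl, mulmxBr, mulmxN, mulNmx, mulmx1, mul1mx) EE.
by congr block_mx; apply/matrixP => x y; rewrite !mxE; ring.
Qed.

(** The definition makes -J M^T J a left inverse of M, hence a right inverse. The relations between
    rows, on which the reduction rests, come from this form. *)
Lemma in_Sp_tr M : in_Sp M -> M *m Jmat g *m M^T = Jmat g.
Proof.
rewrite /in_Sp => h.
have JJ : Jmat g *m Jmat g = - 1%:M.
  rewrite /Jmat mulmx_block !(mulmx0, mul0mx, mulmx1, mul1mx, addr0, add0r).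
  by rewrite (scalar_mx_block _ _ 1) opp_block_mx oppr0.
have h1 : (- (Jmat g *m M^T *m Jmat g)) *m M = 1%:M.
  by rewrite mulNmx -!mulmxA [M^T *m _]mulmxA h JJ opprK.
have := mulmx1C h1; rewrite mulmxN !mulmxA => h2.
have -> : M *m Jmat g *m M^T = (- (M *m Jmat g *m M^T *m Jmat g)) *m Jmat g.
  by rewrite mulNmx -[_ *m Jmat g *m Jmat g]mulmxA JJ mulmxN mulmx1 opprK.
by rewrite h2 mul1mx.
Qed.

Definition ea M i j := M (lshift g i) (lshift g j).
Definition eb M i j := M (lshift g i) (rshift g j).
Definition ec M i j := M (rshift g i) (lshift g j).
Definition ed M i j := M (rshift g i) (rshift g j).

Lemma in_Sp_entries M : in_Sp M ->
  [/\ forall i j, \sum_l ec M i l * ed M j l = \sum_l ed M i l * ec M j l,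
      forall i j, \sum_l ea M i l * eb M j l = \sum_l eb M i l * ea M j l &
      forall i j, \sum_l ea M i l * ed M j l - \sum_l eb M i l * ec M j l = (i == j)%:R].
Proof.
move/in_Sp_tr; rewrite -[in X in X -> _](submxK M) /Jmat tr_block_mx !mulmx_block.
rewrite !(mulmx0, mul0mx, mulmx1, mulmxN, mulNmx, addr0, add0r).
move/eq_block_mx => [h1 h2 _ h3].
split=> i j.
- move/matrixP/(_ i j): h3; rewrite !mxE => /eqP; rewrite addrC subr_eq0 => /eqP.
  by under eq_bigr do rewrite !mxE; under [in RHS]eq_bigr do rewrite !mxE.
- move/matrixP/(_ i j): h1; rewrite !mxE => /eqP; rewrite addrC subr_eq0 => /eqP.
  by under eq_bigr do rewrite !mxE; under [in RHS]eq_bigr do rewrite !mxE.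
- move/matrixP/(_ i j): h2; rewrite !mxE addrC => <-.
  by congr (_ - _); apply: eq_bigr => l _; rewrite !mxE.
Qed.

Lemma ecE M : ec M =2 dlsubmx M.
Proof. by move=> i j; rewrite !mxE. Qed.

Lemma edE M : ed M =2 drsubmx M.
Proof. by move=> i j; rewrite !mxE. Qed.

Lemma ec_transl M S i j : ec (M *m transl S) i j = ec M i j.
Proof.
by rewrite !ecE dlsubmx_mul block_mxKul block_mxKdl mulmx1 mulmx0 addr0.
Qed.

Lemma ed_transl M S i j : ed (M *m transl S) i j = ed M i j + \sum_l ec M i l * S l j.
Proof.
rewrite !edE drsubmx_mul block_mxKur block_mxKdr mulmx1 addrC mxE; congr (_ + _).
by rewrite mxE; apply: eq_bigr => l _; rewrite ecE.
Qed.

Lemma mulmx_delta_entry (X : 'M[int]_g) a b i j :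
  (X *m delta_mx a b) i j = if j == b then X i a else 0.
Proof.
rewrite mxE (bigD1 a)//= big1 => [|l la]; last by rewrite mxE (negPf la) mulr0.
by rewrite addr0 mxE eqxx /=; case: eqP => _; rewrite ?mulr1 ?mulr0.
Qed.

Lemma ec_partial_inv M l i j : ec (M *m partial_inv l) i j =
  if j == l then ed M i l else ec M i j.
Proof.
rewrite !ecE edE dlsubmx_mul block_mxKul block_mxKdl mulmxBr mulmx1.
move: (dlsubmx M) (drsubmx M) => X Y.
rewrite [LHS]mxE [X in X + _]mxE [X in _ + X + _]mxE !mulmx_delta_entry.
by case: eqP => [->|_]; rewrite ?subrr ?add0r// subr0 addr0.
Qed.

Lemma ed_partial_inv M l i j : ed (M *m partial_inv l) i j =
  if j == l then - ec M i l else ed M i j.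
Proof.
rewrite !edE ecE drsubmx_mul block_mxKur block_mxKdr mulmxN mulmxBr mulmx1.
move: (dlsubmx M) (drsubmx M) => X Y.
rewrite [LHS]mxE [X in X + _]mxE [X in _ + X]mxE [X in _ + (_ + X)]mxE !mulmx_delta_entry.
case: eqP => [->|_]; first by rewrite subrr addr0.
by rewrite oppr0 subr0 add0r.
Qed.

Definition elem_sym a b (s : int) : 'M[int]_g :=
  if a == b then s *: delta_mx a a else s *: (delta_mx a b + delta_mx b a).

Lemma elem_sym_tr a b s : (elem_sym a b s)^T = elem_sym a b s.
Proof.
rewrite /elem_sym; case: eqP => _; first by rewrite linearZ /= trmx_delta.
by rewrite linearZ linearD /= !trmx_delta addrC.
Qed.

Lemma ed_transl_elem M a b s i j : ed (M *m transl (elem_sym a b s)) i j =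
  ed M i j + (if j == b then s * ec M i a else 0) +
  (if (a != b) && (j == a) then s * ec M i b else 0).
Proof.
rewrite ed_transl.
have E (X : 'M[int]_g) : \sum_l ec M i l * X l j = (dlsubmx M *m X) i j.
  by rewrite mxE; apply: eq_bigr => l _; rewrite ecE.
rewrite E /elem_sym !ecE; case: (eqVneq a b) => [->|ab] /=.
  rewrite -scalemxAr mxE mulmx_delta_entry addr0; congr (_ + _).
  by case: ifP => _; rewrite ?mulr0.
rewrite -scalemxAr mulmxDr [X in _ + X]mxE [X in _ * X]mxE !mulmx_delta_entry -addrA; congr (_ + _).
by rewrite mulrDr; congr (_ + _); case: ifP => _; rewrite ?mulr0.
Qed.

(** Invariant of the reduction, which brings the rows of the lower half to those of the identity one
    at a time. *)
Definition std_rows (n : nat) M := forall i j, (i < n)%N ->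
  ec M i j = 0 /\ ed M i j = (i == j)%:R.

Lemma std_rows_ec M i j (n : nat) : in_Sp M -> std_rows n M -> (j < n)%N -> ec M i j = 0.
Proof.
move=> spM st jn; have [h _ _] := in_Sp_entries spM.
have := h i j; rewrite (bigD1 j)//= big1 => [|l lj]; last first.
  by rewrite (st j l jn).2 eq_sym (negPf lj) mulr0.
rewrite (st j j jn).2 eqxx mulr1 addr0 => ->.
by rewrite big1// => l _; rewrite (st j l jn).1 mulr0.
Qed.

Lemma std_rows_partial_inv M l (n : nat) : (n <= l)%N -> std_rows n M ->
  std_rows n (M *m partial_inv l).
Proof.
move=> nl st i j i_n; rewrite ec_partial_inv ed_partial_inv.
have il : i != l by apply: contraTneq i_n => ->; rewrite -leqNgt.
by case: eqP => [->|_]; rewrite ?(st i _ i_n).1 ?(st i _ i_n).2 ?oppr0 ?(negPf il).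
Qed.

Lemma std_rows_transl M S (n : nat) : std_rows n M -> std_rows n (M *m transl S).
Proof.
move=> st i j i_n; rewrite ec_transl ed_transl (st i j i_n).1 (st i j i_n).2; split => //.
by rewrite big1 ?addr0// => l _; rewrite (st i l i_n).1 mul0r.
Qed.

(* Adds s times column b of the lower right block to column a, up to signs, when
   the lower left block vanishes on the row considered. *)
Definition colop a b (s : int) M : Mat :=
  M *m partial_inv b *m transl (elem_sym a b s) *m partial_inv b.

Lemma in_Sp_colop a b s M : in_Sp M -> in_Sp (colop a b s M).
Proof.
move=> h; apply: in_SpM (in_Sp_partial_inv _).
apply: in_SpM (in_Sp_transl (elem_sym_tr _ _ _)).
exact: in_SpM (in_Sp_partial_inv _).
Qed.

Lemma spgen_colop a b s M : spgen (colop a b s M) -> spgen M.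
Proof. by move=> /spgenJ_inv /(spgenT_inv (elem_sym_tr _ _ _)) /spgenJ_inv. Qed.

Lemma std_rows_colop a b s M (n : nat) : (n <= b)%N -> std_rows n M ->
  std_rows n (colop a b s M).
Proof.
move=> nb st; apply: std_rows_partial_inv => //; apply: std_rows_transl.
exact: std_rows_partial_inv.
Qed.

Lemma ec_colop a b s M i j : a != b -> (forall l, ec M i l = 0) ->
  ec (colop a b s M) i j = 0.
Proof.
move=> ab c0; rewrite /colop ec_partial_inv ed_transl_elem ec_transl ed_partial_inv.
rewrite !(ec_partial_inv M) eqxx (eq_sym b a) (negPf ab) /= !c0 oppr0 mulr0 !addr0.
by case: eqP.
Qed.

Lemma ed_colop a b s M i j : a != b -> (forall l, ec M i l = 0) ->
  ed (colop a b s M) i j =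
  if j == b then - ed M i b else if j == a then ed M i a + s * ed M i b else ed M i j.
Proof.
move=> ab c0; rewrite /colop ed_partial_inv ec_transl ed_transl_elem ed_partial_inv.
rewrite !(ec_partial_inv M) eqxx (negPf ab) /= !c0 mulr0.
case: (eqVneq j b) => [//|jb]; rewrite addr0.
by case: (eqVneq j a) => [->|_]; rewrite ?addr0.
Qed.

Definition gen_from (n : nat) := forall M, in_Sp M -> std_rows n M -> spgen M.

Lemma gen_from_all : gen_from g.
Proof.
move=> M spM st.
have C0 : dlsubmx M = 0 by apply/matrixP => i j; rewrite -ecE (st i j (ltn_ord i)).1 mxE.
have D1 : drsubmx M = 1%:M.
  by apply/matrixP => i j; rewrite -edE (st i j (ltn_ord i)).2 mxE.
have [_ h1 h2] := in_Sp_entries spM.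
have A1 : ulsubmx M = 1%:M.
  apply/matrixP => i j; have := h2 i j; rewrite [X in _ - X]big1 => [|l _]; last first.
    by rewrite (st j l (ltn_ord j)).1 mulr0.
  rewrite subr0 (bigD1 j)//= big1 => [|l lj]; last first.
    by rewrite (st j l (ltn_ord j)).2 eq_sym (negPf lj) mulr0.
  by rewrite (st j j (ltn_ord j)).2 eqxx mulr1 addr0 !mxE.
have Bs : (ursubmx M)^T = ursubmx M.
  have ea1 i l : ea M i l = (i == l)%:R.
    by move/matrixP/(_ i l): A1; rewrite !mxE.
  apply/matrixP => i j; have := h1 i j.
  rewrite (bigD1 i)//= big1 => [|l li]; last by rewrite ea1 eq_sym (negPf li) mul0r.
  rewrite (bigD1 j)//= big1 => [|l lj]; last by rewrite ea1 eq_sym (negPf lj) mulr0.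
  by rewrite !ea1 !eqxx mul1r mulr1 !addr0 !mxE.
rewrite -[M]submxK A1 C0 D1 -[block_mx _ _ _ _]mul1mx.
exact: spgenT spgen1.
Qed.

Section Step.
Variables (n : nat) (i : 'I_g).
Hypotheses (ni : n = i) (IH : gen_from n.+1).

Let std_ext M : std_rows n M -> (forall j, ec M i j = 0) ->
  (forall j, ed M i j = (i == j)%:R) -> std_rows n.+1 M.
Proof.
move=> st c0 d0 k j; rewrite ltnS leq_eqVlt => /predU1P[kn|]; last exact: st.
by have -> : k = i by apply: val_inj; rewrite /= kn.
Qed.

(** The entry d_ii, 1 or -1, is a pivot: [colop a i] cancels d_ia and leaves the other entries of
    the row unchanged up to sign, so fewer are nonzero. A final sign is removed by the square of a
    partial inversion. *)
Lemma gen_clear M : in_Sp M -> std_rows n M -> (forall j, ec M i j = 0) ->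
  `|ed M i i| = 1 -> spgen M.
Proof.
have [m hm] := ubnP #|[set a : 'I_g | (a != i) && (ed M i a != 0)]%SET|.
elim: m M hm => // m IHm M hm spM st c0 d1.
have [/existsP[a /andP[ai da]]|/existsPn h] := boolP [exists a, (a != i) && (ed M i a != 0)].
  pose s := - (ed M i a * ed M i i).
  apply: (@spgen_colop a i s); apply: IHm.
  - apply: leq_trans (_ : #|[set a : 'I_g | (a != i) && (ed M i a != 0)]%SET| <= m)%N => //.
    apply: proper_card; apply/properP; split.
      apply/fintype.subsetP => b; rewrite !inE ed_colop// => /andP[bi].
      rewrite (negPf bi); case: (eqVneq b a) => [->|_]; last by move=> ->.
      by rewrite da.
    exists a; first by rewrite inE ai.
    rewrite inE ed_colop// eqxx (negPf ai) /= /s.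
    by case: (intP (ed M i i)) d1 => [|k|k] //=; nia.
  - exact: in_Sp_colop.
  - by apply: std_rows_colop; rewrite // ni.
  - by move=> j; apply: ec_colop.
  - by rewrite ed_colop// eqxx normrN.
have z a : a != i -> ed M i a = 0.
  by move=> ai; have := h a; rewrite ai /= negbK => /eqP.
have [d1'|d1'] : ed M i i = 1 \/ ed M i i = -1 by lia.
  apply: IH => //; apply: std_ext => // j.
  by case: (eqVneq i j) => [<-|ij]; rewrite ?d1'// z// eq_sym.
apply: (@spgenJ_inv _ i); apply: (@spgenJ_inv _ i); apply: IH.
  by do 2?[apply: in_SpM => //]; apply: in_Sp_partial_inv.
apply: std_ext.
- by do 2?[apply: std_rows_partial_inv; rewrite ?ni//]; rewrite -ni.
- by move=> j; rewrite ec_partial_inv ed_partial_inv eqxx ec_partial_inv !c0 oppr0; do 2?case: ifP.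
- move=> j; rewrite ed_partial_inv ec_partial_inv ed_partial_inv eqxx.
  case: (eqVneq j i) => [jE|ji]; first by rewrite /= d1' opprK.
  by rewrite /= z.
Qed.

(** Euclid's algorithm on the entries d_ia with a >= n. The symplectic relations make them coprime,
    so a single entry 1 or -1 is left; one more column operation creates a unit at position i. *)
Lemma gen_gcd M : in_Sp M -> std_rows n M -> (forall j, ec M i j = 0) -> spgen M.
Proof.
have [m hm] := ubnP (\sum_(a < g | (n <= a)%N) absz (ed M i a)).
elim: m M hm => // m IHm M hm spM st c0.
(* Columns a < n drop out: the relation between row i and the standard row a gives
   [ea M i a = 0]. *)
have unimod : \sum_(a < g | (n <= a)%N) ea M i a * ed M i a = 1.
  have [_ _ h] := in_Sp_entries spM.
  have := h i i; rewrite eqxx [X in _ - X]big1 ?subr0 => [|l _]; last by rewrite c0 mulr0.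
  rewrite (bigID (fun a : 'I_g => (n <= a)%N)) /= [X in _ + X]big1 ?addr0// => a.
  rewrite -ltnNge => an; have := h i a.
  rewrite [X in _ - X]big1 ?subr0 => [|l _]; last by rewrite (st a l an).1 mulr0.
  rewrite (bigD1 a)//= big1 => [|l la]; last by rewrite (st a l an).2 eq_sym (negPf la) mulr0.
  rewrite (st a a an).2 eqxx mulr1 addr0 => ->.
  have -> : (i == a) = false by apply/negP => /eqP ia; move: an; rewrite -ia ni ltnn.
  by rewrite mul0r.
have [/existsP[a /existsP[b /and5P[na nb ab da dab]]]|hno] := boolP [exists a : 'I_g, [exists b : 'I_g,
  [&& (n <= a)%N, (n <= b)%N, a != b, ed M i b != 0 & (absz (ed M i b) <= absz (ed M i a))%N]]].
  pose s := - (ed M i a %/ ed M i b)%Z.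
  apply: (@spgen_colop a b s); apply: IHm.
  - apply: leq_trans (_ : (\sum_(a < g | (n <= a)%N) absz (ed M i a)) <= m)%N => //.
    rewrite (bigD1 a)//= [in X in (_ < X)%N](bigD1 a)//=.
    have E (l : 'I_g) : l != a -> absz (ed (colop a b s M) i l) = absz (ed M i l).
      move=> la; rewrite ed_colop//; case: (eqVneq l b) => [->|_]; first by rewrite abszN.
      by rewrite (negPf la).
    rewrite [X in (_ + X < _)%N](eq_bigr (fun l => absz (ed M i l))); last first.
      by move=> l /andP[_ la]; exact: E.
    rewrite ltn_add2r ed_colop// (negPf ab) eqxx /s.
    have e1 := divz_eq (ed M i a) (ed M i b).
    have e2 := modz_ge0 (ed M i a) da.
    have e3 := ltz_mod (ed M i a) da.
    apply: leq_trans dab.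
    by lia.
  - exact: in_Sp_colop.
  - exact: std_rows_colop.
  - by move=> j; apply: ec_colop.
have uniq_b (a b : 'I_g) : (n <= a)%N -> (n <= b)%N -> ed M i a != 0 -> ed M i b != 0 -> a = b.
  move=> na nb da db; apply/eqP; apply: contraNT hno => ab.
  have [le|/ltnW le] := leqP (absz (ed M i b)) (absz (ed M i a)).
    by apply/existsP; exists a; apply/existsP; exists b; apply/and5P.
  by apply/existsP; exists b; apply/existsP; exists a; apply/and5P; rewrite eq_sym.
have [b /andP[nb db]] : exists b : 'I_g, (n <= b)%N && (ed M i b != 0).
  apply/existsP; apply: contra_eqT unimod => /existsPn hz.
  rewrite big1// => a na; have := hz a; rewrite na /= negbK => /eqP ->.
  by rewrite mulr0.
have z a : (n <= a)%N -> a != b -> ed M i a = 0.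
  by move=> na; apply: contraNeq => da; apply/eqP; apply: uniq_b.
have b1 : `|ed M i b| = 1.
  move: unimod; rewrite (bigD1 b)//= big1 => [|a /andP[na ab]]; last by rewrite z// mulr0.
  rewrite addr0 => h; have : (ed M i b %| 1)%Z by apply/dvdzP; exists (ea M i b).
  by rewrite dvdz1 => /eqP; lia.
have [bi|bi] := eqVneq b i; first by rewrite bi in b1; exact: gen_clear.
have ib : i != b by rewrite eq_sym.
apply: (@spgen_colop i b (ed M i b)); apply: gen_clear.
- exact: in_Sp_colop.
- exact: std_rows_colop.
- by move=> j; apply: ec_colop.
- rewrite ed_colop// (negPf ib) eqxx z ?ni// add0r.
  by rewrite normrM b1.
Qed.

(** Euclid's algorithm between c_il and d_il: a translation replaces d_il by its remainder modulo
    c_il, and the partial inversion moves that remainder into the lower left block. The sum of the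
    |c_ia| decreases until they all vanish. *)
Lemma gen_row M : in_Sp M -> std_rows n M -> spgen M.
Proof.
have [m hm] := ubnP (\sum_(a < g) absz (ec M i a)).
elim: m M hm => // m IHm M hm spM st.
have [/existsP[l cl]|/existsPn h] := boolP [exists l, ec M i l != 0]; last first.
  by apply: gen_gcd => // j; have := h j; rewrite negbK => /eqP.
have nl : (n <= l)%N.
  by rewrite leqNgt; apply: contra cl => ln; rewrite (std_rows_ec _ spM st ln).
pose s := - (ed M i l %/ ec M i l)%Z.
apply: (spgenT_inv (elem_sym_tr l l s)); apply: (@spgenJ_inv _ l); apply: IHm.
- apply: leq_trans (_ : (\sum_(a < g) absz (ec M i a)) <= m)%N => //.
  rewrite (bigD1 l)//= [in X in (_ < X)%N](bigD1 l)//=.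
  rewrite [X in (_ + X < _)%N](eq_bigr (fun a => absz (ec M i a))); last first.
    by move=> a al; rewrite ec_partial_inv (negPf al) ec_transl.
  rewrite ltn_add2r ec_partial_inv eqxx ed_transl_elem !eqxx /= addr0 /s.
  have e1 := divz_eq (ed M i l) (ec M i l).
  have e2 := modz_ge0 (ed M i l) cl.
  have e3 := ltz_mod (ed M i l) cl.
  by lia.
- apply: in_SpM; last exact: in_Sp_partial_inv.
  by apply: in_SpM => //; apply/in_Sp_transl/elem_sym_tr.
- by apply: std_rows_partial_inv => //; apply: std_rows_transl.
Qed.

End Step.

Lemma spgen_Sp M : in_Sp M -> spgen M.
Proof.
have : gen_from 0.
  have key k : (k <= g)%N -> gen_from (g - k).
    elim: k => [_|k IHk kg]; first by rewrite subn0; exact: gen_from_all.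
    have lt : (g - k.+1 < g)%N by lia.
    have E : (g - k.+1).+1 = (g - k)%N by lia.
    move=> N spN stN; apply: (@gen_row (g - k.+1) (Ordinal lt)) => //.
    by rewrite E; apply: IHk; exact: ltnW.
  by rewrite -(subnn g); exact: key.
by move=> h spM; apply: h => // i j.
Qed.

End SymplecticGeneration.

(** * Bilinear forms and dot products of row vectors *)

Section BilinearForm.
Variables (K : comNzRingType) (n : nat).
Implicit Types (Q : 'M[K]_n) (p q : 'rV[K]_n).

Definition bil Q p q : K := (p *m Q *m q^T) 0 0.

Lemma bilDl Q p p' q : bil Q (p + p') q = bil Q p q + bil Q p' q.
Proof. by rewrite /bil !mulmxDl mxE. Qed.

Lemma bilZl Q c p q : bil Q (c *: p) q = c * bil Q p q.
Proof. by rewrite /bil -!scalemxAl mxE. Qed.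

Lemma bilNl Q p q : bil Q (- p) q = - bil Q p q.
Proof. by rewrite -scaleN1r bilZl mulN1r. Qed.

Lemma bilQD Q Q' p q : bil (Q + Q') p q = bil Q p q + bil Q' p q.
Proof. by rewrite /bil mulmxDr mulmxDl mxE. Qed.

Lemma bilQZ Q c p q : bil (c *: Q) p q = c * bil Q p q.
Proof. by rewrite /bil -scalemxAr -scalemxAl mxE. Qed.

Lemma bil_tr Q p q : bil Q p q = bil Q^T q p.
Proof.
have -> : bil Q^T q p = ((p *m Q *m q^T)^T) 0 0 by rewrite /bil !trmx_mul trmxK mulmxA.
by rewrite mxE.
Qed.

Lemma bilDr Q p q q' : bil Q p (q + q') = bil Q p q + bil Q p q'.
Proof. by rewrite bil_tr bilDl -!bil_tr. Qed.

Lemma bilZr Q c p q : bil Q p (c *: q) = c * bil Q p q.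
Proof. by rewrite bil_tr bilZl -bil_tr. Qed.

Lemma bilNr Q p q : bil Q p (- q) = - bil Q p q.
Proof. by rewrite bil_tr bilNl -bil_tr. Qed.

Lemma bil_sym Q p q : Q^T = Q -> bil Q p q = bil Q q p.
Proof. by move=> Qs; rewrite bil_tr Qs. Qed.

Definition dot p q : K := (p *m q^T) 0 0.

Lemma dotE p q : dot p q = bil 1%:M p q.
Proof. by rewrite /bil mulmx1. Qed.

Lemma dotDl p p' q : dot (p + p') q = dot p q + dot p' q.
Proof. by rewrite !dotE bilDl. Qed.

Lemma dotDr p q q' : dot p (q + q') = dot p q + dot p q'.
Proof. by rewrite !dotE bilDr. Qed.

Lemma dotZl c p q : dot (c *: p) q = c * dot p q.
Proof. by rewrite !dotE bilZl. Qed.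

Lemma dotZr c p q : dot p (c *: q) = c * dot p q.
Proof. by rewrite !dotE bilZr. Qed.

Lemma dotNr p q : dot p (- q) = - dot p q.
Proof. by rewrite !dotE bilNr. Qed.

Lemma dotC p q : dot p q = dot q p.
Proof. by rewrite !dotE bil_tr trmx1. Qed.

Lemma dot_sum p q : dot p q = \sum_j p 0 j * q 0 j.
Proof. by rewrite /dot mxE; apply: eq_bigr => j _; rewrite mxE. Qed.

Lemma dot_delta p j : dot p (delta_mx 0 j) = p 0 j.
Proof. by rewrite /dot trmx_delta -colE mxE. Qed.

Lemma bil_dot Q p q : bil Q p q = dot (p *m Q) q.
Proof. by []. Qed.

Lemma bil_sum Q p q : bil Q p q = \sum_i \sum_j p 0 i * Q i j * q 0 j.
Proof.
rewrite bil_dot dot_sum exchange_big /=; apply: eq_bigr => j _.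
by rewrite mxE mulr_suml.
Qed.

Lemma trmxD m k (X Y : 'M[K]_(m, k)) : (X + Y)^T = X^T + Y^T.
Proof. exact: linearD. Qed.

End BilinearForm.

(** * The slash action *)

Section SymplecticAction.
Variables (R : realType) (g : nat).
Local Notation C := (Num.NumField.sort (R[i])).
Local Notation Mat := 'M[int]_(g + g).
Implicit Types (M N : Mat) (Z : 'M[C]_g) (W : 'rV[C]_g).

Local Notation cmx := (map_mx (@intC R)).
Local Notation conj := (map_mx (@conjc R)).

Definition jfac M Z : 'M[C]_g := dlsubmx (cmx M) *m Z + drsubmx (cmx M).
Definition jnum M Z : 'M[C]_g := ulsubmx (cmx M) *m Z + ursubmx (cmx M).
Definition act M Z : 'M[C]_g := jnum M Z *m invmx (jfac M Z).

Lemma intC_intr : @intC R = intr. Proof. by []. Qed.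

Lemma cmxM p q s (X : 'M[int]_(p, q)) (Y : 'M[int]_(q, s)) : cmx (X *m Y) = cmx X *m cmx Y.
Proof. exact: map_mxM. Qed.

Lemma conj_int (z : int) : conjc (@intC R z) = intC R z.
Proof. by rewrite /intC rmorph_int. Qed.

Lemma Sp_blocks M : in_Sp M -> let Mc := cmx M in
  let A := ulsubmx Mc in let B := ursubmx Mc in
  let Cm := dlsubmx Mc in let D := drsubmx Mc in
  [/\ A^T *m Cm = Cm^T *m A, B^T *m D = D^T *m B,
      A^T *m D - Cm^T *m B = 1%:M & D^T *m A - B^T *m Cm = 1%:M].
Proof.
rewrite /in_Sp => h; have {}h : (cmx M)^T *m cmx (Jmat g) *m cmx M = cmx (Jmat g).
  by rewrite -[in RHS]h !cmxM map_trmx.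
have EJ : cmx (Jmat g) = block_mx 0 1%:M (- 1%:M) 0.
  by rewrite intC_intr /Jmat map_block_mx map_mxN !map_mx0 map_mx1.
move: h; rewrite EJ -{1 2}[cmx M]submxK tr_block_mx !mulmx_block.
rewrite !(mulmx0, mul0mx, mulmx1, mulmxN, mulNmx, addr0, add0r).
move/eq_block_mx => [h1 h2 h3 h4] /=.
split.
- by apply/eqP; rewrite -subr_eq0 addrC h1.
- by apply/eqP; rewrite -subr_eq0 addrC h4.
- by rewrite addrC.
- by move: h3 => /(congr1 -%R); rewrite opprK => <-; rewrite opprD opprK addrC.
Qed.

(** Applied with Z1 = Z2, for the symmetry of the transformed matrix, and with Z1 the conjugate of
    Z2, for the positivity of its imaginary part. *)
Lemma sp_form (A B Cm D Z1 Z2 : 'M[C]_g) : A^T *m Cm = Cm^T *m A -> B^T *m D = D^T *m B ->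
  A^T *m D - Cm^T *m B = 1%:M -> D^T *m A - B^T *m Cm = 1%:M ->
  (Z1 *m Cm^T + D^T) *m (A *m Z2 + B) - (Z1 *m A^T + B^T) *m (Cm *m Z2 + D) = Z2 - Z1.
Proof.
move=> h1 h2 h3 h4; rewrite !(mulmxDl, mulmxDr) !mulmxA.
have -> : Z1 *m Cm^T *m A *m Z2 = Z1 *m A^T *m Cm *m Z2 by rewrite -(mulmxA Z1 Cm^T) -h1 !mulmxA.
have -> : Z1 *m Cm^T *m B = Z1 *m A^T *m D - Z1.
  by rewrite -(mulmxA Z1 Cm^T) -(mulmxA Z1 A^T) -[X in _ - X]mulmx1 -mulmxBr -h3 opprB addrC subrK.
have -> : D^T *m A *m Z2 = B^T *m Cm *m Z2 + Z2 by rewrite -[X in _ + X]mul1mx -h4 mulmxBl addrC subrK.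
rewrite h2.
move: (Z1 *m A^T *m Cm *m Z2) (Z1 *m A^T *m D) (B^T *m Cm *m Z2) (D^T *m B) => X1 X2 X3 X4.
by apply/matrixP => i j; rewrite !mxE; ring.
Qed.

Lemma jfac_jnum_tr M Z : in_Sp M -> Z^T = Z ->
  (jfac M Z)^T *m jnum M Z = (jnum M Z)^T *m jfac M Z.
Proof.
move=> /Sp_blocks /= [h1 h2 h3 h4] Zs; apply/eqP; rewrite -subr_eq0; apply/eqP.
by rewrite /jfac /jnum !trmxD !trmx_mul Zs (sp_form _ _ h1 h2 h3 h4) subrr.
Qed.

Lemma jfac_jnum_conj M Z : in_Sp M -> Z^T = Z ->
  (conj (jfac M Z))^T *m jnum M Z - (conj (jnum M Z))^T *m jfac M Z = Z - conj Z.
Proof.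
move=> /Sp_blocks /= [h1 h2 h3 h4] Zs.
have Zcs : (conj Z)^T = conj Z by rewrite map_trmx Zs.
have cA : conj (ulsubmx (cmx M)) = ulsubmx (cmx M) by apply/matrixP => i j; rewrite !mxE conj_int.
have cB : conj (ursubmx (cmx M)) = ursubmx (cmx M) by apply/matrixP => i j; rewrite !mxE conj_int.
have cC : conj (dlsubmx (cmx M)) = dlsubmx (cmx M) by apply/matrixP => i j; rewrite !mxE conj_int.
have cD : conj (drsubmx (cmx M)) = drsubmx (cmx M) by apply/matrixP => i j; rewrite !mxE conj_int.
rewrite /jfac /jnum !map_mxD !map_mxM cA cB cC cD.
by rewrite !trmxD !trmx_mul Zcs (sp_form _ _ h1 h2 h3 h4).
Qed.

(** With v = x + i y and Y = Im Z, the cross terms cancel by symmetry of Y, and x Y x^T + y Y y^T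
    remains. *)
Lemma herm_pos Z (v : 'rV[C]_g) : siegelH Z -> v != 0 ->
  exists2 r : R, 0 < r & (conj v *m (Z - conj Z) *m v^T) 0 0 = 2 * 'i%C * r%:C.
Proof.
move=> [Zs Zp] v0.
pose Y : 'M[R]_g := map_mx (@complex.Im R) Z.
pose toC := map_mx (real_complex R).
pose x : 'rV[R]_g := map_mx (@complex.Re R) v; pose y : 'rV[R]_g := map_mx (@complex.Im R) v.
have vE : v = toC _ _ x + 'i%C *: toC _ _ y.
  by apply/matrixP => i j; rewrite !mxE {1}(complexE (v i j)).
have cvE : conj v = toC _ _ x - 'i%C *: toC _ _ y.
  apply/matrixP => i j; rewrite !mxE; case: (v i j) => a b /=.
  by apply/eqP; rewrite eq_complex /=; apply/andP; split; apply/eqP; ring.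
have ZE : Z - conj Z = (2 * 'i%C) *: toC _ _ Y.
  apply/matrixP => i j; rewrite !mxE; case: (Z i j) => a b /=.
  rewrite (nat_realC R 2).
  by apply/eqP; rewrite eq_complex /=; apply/andP; split; apply/eqP; ring.
have Ys : Y^T = Y by rewrite /Y map_trmx Zs.
have psdY (u : 'rV[R]_g) : 0 <= (u *m Y *m u^T) 0 0.
  have [->|u0] := eqVneq u 0; first by rewrite !mul0mx mxE.
  exact/ltW/Zp.
exists ((x *m Y *m x^T) 0 0 + (y *m Y *m y^T) 0 0).
  have [x0|x0] := eqVneq x 0; last by rewrite ltr_pwDl ?Zp.
  have y0 : y != 0.
    apply: contra v0 => /eqP y0; rewrite vE x0 y0 /toC !map_mx0 scaler0 addr0.
    by [].
  by rewrite ltr_wpDl ?psdY ?Zp.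
clearbody x y; rewrite -[LHS]/(bil (Z - conj Z) (conj v) v) ZE bilQZ; congr (_ * _).
have real_q (p q : 'rV[R]_g) : bil (toC _ _ Y) (toC _ _ p) (toC _ _ q) = (bil Y p q)%:C.
  by rewrite /bil /toC map_trmx -!map_mxM mxE.
rewrite cvE vE bilDr !bilDl !bilZr !bilNl !bilZl !real_q (bil_sym y x Ys).
rewrite -[(x *m Y *m x^T) 0 0]/(bil Y x x) -[(y *m Y *m y^T) 0 0]/(bil Y y y) rmorphD /=.
have i2 : 'i%C * 'i%C = -1 :> C by rewrite -expr2 sqr_i.
by rewrite mulrN mulrA i2; ring.
Qed.

(** A kernel vector of CZ + D would annihilate the left-hand side of [jfac_jnum_conj], against
    [herm_pos]. *)
Lemma jfac_unit M Z : in_Sp M -> siegelH Z -> jfac M Z \in unitmx.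
Proof.
move=> spM HZ; rewrite unitmxE unitfE -det_tr; apply/negP => /det0P [v v0 hv].
have [r r0] := herm_pos HZ v0.
rewrite -(jfac_jnum_conj spM HZ.1) mulmxBr mulmxBl.
have E1 : jfac M Z *m v^T = 0 by rewrite -[jfac M Z]trmxK -trmx_mul hv trmx0.
have E2 : conj v *m (conj (jfac M Z))^T = 0.
  by rewrite map_trmx -map_mxM hv map_mx0.
rewrite mulmxA E2 !mul0mx -!mulmxA E1 !mulmx0 subrr mxE => /esym/eqP.
rewrite !mulf_eq0 pnatr_eq0 /= => /orP[|].
  by rewrite eq_complex /= oner_eq0 andbF.
by rewrite eq_complex /= gt_eqF.
Qed.

Lemma act_siegelH M Z : in_Sp M -> siegelH Z -> siegelH (act M Z).
Proof.
move=> spM HZ; have uQ := jfac_unit spM HZ; have [Zs Zp] := HZ.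
set Q := jfac M Z in uQ *; set P := jnum M Z.
have sym : (act M Z)^T = act M Z.
  rewrite /act -/P -/Q trmx_mul trmx_inv.
  have uQt : Q^T \in unitmx by rewrite unitmx_tr.
  apply: (can_inj (mulKmx uQt)); rewrite mulKVmx// mulmxA.
  by rewrite (jfac_jnum_tr spM Zs) mulmxK.
split => // x x0.
pose toC := map_mx (real_complex R).
(* Pulling x back by CZ + D turns the form of the new imaginary part at x into the Hermitian form of
   Im Z at v. *)
pose v : 'rV[C]_g := (invmx Q *m (toC _ _ x)^T)^T.
have Qv : Q *m v^T = (toC _ _ x)^T by rewrite /v trmxK mulKVmx.
have xr : conj (toC _ _ x) = toC _ _ x.
  by apply/matrixP => i j; rewrite !mxE conjc_real.
have vQ : conj v *m (conj Q)^T = toC _ _ x.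
  by rewrite map_trmx -map_mxM -[v]trmxK -trmx_mul Qv trmxK xr.
have v0 : v != 0.
  clearbody v; apply: contra_neq x0 => v0; move: Qv; rewrite v0 trmx0 mulmx0 => /(congr1 trmx).
  rewrite trmxK trmx0 => /esym/matrixP h; apply/matrixP => i j.
  by have := h i j; rewrite !mxE => -[].
have [r r0 hr] := herm_pos HZ v0.
clearbody v.
have ZE : act M Z - conj (act M Z) = (2 * 'i%C) *: toC _ _ (map_mx (@complex.Im R) (act M Z)).
  apply/matrixP => i j; rewrite !mxE; case: (\sum_(_ | _) _) => a b /=.
  rewrite (nat_realC R 2).
  by apply/eqP; rewrite eq_complex /=; apply/andP; split; apply/eqP; ring.
have E1 : conj v *m (conj Q)^T *m P *m v^T = toC _ _ x *m act M Z *m (toC _ _ x)^T.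
  by rewrite vQ /act -/P -/Q -!mulmxA -Qv mulKmx.
have E2 : conj v *m (conj P)^T *m Q *m v^T = toC _ _ x *m conj (act M Z) *m (toC _ _ x)^T.
  have QtA : Q^T *m act M Z = P^T by rewrite /act -/P -/Q mulmxA (jfac_jnum_tr spM Zs) mulmxK.
  have -> : toC _ _ x *m conj (act M Z) = conj v *m (conj P)^T.
    by rewrite -vQ -mulmxA map_trmx -map_mxM QtA map_trmx.
  by rewrite -Qv !mulmxA.
have real_q (Y : 'M[R]_g) : (toC _ _ x *m toC _ _ Y *m (toC _ _ x)^T) 0 0 = ((x *m Y *m x^T) 0 0)%:C.
  by rewrite /toC map_trmx -!map_mxM mxE.
have := hr; rewrite -(jfac_jnum_conj spM Zs) -/P -/Q mulmxBr mulmxBl !mulmxA E1 E2.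
rewrite -mulmxBl -mulmxBr ZE -scalemxAr -scalemxAl mxE real_q.
have i20 : 2 * 'i%C != 0 :> C.
  by rewrite mulf_neq0 ?pnatr_eq0// eq_complex /= oner_eq0 andbF.
by move=> /(mulfI i20) /complexI ->.
Qed.

Lemma jnumE M Z : in_Sp M -> siegelH Z -> jnum M Z = act M Z *m jfac M Z.
Proof. by move=> spM HZ; rewrite /act mulmxKV// jfac_unit. Qed.

Lemma jfac_mul M N Z : in_Sp N -> siegelH Z ->
  jfac (M *m N) Z = jfac M (act N Z) *m jfac N Z.
Proof.
move=> spN HZ; rewrite {2}/jfac mulmxDl -mulmxA -jnumE//.
rewrite {1}/jfac cmxM dlsubmx_mul drsubmx_mul /jnum /jfac.
rewrite !(mulmxDl, mulmxDr) !mulmxA -!addrA; congr (_ + _).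
by rewrite addrCA; congr (_ + _); rewrite addrC.
Qed.

Lemma jnum_mul M N Z : in_Sp N -> siegelH Z ->
  jnum (M *m N) Z = jnum M (act N Z) *m jfac N Z.
Proof.
move=> spN HZ; rewrite {2}/jnum mulmxDl -mulmxA -jnumE//.
rewrite {1}/jnum cmxM ulsubmx_mul ursubmx_mul /jnum /jfac.
rewrite !(mulmxDl, mulmxDr) !mulmxA -!addrA; congr (_ + _).
by rewrite addrCA; congr (_ + _); rewrite addrC.
Qed.

Lemma invmx_mul (A B : 'M[C]_g) : A \in unitmx -> B \in unitmx ->
  invmx (A *m B) = invmx B *m invmx A.
Proof.
move=> uA uB; have uAB : A *m B \in unitmx by rewrite unitmx_mul uA.
apply: (can_inj (mulKmx uAB)).
by rewrite mulmxV// -mulmxA mulKVmx// mulmxV.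
Qed.

Lemma act_mul M N Z : in_Sp M -> in_Sp N -> siegelH Z -> act (M *m N) Z = act M (act N Z).
Proof.
move=> spM spN HZ.
have uN := jfac_unit spN HZ; have uM := jfac_unit spM (act_siegelH spN HZ).
rewrite {1}/act (jnum_mul _ spN HZ) (jfac_mul _ spN HZ) (invmx_mul uM uN) mulmxA (mulmxK uN).
exact: erefl.
Qed.

(** The quadratic form in W in the exponential factor of [slash]; [jker_mul] is its cocycle
    relation. *)
Definition jker M Z : 'M[C]_g := invmx (jfac M Z) *m dlsubmx (cmx M).

(** This identity turns the second term of [jker_mul] into a congruence, that is, into the kernel of
    M evaluated at the transformed W. *)
Lemma jnum_act M Z : in_Sp M -> siegelH Z ->
  ulsubmx (cmx M) - act M Z *m dlsubmx (cmx M) = (invmx (jfac M Z))^T.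
Proof.
move=> spM HZ; have uM := jfac_unit spM HZ.
have uMt : (jfac M Z)^T \in unitmx by rewrite unitmx_tr.
apply: (can_inj (mulKmx uMt)).
rewrite trmx_inv mulmxV// mulmxBr mulmxA.
have -> : (jfac M Z)^T *m act M Z = (jnum M Z)^T.
  by rewrite /act mulmxA (jfac_jnum_tr spM HZ.1) mulmxK.
have [h1 h2 h3 h4] := Sp_blocks spM.
rewrite /jfac /jnum !trmxD !trmx_mul HZ.1 !mulmxDl -!mulmxA h1 opprD addrACA subrr add0r.
exact: h4.
Qed.

Lemma jker_alg (jN jM CM DM X CN AN : 'M[C]_g) : jM \in unitmx -> jM = CM *m X + DM ->
  invmx jN *m invmx jM *m (CM *m AN + DM *m CN) =
  invmx jN *m CN + invmx jN *m (invmx jM *m CM) *m (AN - X *m CN).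
Proof.
move=> uM E; have -> : CM *m AN + DM *m CN = jM *m CN + CM *m (AN - X *m CN).
  rewrite E mulmxBr mulmxDl mulmxA.
  move: (CM *m AN) (CM *m X *m CN) (DM *m CN) => X1 X2 X3.
  by apply/matrixP => i j; rewrite !mxE; ring.
by rewrite mulmxDr !mulmxA mulmxKV.
Qed.

Lemma jker_mul M N Z : in_Sp M -> in_Sp N -> siegelH Z ->
  jker (M *m N) Z = jker N Z + invmx (jfac N Z) *m jker M (act N Z) *m (invmx (jfac N Z))^T.
Proof.
move=> spM spN HZ.
have uN := jfac_unit spN HZ; have uM := jfac_unit spM (act_siegelH spN HZ).
rewrite /jker (jfac_mul _ spN HZ) (invmx_mul uM uN) cmxM dlsubmx_mul -(jnum_act spN HZ).
exact: jker_alg.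
Qed.

Lemma slashE k m M (phi : fn R g) Z W : slash k m M phi Z W =
  (\det (jfac M Z)) ^- k * eC (- (m%:R * bil (jker M Z) W W)) *
  phi (act M Z) (W *m invmx (jfac M Z)).
Proof. by rewrite /slash /bil /jker mulmxA. Qed.

Lemma slash_mul k m M N (phi : fn R g) Z W : in_Sp M -> in_Sp N -> siegelH Z ->
  slash k m (M *m N) phi Z W = slash k m N (slash k m M phi) Z W.
Proof.
move=> spM spN HZ; rewrite !slashE.
have uN := jfac_unit spN HZ; have uM := jfac_unit spM (act_siegelH spN HZ).
have E : bil (invmx (jfac N Z) *m jker M (act N Z) *m (invmx (jfac N Z))^T) W W =
  bil (jker M (act N Z)) (W *m invmx (jfac N Z)) (W *m invmx (jfac N Z)).
  by move: (jker _ _) (invmx _) => X Y; rewrite /bil trmx_mul !mulmxA.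
rewrite act_mul// jker_mul// bilQD E jfac_mul// det_mulmx invmx_mul// (mulmxA W).
rewrite mulrDr opprD eCD exprMn invfM.
have alg (a b c d e : C) : d * e * (b * c) * a = e * b * (d * c * a) by ring.
exact: alg.
Qed.

Lemma eq_slash k m M (phi psi : fn R g) Z W : in_Sp M -> siegelH Z ->
  (forall Z W, siegelH Z -> phi Z W = psi Z W) -> slash k m M phi Z W = slash k m M psi Z W.
Proof. by move=> spM HZ h; rewrite !slashE h//; apply: act_siegelH. Qed.

Lemma jfac1 Z : jfac 1%:M Z = 1%:M.
Proof.
rewrite /jfac /intC map_mx1 scalar_mx_block block_mxKdl block_mxKdr.
by rewrite mul0mx add0r.
Qed.

Lemma jnum1 Z : jnum 1%:M Z = Z.
Proof.
rewrite /jnum /intC map_mx1 scalar_mx_block block_mxKul block_mxKur.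
by rewrite mul1mx addr0.
Qed.

Lemma slash1 k m (phi : fn R g) Z W : slash k m 1%:M phi Z W = phi Z W.
Proof.
rewrite slashE /act /jker jnum1 jfac1 invmx1 !mulmx1 mul1mx det1 expr1n invr1 mul1r.
have -> : dlsubmx (cmx (1%:M : Mat)) = 0.
  by apply/matrixP => i j; rewrite !mxE eq_rlshift.
by rewrite /bil mulmx0 mul0mx mxE mulr0 oppr0 eC0 mul1r.
Qed.

Lemma jfac_transl S Z : jfac (transl S) Z = 1%:M.
Proof.
rewrite /jfac /transl map_block_mx block_mxKdl block_mxKdr intC_intr map_mx0 map_mx1.
by rewrite mul0mx add0r.
Qed.

Lemma slash_transl k m S (phi : fn R g) Z W :
  slash k m (transl S) phi Z W = phi (Z + cmx S) W.
Proof.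
rewrite slashE /act /jker jfac_transl invmx1 !mulmx1 mul1mx det1 expr1n invr1 mul1r.
have -> : dlsubmx (cmx (transl S)) = 0 by rewrite /transl map_block_mx block_mxKdl intC_intr map_mx0.
rewrite /bil mulmx0 mul0mx mxE mulr0 oppr0 eC0 mul1r.
by rewrite /jnum /transl map_block_mx block_mxKul block_mxKur intC_intr map_mx1 mul1mx.
Qed.

Lemma slash_Sp k m (phi : fn R g) :
  (forall S Z W, S^T = S -> siegelH Z -> slash k m (transl S) phi Z W = phi Z W) ->
  (forall l Z W, siegelH Z -> slash k m (partial_inv l) phi Z W = phi Z W) ->
  forall M Z W, in_Sp M -> siegelH Z -> slash k m M phi Z W = phi Z W.
Proof.
move=> hT hJ M Z W spM HZ.
suff [] : in_Sp M /\ forall Z W, siegelH Z -> slash k m M phi Z W = phi Z W by move=> _; apply.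
elim: (spgen_Sp spM) => {M spM Z W HZ} [|M S Ss _ [spM IH]|M l _ [spM IH]].
- by split; [rewrite /in_Sp trmx1 mul1mx mulmx1|move=> Z W _; exact: slash1].
- have spS := in_Sp_transl Ss; split; first exact: in_SpM.
  by move=> Z W HZ; rewrite slash_mul// (eq_slash _ _ _ spS HZ IH) hT.
- have spJ := in_Sp_partial_inv l; split; first exact: in_SpM.
  by move=> Z W HZ; rewrite slash_mul// (eq_slash _ _ _ spJ HZ IH) hJ.
Qed.

End SymplecticAction.

(** * Positive definite forms and sums over lattices *)

Section PosDef.
Variables (R : realType) (g : nat).

Definition sqn (x : 'rV[R]_g) : R := \sum_i x 0 i ^+ 2.

Lemma sqn_ge0 x : 0 <= sqn x.
Proof. by apply: sumr_ge0 => i _; apply: sqr_ge0. Qed.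

Lemma sqn_eq0 x : sqn x = 0 -> x = 0.
Proof.
move/eqP; rewrite psumr_eq0 => [/allP h|i _]; last exact: sqr_ge0.
apply/matrixP => i j; rewrite ord1 mxE.
by have := h j (mem_index_enum j); rewrite /= sqrf_eq0 => /eqP.
Qed.

Lemma sqn0 : sqn 0 = 0.
Proof. by rewrite /sqn big1// => i _; rewrite mxE expr0n. Qed.

Lemma bil0l (Y : 'M[R]_g) x : bil Y 0 x = 0.
Proof. by rewrite /bil !mul0mx mxE. Qed.

Lemma sqnZ c x : sqn (c *: x) = c ^+ 2 * sqn x.
Proof. by rewrite /sqn mulr_sumr; apply: eq_bigr => i _; rewrite mxE exprMn. Qed.

Lemma continuous_bigsum (T : topologicalType) (I : Type) (r : seq I) (f : I -> T -> R) :
  (forall i, continuous (f i)) -> continuous (fun x => \sum_(i <- r) f i x).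
Proof.
move=> h; elim: r => [|i r IH].
  by under eq_fun do rewrite big_nil; exact: cst_continuous.
under eq_fun do rewrite big_cons.
by move=> x; apply: cvgD; [exact: h|exact: IH].
Qed.

Lemma continuous_mul (T : topologicalType) (f h : T -> R) :
  continuous f -> continuous h -> continuous (fun x => f x * h x).
Proof. by move=> cf ch x; apply: cvgM; [exact: cf|exact: ch]. Qed.

Lemma continuous_bil (Y : 'M[R]_g) : continuous (fun x : 'rV[R]_g => bil Y x x).
Proof.
under eq_fun do rewrite bil_sum.
apply: continuous_bigsum => i; apply: continuous_bigsum => j.
apply: continuous_mul; last exact: coord_continuous.
by apply: continuous_mul; [exact: coord_continuous|exact: cst_continuous].
Qed.

Lemma continuous_sqn : continuous sqn.
Proof.
apply: continuous_bigsum => i; under eq_fun do rewrite expr2.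
by apply: continuous_mul; exact: coord_continuous.
Qed.

(** The minimum over the compact unit sphere, extended by homogeneity; an empty sphere means that 0
    is the only vector. *)
Lemma posdef_lower (Y : 'M[R]_g) : posdef Y ->
  exists2 c : R, 0 < c & forall x, c * sqn x <= bil Y x x.
Proof.
move=> pY; pose S := [set x : 'rV[R]_g | sqn x = 1].
have [S0|S0] := pselect (S !=set0); last first.
  exists 1 => // x; suff -> : x = 0 by rewrite sqn0 bil0l mulr0.
  apply: sqn_eq0; apply: contrapT => /eqP x0; apply: S0.
  exists ((Num.sqrt (sqn x))^-1 *: x); rewrite /S /= sqnZ exprVn sqr_sqrtr ?sqn_ge0//.
  by rewrite mulVf.
have cS : compact S.
  apply: bounded_closed_compact.
    exists 1; split; first exact: num_real.
    move=> M M1 x Sx; rewrite /= /Num.norm /= mx_normrE.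
    apply/bigmax_leP; split => [|[i j] _ /=]; first exact: le_trans ler01 (ltW M1).
    apply: le_trans (ltW M1); rewrite ord1.
    rewrite -(@expr_le1 _ 2)// real_normK ?num_real// -[leRHS]Sx /sqn (bigD1 j)//= lerDl.
    by apply: sumr_ge0 => k _; exact: sqr_ge0.
  apply: (@preimage_closed _ _ sqn [set 1]); last first.
    by apply: compact_closed; [exact: norm_hausdorff|exact: compact_set1].
  by move=> x _; exact: continuous_sqn.
have [x0 Sx0 hx0] := compact_EVT_min S0 cS (continuous_subspaceT (continuous_bil (Y := Y))).
rewrite inE in Sx0.
have x0n : x0 != 0.
  apply: contra_eq_neq Sx0 => ->; rewrite /S /= /sqn big1 ?(eq_sym 0) ?oner_eq0// => i _.
  by rewrite mxE expr0n.
exists (bil Y x0 x0); first exact: pY.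
move=> x; have [->|xn] := eqVneq x 0.
  by rewrite sqn0 bil0l mulr0.
have sx : 0 < sqn x.
  by rewrite lt_neqAle sqn_ge0 andbT eq_sym; apply: contra_neq xn; exact: sqn_eq0.
pose s := Num.sqrt (sqn x); have s0 : 0 < s by rewrite sqrtr_gt0.
have Sy : (s^-1 *: x) \in S.
  by rewrite inE /S /= sqnZ exprVn sqr_sqrtr ?sqn_ge0// mulVf// gt_eqF.
have := hx0 _ Sy; rewrite bilZl bilZr mulrA -invfM -expr2 sqr_sqrtr ?sqn_ge0//.
by rewrite mulrC -ler_pdivlMr// invrK mulrC ler_pdivlMr// => h; rewrite mulrC.
Qed.

End PosDef.

Section LatticeSum.
Variable R : realType.

(** Finitely many lattice points lie in a box S^g, over which the sum of products factors. *)
Lemma psum_le_prod (g : nat) (f : int -> R) B : (forall n, 0 <= f n) -> psum_le f B ->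
  psum_le (fun n : 'rV[int]_g => \prod_i f (n 0 i)) (B ^+ g).
Proof.
move=> f0 hB F uF.
pose S := undup (flatten [seq [seq (n : 'rV[int]_g) 0 i | i <- enum 'I_g] | n <- F]).
have uS : uniq S by exact: undup_uniq.
have inS (n : 'rV[int]_g) i : n \in F -> n 0 i \in S.
  move=> nF; rewrite mem_undup; apply/flattenP; exists [seq n 0 i | i <- enum 'I_g].
    by apply: map_f.
  by apply: map_f; rewrite mem_enum.
pose row (h : {ffun 'I_g -> 'I_(size S)}) : 'rV[int]_g := \row_i nth 0 S (h i).
have inj_row : injective row.
  move=> h h' /matrixP E; apply/ffunP => i; apply: val_inj.
  by have := E 0 i; rewrite !mxE => /eqP; rewrite nth_uniq// => /eqP.
have prod0 n : 0 <= \prod_i f ((n : 'rV[int]_g) 0 i) by apply: prodr_ge0.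
apply: (@le_trans _ _ (\sum_(n <- map row (enum {ffun 'I_g -> 'I_(size S)})) \prod_i f (n 0 i))).
  apply: sum_subset => //; first by rewrite map_inj_uniq ?enum_uniq.
  move=> n nF; apply/mapP.
  have lt (i : 'I_g) : (index ((n : 'rV[int]_g) 0%R i) S < size S)%N by rewrite index_mem inS.
  exists [ffun i => Ordinal (lt i)]; first by rewrite mem_enum.
  by apply/matrixP => k i; rewrite ord1 mxE ffunE /= nth_index// inS.
rewrite big_map big_enum /=.
have -> : \sum_(h : {ffun 'I_g -> 'I_(size S)}) \prod_i f (row h 0 i) =
   \prod_(i < g) \sum_(k < size S) f (nth 0 S k).
  rewrite bigA_distr_bigA /=; apply: eq_bigr => h _.
  by apply: eq_bigr => i _; rewrite mxE.
rewrite prodr_const card_ord lerXn2r ?nnegrE ?sumr_ge0//.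
  by apply: le_trans (hB [::] isT); rewrite big_nil.
by have := hB S uS; rewrite (big_nth 0) big_mkord.
Qed.

End LatticeSum.

(** * Theta functions with characteristics *)

Section Theta.
Variables (R : realType) (g : nat).
Local Notation C := (Num.NumField.sort (R[i])).
Local Notation toC := (map_mx (real_complex R)).
Implicit Types (a b x : 'rV[R]_g) (Z : 'M[C]_g) (W : 'rV[C]_g) (n : 'rV[int]_g).

Definition rvec n a : 'rV[R]_g := map_mx intr n + a.

Definition texp b Z W x : C := 2^-1 * bil Z (toC x) (toC x) + dot (toC x) (W + toC b).

Definition tterm a b Z W n : C := eC (texp b Z W (rvec n a)).

Definition theta a b Z W : C := csum (tterm a b Z W).

(** Changing the entries of Z and W by at most t changes the exponent by at most t [qw x], as
    [texp_diff] shows; this fixes the constant g + 1. *)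
Definition qw x : R := g.+1%:R * (1 + sqn x).

Lemma qw_ge0 x : 0 <= qw x.
Proof. by rewrite mulr_ge0// addr_ge0// sqn_ge0. Qed.

Lemma Im_realM (r : R) (z : C) : complex.Im (r%:C * z) = r * complex.Im z.
Proof. by case: z => u v /=; rewrite mul0r addr0. Qed.

Lemma Im_sum (I : Type) (r : seq I) (F : I -> C) :
  complex.Im (\sum_(i <- r) F i) = \sum_(i <- r) complex.Im (F i).
Proof. by apply: (big_morph (@complex.Im R)) => // -[u v] [u' v']. Qed.

Lemma Im_bil Z x : complex.Im (bil Z (toC x) (toC x)) = bil (map_mx (@complex.Im R) Z) x x.
Proof.
rewrite !bil_sum Im_sum; apply: eq_bigr => i _; rewrite Im_sum; apply: eq_bigr => j _.
by rewrite !mxE mulrAC -rmorphM Im_realM mulrAC.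
Qed.

Lemma Im_dot b W x : complex.Im (dot (toC x) (W + toC b)) = dot x (map_mx (@complex.Im R) W).
Proof.
rewrite !dot_sum Im_sum; apply: eq_bigr => j _; rewrite !mxE Im_realM; congr (_ * _).
by case: (W 0 j) => u v /=; rewrite addr0.
Qed.

Lemma nrm_tterm a b Z W n : nrm (tterm a b Z W n) =
  expR (- (pi * bil (map_mx (@complex.Im R) Z) (rvec n a) (rvec n a) +
           2 * pi * dot (rvec n a) (map_mx (@complex.Im R) W))).
Proof.
rewrite /tterm nrm_eC /texp raddfD /= Im_dot.
have -> : 2^-1 = (2^-1 : R)%:C :> C by rewrite fmorphV /= rmorph_nat.
by rewrite Im_realM Im_bil; congr expR; field.
Qed.

(** Half of the quadratic decay pi c |x|^2 is spent on the weight, the other half on the terms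
    linear in x, leaving a product of one-variable geometric majorants. *)
Lemma tterm_weight a b Z W : siegelH Z -> exists2 r : R, 0 < r & exists B : R,
  psum_le (fun n => nrm (tterm a b Z W n) * expR (r * qw (rvec n a))) B.
Proof.
move=> [_ pY]; set Y := map_mx _ Z in pY; have p0 := pi_gt0 R.
have [c c0 hc] := posdef_lower pY.
pose v := \sum_j `|complex.Im (W 0 j)|.
have c1 : 0 < pi * c / 2 by rewrite divr_gt0// mulr_gt0.
have [K hK] := @quad_bound R _ (2 * pi * v) c1.
pose r := pi * c / 2 / g.+1%:R.
exists r; first by rewrite divr_gt0.
pose A := expR (pi * c / 2 + \sum_(i < g) (K + `|a 0 i|)).
exists (A * (2 * (1 + 1^-1)) ^+ g) => F uF.
apply: (@le_trans _ _ (\sum_(n <- F) A * \prod_i expR (- (1 * `|n 0 i|%:~R)))); last first.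
  rewrite -mulr_sumr ler_wpM2l ?expR_ge0//.
  have := @psum_le_prod R g (fun k : int => expR (- (1 * `|k|%:~R))) _
    (fun k => expR_ge0 _) (psum_le_exp_int ltr01).
  by apply.
apply: ler_sum => n _; rewrite nrm_tterm -/Y -expR_sum -!expRD ler_expR.
set x := rvec n a.
have h1 : - dot x (map_mx (@complex.Im R) W) <= \sum_i v * `|x 0 i|.
  apply: (le_trans (ler_norm _)); rewrite normrN dot_sum; apply: (le_trans (ler_norm_sum _ _ _)).
  apply: ler_sum => i _; rewrite normrM mulrC ler_wpM2r// /v (bigD1 i)//=.
  by rewrite [X in `|X|]mxE lerDl sumr_ge0.
have h2 : r * qw x = pi * c / 2 + \sum_i pi * c / 2 * x 0 i ^+ 2.
  by rewrite /r /qw /sqn mulrA divfK ?pnatr_eq0// mulrDr mulr1 mulr_sumr.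
have h3 := ler_wpM2l (ltW p0) (hc x).
have h4 : pi * (c * sqn x) = \sum_i pi * c * x 0 i ^+ 2 by rewrite mulrA /sqn mulr_sumr.
have h5 := ler_wpM2l (ltW (mulr_gt0 (ltr0Sn R 1) p0)) h1.
have h6 : \sum_i (- (pi * c / 2 * x 0 i ^+ 2) + 2 * pi * v * `|x 0 i|) <=
   \sum_i (K + `|a 0 i| - 1 * `|n 0 i|%:~R).
  apply: ler_sum => i _; have := hK `|x 0 i| (normr_ge0 _).
  rewrite real_normK ?num_real// => h; apply: (le_trans h).
  have : `|n 0 i|%:~R <= `|x 0 i| + `|a 0 i|.
    rewrite intr_norm -(normrN (a 0 i)); apply: le_trans (ler_normD _ _).
    by rewrite /x !mxE addrK.
  by lra.
have e1 : \sum_i pi * c * x 0 i ^+ 2 = 2 * \sum_i pi * c / 2 * x 0 i ^+ 2.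
  by rewrite mulr_sumr; apply: eq_bigr => i _; field.
have e2 : 2 * pi * (\sum_i v * `|x 0 i|) = \sum_i 2 * pi * v * `|x 0 i|.
  by rewrite mulr_sumr; apply: eq_bigr => i _; rewrite mulrA.
move: h6; rewrite !big_split /= !sumrN => h6.
rewrite h2; rewrite h4 e1 in h3; rewrite e2 in h5.
by lra.
Qed.

Lemma summ_tterm a b Z W : siegelH Z -> summ (tterm a b Z W).
Proof.
move=> HZ; have [r r0 [B hB]] := tterm_weight a b W HZ.
by apply: expfam_summ0 hB => // n; exact: qw_ge0.
Qed.

Lemma norm_sum_sq x : \sum_i `|x 0 i| <= g%:R + sqn x /\
  (\sum_i `|x 0 i|) ^+ 2 <= g%:R * sqn x.
Proof.
split.
  have -> : g%:R = \sum_(i < g) 1 :> R by rewrite sumr_const card_ord.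
  rewrite /sqn -big_split /=; apply: ler_sum => i _.
  rewrite -(real_normK (num_real (x 0 i))).
  by have := sqr_ge0 (`|x 0 i| - 1); have := sqr_ge0 `|x 0 i|; rewrite sqrrB1 mulr2n; lra.
have -> : (\sum_i `|x 0 i|) ^+ 2 = \sum_i \sum_j `|x 0 i| * `|x 0 j|.
  by rewrite expr2 mulr_suml; apply: eq_bigr => i _; rewrite mulr_sumr.
apply: (@le_trans _ _ (\sum_(i < g) \sum_(j < g) (x 0 i ^+ 2 / 2 + x 0 j ^+ 2 / 2))).
  apply: ler_sum => i _; apply: ler_sum => j _.
  rewrite -(real_normK (num_real (x 0 i))) -(real_normK (num_real (x 0 j))).
  by have := sqr_ge0 (`|x 0 i| - `|x 0 j|); rewrite sqrrB mulr2n; lra.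
have E (i : 'I_g) : \sum_(j < g) (x 0 i ^+ 2 / 2 + x 0 j ^+ 2 / 2) =
    g%:R * (x 0 i ^+ 2 / 2) + sqn x / 2.
  by rewrite big_split /= sumr_const card_ord -mulr_suml mulr_natl.
rewrite (eq_bigr _ (fun i _ => E i)) big_split /= -mulr_sumr -mulr_suml sumr_const card_ord.
by rewrite -/(sqn x) -[_ *+ g]mulr_natl; lra.
Qed.

Lemma weight_bound (t G q S S2 X1 X2 : R) : 0 <= t -> 0 <= G -> 0 <= q -> S <= G + q ->
  S2 <= G * q -> X1 <= t * S2 -> X2 <= t * S -> 2^-1 * X1 + X2 <= t * ((G + 1) * (1 + q)).
Proof.
move=> t0 G0 q0 /(ler_wpM2l t0); rewrite mulrDr => e1 /(ler_wpM2l t0) e2 h1 h2.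
have -> : t * ((G + 1) * (1 + q)) = t * (G * q) + t * G + t + t * q by ring.
have := mulr_ge0 t0 (mulr_ge0 G0 q0); have := mulr_ge0 t0 q0; have := mulr_ge0 t0 G0.
move: (t * (G * q)) (t * G) (t * q) (t * S) (t * S2) e1 e2 h1 h2 => a1 a2 a3 a4 a5.
by clear S S2; lra.
Qed.

Lemma texpD b Z dZ W dW x : texp b (Z + dZ) (W + dW) x =
  texp b Z W x + (2^-1 * bil dZ (toC x) (toC x) + dot (toC x) dW).
Proof.
by rewrite /texp bilQD (addrAC W) (dotDr _ _ dW) mulrDr addrACA.
Qed.

Lemma texp_diff x (dZ : 'M[C]_g) (dW : 'rV[C]_g) (t : R) : 0 <= t ->
  (forall i j, nrm (dZ i j) <= t) -> (forall j, nrm (dW 0 j) <= t) ->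
  nrm (2^-1 * bil dZ (toC x) (toC x) + dot (toC x) dW) <= t * qw x.
Proof.
move=> t0 hZ hW; have [s1 s2] := norm_sum_sq x.
have b1 : nrm (bil dZ (toC x) (toC x)) <= t * (\sum_i `|x 0 i|) ^+ 2.
  rewrite bil_sum expr2 mulr_suml mulr_sumr; apply: (le_trans (nrm_sum _ _ _)).
  apply: ler_sum => i _; rewrite mulr_sumr mulr_sumr; apply: (le_trans (nrm_sum _ _ _)).
  apply: ler_sum => j _; rewrite !nrmM !mxE !nrm_real mulrAC [leRHS]mulrC.
  by apply: ler_wpM2l; rewrite ?mulr_ge0.
have b2 : nrm (dot (toC x) dW) <= t * \sum_i `|x 0 i|.
  rewrite dot_sum mulr_sumr; apply: (le_trans (nrm_sum _ _ _)).
  by apply: ler_sum => i _; rewrite nrmM mxE nrm_real mulrC ler_wpM2r.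
apply: (le_trans (nrmD _ _)); rewrite nrmM.
have -> : nrm (2^-1 : C) = 2^-1 by rewrite (nrm_natV R 1).
have gE : g.+1%:R = g%:R + 1 :> R by rewrite natr1.
rewrite /qw gE; exact: weight_bound t0 (ler0n _ g) (sqn_ge0 x) s1 s2 b1 b2.
Qed.

Lemma theta_lip a b Z W : siegelH Z -> exists2 K : R, 0 < K & exists2 d : R, 0 < d &
  forall dZ dW (t : R), 0 <= t -> t <= d ->
    (forall i j, nrm ((dZ : 'M[C]_g) i j) <= t) -> (forall j, nrm ((dW : 'rV[C]_g) 0 j) <= t) ->
    nrm (theta a b (Z + dZ) (W + dW) - theta a b Z W) <= K * t.
Proof.
move=> HZ; have [r r0 [B hB]] := tterm_weight a b W HZ; have p0 := pi_gt0 R.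
have B0 : 0 <= B by have := hB [::] isT; rewrite big_nil.
have q0 n : 0 <= qw (rvec n a) by apply: qw_ge0.
exists (5 * (2 * pi) * (2 / r) * B + 1).
  by rewrite ltr_wpDl// !mulr_ge0 ?invr_ge0 ?(ltW r0) ?(ltW p0).
exists (r / (8 * pi)); first by rewrite divr_gt0 ?mulr_gt0.
move=> dZ dW t t0 td hZ hW.
have ht : 2 * (2 * pi * t) <= r / 2.
  by move: td; rewrite ler_pdivlMr ?mulr_gt0//; lra.
pose d n := 2^-1 * bil dZ (toC (rvec n a)) (toC (rvec n a)) + dot (toC (rvec n a)) dW.
have hd n : nrm (d n) <= t * qw (rvec n a) by apply: texp_diff.
have E : (fun n => tterm a b Z W n * eC (d n)) = tterm a b (Z + dZ) (W + dW).
  apply: funext => n; rewrite /tterm -eCD; congr eC.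
  by rewrite texpD.
have h0 := csumP (summ_tterm a b W HZ).
have h1 := csumP (expfam_summ r0 q0 hB t0 ht hd).
have := expfam_dist r0 q0 hB t0 ht hd h0 h1; rewrite E => h; apply: (le_trans h).
have -> : 5 * (2 * pi) * (2 / r) * t * B = 5 * (2 * pi) * (2 / r) * B * t by ring.
by rewrite [(_ + 1) * t]mulrDl mul1r lerDl.
Qed.

Lemma theta_derive a b Z W dZ dW : siegelH Z ->
  exists D, is_derive (0 : C) (1 : C)
    (fun t => theta a b (Z + t *: dZ) (W + t *: dW)) D.
Proof.
move=> HZ; have [r r0 [B hB]] := tterm_weight a b W HZ; have p0 := pi_gt0 R.
pose c : R := 1 + \sum_i \sum_j nrm (dZ i j) + \sum_j nrm (dW 0 j).
have s1 : 0 <= \sum_i \sum_j nrm (dZ i j).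
  by apply: sumr_ge0 => i _; apply: sumr_ge0 => j _; apply: nrm_ge0.
have s2 : 0 <= \sum_j nrm (dW 0 j) by apply: sumr_ge0 => j _; apply: nrm_ge0.
have c0 : 0 < c by rewrite /c -addrA ltr_pwDl// addr_ge0.
have hZ i j : nrm (dZ i j) <= c.
  rewrite /c (bigD1 i)//= (bigD1 j)//=.
  have : 0 <= \sum_(j0 | j0 != j) nrm (dZ i j0) by apply: sumr_ge0 => *; apply: nrm_ge0.
  have : 0 <= \sum_(i0 | i0 != i) \sum_j0 nrm (dZ i0 j0).
    by apply: sumr_ge0 => *; apply: sumr_ge0 => *; apply: nrm_ge0.
  by lra.
have hW j : nrm (dW 0 j) <= c.
  rewrite /c (bigD1 j (F := fun j => nrm (dW 0 j)))//=.
  have : 0 <= \sum_(j0 | j0 != j) nrm (dW 0 j0) by apply: sumr_ge0 => *; apply: nrm_ge0.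
  by lra.
pose q n : R := c * qw (rvec n a).
have q0 n : 0 <= q n by rewrite mulr_ge0 ?qw_ge0// ltW.
have rc0 : 0 < r / c by rewrite divr_gt0.
have hB' : psum_le (fun n => nrm (tterm a b Z W n) * expR (r / c * q n)) B.
  move=> F uF; apply: le_trans (hB F uF); rewrite le_eqVlt; apply/orP; left; apply/eqP.
  by apply: eq_bigr => n _; rewrite /q mulrA divfK// gt_eqF.
pose d n := 2^-1 * bil dZ (toC (rvec n a)) (toC (rvec n a)) + dot (toC (rvec n a)) dW.
have hd n : nrm (d n) <= q n by apply: texp_diff => //; exact: ltW.
apply: (expfam_derive rc0 q0 hB' hd) => s hs.
have E : (fun n => tterm a b Z W n * eC (s * d n)) = tterm a b (Z + s *: dZ) (W + s *: dW).
  apply: funext => n; rewrite /tterm -eCD; congr eC.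
  by rewrite texpD bilQZ dotZr mulrCA -mulrDr.
rewrite /theta -E; apply: csumP.
apply: (@expfam_summ R _ _ _ (r / c) B rc0 q0 hB' _ (nrm s)); first exact: nrm_ge0.
  by move: hs; rewrite ler_pdivlMr ?mulr_gt0//; lra.
by move=> n; rewrite nrmM ler_wpM2l ?nrm_ge0.
Qed.

End Theta.

(** * Theta functions under lattice shifts and translations of Z *)

Section ThetaTransformation.
Variables (R : realType) (g : nat).
Local Notation C := (Num.NumField.sort (R[i])).
Local Notation toC := (map_mx (real_complex R)).
Local Notation cmx := (map_mx (@intC R)).
Implicit Types (a b x : 'rV[R]_g) (Z : 'M[C]_g) (W : 'rV[C]_g) (n nu : 'rV[int]_g).

Lemma toC_rvec n a : toC (rvec n a) = cmx n + toC a.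
Proof. by apply/matrixP => i j; rewrite !mxE rmorphD /= -int_realC. Qed.

Lemma cmxD n nu : cmx (n + nu) = cmx n + cmx nu.
Proof. by apply/matrixP => i j; rewrite !mxE /intC rmorphD. Qed.

Lemma dot_cmx n nu : dot (cmx n) (cmx nu) = (dot n nu)%:~R :> C.
Proof.
by rewrite !dot_sum rmorph_sum; apply: eq_bigr => i _; rewrite !mxE /intC -rmorphM.
Qed.

Lemma bil_cmx (S : 'M[int]_g) n nu : bil (cmx S) (cmx n) (cmx nu) = (bil S n nu)%:~R :> C.
Proof. by rewrite !bil_dot -cmxM dot_cmx. Qed.

Lemma csum_bij (I J : eqType) (f : I -> J) (h : J -> I) (v : J -> C) :
  cancel f h -> cancel h f -> summ v -> csum (v \o f) = csum v.
Proof. by move=> fh hf /csumP s; apply: csumE; exact: has_sum_bij fh hf s. Qed.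

Lemma csumZ (I : eqType) (c : C) (v : I -> C) : summ v ->
  csum (fun i => c * v i) = c * csum v.
Proof. by move=> /csumP s; apply: csumE; exact: has_sumZ. Qed.

Lemma rvec_shift n nu a : rvec n (rvec nu a) = rvec (n + nu) a.
Proof. by apply/matrixP => i j; rewrite !mxE rmorphD /= addrA. Qed.

Lemma csum_shift (v : 'rV[int]_g -> C) nu : summ v -> csum (fun n => v (n + nu)) = csum v.
Proof.
move=> h; apply: (@csum_bij _ _ (fun n => n + nu) (fun n => n - nu)) => // n.
  by rewrite addrK.
by rewrite subrK.
Qed.

Lemma theta_shift_a nu a b Z W : siegelH Z -> theta (rvec nu a) b Z W = theta a b Z W.
Proof.
move=> HZ; transitivity (csum (fun n => tterm a b Z W (n + nu))); last first.
  by apply: csum_shift; exact: summ_tterm.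
apply: eq_csum => n.
by congr (eC (texp _ _ _ _)); exact: rvec_shift.
Qed.

Lemma theta_shift_b nu a b Z W : siegelH Z ->
  theta a (rvec nu b) Z W = eC (dot (toC a) (cmx nu)) * theta a b Z W.
Proof.
move=> HZ; rewrite /theta -csumZ; last exact: summ_tterm.
congr csum; apply: funext => n; rewrite /tterm -eCD; apply: (@eC_eqint _ _ _ (dot n nu)).
rewrite /texp (toC_rvec nu) [cmx nu + _]addrC addrA dotDr [X in _ + (_ + X)]dotC toC_rvec dotDr.
rewrite -dot_cmx (dotC _ (cmx n + _)) !dotDl; set u := bil _ _ _; clearbody u.
move: (dot (cmx n) W) (dot (cmx n) (toC b)) (dot (cmx n) (cmx nu)) (dot (toC a) W) (dot (toC a) (toC b)) => *.
by ring.
Qed.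

(** Translating W by nu Z shifts the first characteristic by the integral vector nu, which
    [theta_shift_a] ignores; mu only contributes the constant e(a mu^T). *)
Lemma theta_heis nu mu a b Z W : siegelH Z ->
  theta a b Z (W + cmx nu *m Z + cmx mu) =
  eC (- (2^-1 * bil Z (cmx nu) (cmx nu) + dot (cmx nu) W) - dot (cmx nu) (toC b)
      + dot (toC a) (cmx mu)) * theta a b Z W.
Proof.
move=> HZ; rewrite -[in RHS](theta_shift_a nu)// /theta -csumZ; last exact: summ_tterm.
congr csum; apply: funext => n; rewrite /tterm -eCD; apply: (@eC_eqint _ _ _ (dot n mu)).
rewrite rvec_shift /texp !toC_rvec cmxD.
have Zs : Z^T = Z by case: HZ.
rewrite !bilDl !bilDr !dotDr !dotDl -dot_cmx.
have sw (u v : 'rV[C]_g) : dot u (v *m Z) = bil Z v u by rewrite dotC -bil_dot.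
rewrite !sw (bil_sym (cmx nu) (cmx n) Zs) (bil_sym (toC a) (cmx n) Zs).
rewrite (bil_sym (toC a) (cmx nu) Zs).
move: (bil Z (cmx n) (cmx n)) (bil Z (cmx n) (cmx nu)) (bil Z (cmx n) (toC a))
  (bil Z (cmx nu) (cmx nu)) (bil Z (cmx nu) (toC a)) (bil Z (toC a) (toC a))
  (dot (cmx n) W) (dot (toC a) W) (dot (cmx nu) W) (dot (cmx n) (toC b))
  (dot (toC a) (toC b)) (dot (cmx nu) (toC b)) (dot (cmx n) (cmx mu)) (dot (toC a) (cmx mu)).
by move=> *; field.
Qed.

Lemma sum_sym_parity (f : 'I_g -> 'I_g -> int) : (forall i j, f i j = f j i) ->
  exists z, \sum_i \sum_j f i j = \sum_i f i i + 2 * z.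
Proof.
move=> fs; exists (\sum_(i < g) \sum_(j < g | (j < i)%N) f i j).
have E i : \sum_j f i j = f i i + \sum_(j < g | (j < i)%N) f i j + \sum_(j < g | (i < j)%N) f i j.
  rewrite (bigD1 i)//= -addrA; congr (_ + _).
  rewrite (bigID (fun j : 'I_g => (j < i)%N))/=; congr (_ + _); apply: eq_bigl => j.
    by rewrite -val_eqE /=; case: ltngtP.
  by rewrite -val_eqE /=; case: ltngtP.
rewrite (eq_bigr _ (fun i _ => E i)) !big_split /= -addrA mulr_sumr; congr (_ + _).
have -> : \sum_(i < g) \sum_(j < g | (i < j)%N) f i j = \sum_(i < g) \sum_(j < g | (j < i)%N) f i j.
  rewrite (exchange_big_dep xpredT)//=; apply: eq_bigr => i _.
  by apply: eq_bigr => j _; exact: fs.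
by rewrite -big_split /=; apply: eq_bigr => i _; rewrite mulr2n mulrDl mul1r.
Qed.

Lemma sqr_parity (k : int) : exists z, k ^+ 2 = k + 2 * z.
Proof.
exists ((k * (k - 1)) %/ 2)%Z; have d2 : (2 %| k * (k - 1))%Z.
  have /orP[h|h] : (2 %| k)%Z || (2 %| k - 1)%Z by lia.
    exact: dvdz_mulr.
  exact: dvdz_mull.
by rewrite mulrC divzK//; ring.
Qed.

Definition diag_row (S : 'M[int]_g) : 'rV[int]_g := \row_i S i i.

(** Off-diagonal terms come in equal pairs, and n_i^2 = n_i modulo 2. Hence the half diagonal in
    [theta_transl]. *)
Lemma bil_parity (S : 'M[int]_g) n : S^T = S ->
  exists z, bil S n n = dot n (diag_row S) + 2 * z.
Proof.
move=> Ss; have [|z hz] := @sum_sym_parity (fun i j => n 0 i * S i j * n 0 j).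
  by move=> i j; rewrite mulrAC [n 0 i * _]mulrC mulrAC -{1}Ss mxE.
rewrite bil_sum hz dot_sum.
have [w hw] : exists w, \sum_i n 0 i * S i i * n 0 i = \sum_j n 0 j * diag_row S 0 j + 2 * w.
  exists (\sum_i S i i * ((n 0%R i ^+ 2 - n 0%R i) %/ 2)%Z).
  rewrite mulr_sumr -big_split /=; apply: eq_bigr => i _; rewrite mxE.
  have [q hq] := sqr_parity (n 0 i); rewrite hq addrAC subrr add0r mulKz//.
  have -> : n 0 i * S i i * n 0 i = S i i * n 0 i ^+ 2 by ring.
  by rewrite hq; ring.
by exists (w + z); rewrite hw mulrDr addrA.
Qed.

Lemma theta_transl (S : 'M[int]_g) a b Z W : S^T = S -> siegelH Z ->
  theta a b (Z + cmx S) W =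
  eC (- (2^-1 * (bil (cmx S) (toC a) (toC a) + dot (toC a) (cmx (diag_row S))))) *
  theta a (b + a *m map_mx intr S + 2^-1 *: map_mx intr (diag_row S)) Z W.
Proof.
move=> Ss HZ; rewrite /theta -csumZ; last exact: summ_tterm.
congr csum; apply: funext => n; rewrite /tterm -eCD.
have [z hz] := bil_parity n Ss; apply: (@eC_eqint _ _ _ z).
rewrite /texp; have -> : toC (b + a *m map_mx intr S + 2^-1 *: map_mx intr (diag_row S)) =
   toC b + toC a *m cmx S + 2^-1 *: cmx (diag_row S).
  rewrite !map_mxD map_mxM; congr (_ + _ *m _ + _).
    by apply/matrixP => i j; rewrite !mxE /intC int_realC.
  have e (r : R) : (2^-1 * r)%:C = 2^-1 * r%:C :> C by rewrite rmorphM fmorphV rmorph_nat.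
  by apply/matrixP => i j; rewrite !mxE /intC int_realC -e.
have Sc : (cmx S)^T = cmx S by rewrite map_trmx Ss.
rewrite !toC_rvec bilQD !addrA !(dotDr _ (_ + _)) dotZr (dotC _ (toC a *m _)) -bil_dot.
rewrite !(dotDl _ _ (cmx (diag_row S))) (bilDl (cmx S)) !(bilDr (cmx S)) dot_cmx.
rewrite (bil_sym (toC a) (cmx n) Sc) bil_cmx hz rmorphD rmorphM /= -[2%:~R]/(2 : C).
move: (bil Z _ _) (dot (cmx n + _) _) (bil _ (cmx n) (toC a))
  (bil _ (toC a) _) ((dot n _)%:~R : C) (dot (toC a) _) (z%:~R : C) => *.
by field.
Qed.

End ThetaTransformation.

(** * Partial inversions and their effect on theta functions *)

Section RankOne.
Variables (K : comUnitRingType) (n : nat).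
Implicit Types (u : 'cV[K]_n) (v : 'rV[K]_n).

(** Two block triangular factorisations of one matrix. For a partial inversion CZ + D is a rank-one
    perturbation of the identity; this and [invmx_rank1] give its determinant and inverse. *)
Lemma det_rank1 u v : \det (1%:M + u *m v) = 1 + (v *m u) 0 0.
Proof.
have d1 : block_mx (1%:M : 'M[K]_1) (- v) u (1%:M : 'M[K]_n) =
    block_mx 1%:M 0 u 1%:M *m block_mx 1%:M (- v) 0 (1%:M + u *m v).
  rewrite mulmx_block !(mulmx0, mul0mx, mulmx1, mul1mx) !addr0 mulmxN.
  by congr block_mx; rewrite addrC addrK.
have d2 : block_mx (1%:M : 'M[K]_1) (- v) u (1%:M : 'M[K]_n) =
    block_mx 1%:M (- v) 0 1%:M *m block_mx (1%:M + v *m u) 0 u 1%:M.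
  rewrite mulmx_block !(mulmx0, mul0mx, mulmx1, mul1mx) !add0r mulNmx.
  by congr block_mx; rewrite addrK.
have := congr1 determinant d2; rewrite {1}d1 !det_mulmx.
rewrite !det_lblock !det_ublock !det1 !mul1r mulr1 => ->.
by rewrite det_mx11 !mxE eqxx.
Qed.

Lemma invmx_rank1 u v (z : K) : (v *m u) 0 0 = z - 1 -> z \is a GRing.unit ->
  1%:M + u *m v \in unitmx /\ invmx (1%:M + u *m v) = 1%:M - z^-1 *: (u *m v).
Proof.
move=> vu uz; have uu : 1%:M + u *m v \in unitmx.
  by rewrite unitmxE det_rank1 vu addrC subrK.
split=> //; apply: (can_inj (mulKmx uu)); rewrite mulmxV//.
have vuM : v *m u = (z - 1)%:M by rewrite [v *m u]mx11_scalar vu.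
rewrite mulmxBr mulmx1 -scalemxAr mulmxDl mul1mx mulmxA -[u *m v *m u]mulmxA vuM.
rewrite mul_mx_scalar -scalemxAl -[X in X + _ *: _]scale1r -scalerDl.
by rewrite addrC [_ + (z - 1)]addrC subrK scalerA mulVr// scale1r addrC addrK.
Qed.

End RankOne.

Section PartialInversion.
Variables (R : realType) (g : nat).
Local Notation C := (Num.NumField.sort (R[i])).
Local Notation cmx := (map_mx (@intC R)).
Implicit Types (Z : 'M[C]_g) (W p : 'rV[C]_g).
Variable l : 'I_g.
Let e : 'rV[C]_g := delta_mx 0 l.
Let et : 'cV[C]_g := delta_mx l 0.

Lemma siegel_diag_upper Z : siegelH Z -> upper (Z l l).
Proof.
move=> [_ pY]; have e0 : (delta_mx 0 l : 'rV[R]_g) != 0.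
  by apply/eqP => /matrixP /(_ 0 l); rewrite !mxE !eqxx => /eqP; rewrite oner_eq0.
have := pY _ e0; rewrite -rowE trmx_delta -colE !mxE.
by [].
Qed.

Lemma delta_et_e : et *m e = delta_mx l l.
Proof. by rewrite /et /e mul_delta_mx. Qed.

Lemma cmx_delta : cmx (delta_mx l l : 'M[int]_g) = delta_mx l l.
Proof. by apply/matrixP => i j; rewrite !mxE /intC; case: (_ && _). Qed.

Lemma cmx_delta1 : cmx (1%:M - delta_mx l l : 'M[int]_g) = 1%:M - delta_mx l l.
Proof.
by apply/matrixP => i j; rewrite !mxE /intC rmorphB /= !natz !pmulrn -!pmulrn.
Qed.

Lemma e_row Z : e *m Z = row l Z. Proof. by rewrite -rowE. Qed.

Lemma jfac_partial_inv Z : jfac (partial_inv l) Z = 1%:M + et *m (row l Z - e).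
Proof.
rewrite /jfac /partial_inv map_block_mx block_mxKdl block_mxKdr cmx_delta cmx_delta1.
by rewrite mulmxBr delta_et_e -e_row mulmxA delta_et_e addrCA.
Qed.

Lemma zeta_et Z : ((row l Z - e) *m et) 0 0 = Z l l - 1.
Proof. by rewrite -colE !mxE !eqxx. Qed.

Lemma jfac_pinv_det Z : \det (jfac (partial_inv l) Z) = Z l l.
Proof. by rewrite jfac_partial_inv det_rank1 zeta_et addrC subrK. Qed.

Lemma jfac_pinv_inv Z : Z l l != 0 -> invmx (jfac (partial_inv l) Z) =
  1%:M - (Z l l)^-1 *: (et *m (row l Z - e)).
Proof.
move=> z0; rewrite jfac_partial_inv.
by have [] := invmx_rank1 (zeta_et Z) (etrans (unitfE (Z l l)) z0).
Qed.

Lemma jker_pinv Z W : Z l l != 0 -> bil (jker (partial_inv l) Z) W W = W 0 l ^+ 2 / Z l l.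
Proof.
move=> z0; have -> : jker (partial_inv l) Z = (Z l l)^-1 *: (et *m e).
  rewrite /jker jfac_pinv_inv// /partial_inv map_block_mx block_mxKdl cmx_delta.
  rewrite -delta_et_e mulmxBl mul1mx -scalemxAl mulmxA -[et *m _ *m et]mulmxA.
  rewrite [(row l Z - e) *m et]mx11_scalar zeta_et mul_mx_scalar -scalemxAl scalerA.
  rewrite -[X in X - _]scale1r -scalerBl; congr (_ *: _).
  by rewrite mulrBr mulVf// mulr1 opprB addrC subrK.
rewrite bilQZ mulrC; congr (_ * _); rewrite bil_dot mulmxA.
have -> : W *m et = (W 0 l)%:M by rewrite [W *m et]mx11_scalar -colE mxE.
by rewrite mul_scalar_mx dotZl dotC /dot trmx_delta -colE mxE expr2.
Qed.

Lemma W_pinv Z W : Z l l != 0 -> W *m invmx (jfac (partial_inv l) Z) =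
  W - (W 0 l / Z l l) *: (row l Z - e).
Proof.
move=> z0; rewrite jfac_pinv_inv// mulmxBr mulmx1 -scalemxAr mulmxA.
have -> : W *m et = (W 0 l)%:M by rewrite [W *m et]mx11_scalar -colE mxE.
by rewrite mul_scalar_mx scalerA mulrC.
Qed.

Lemma act_pinv Z : Z^T = Z -> Z l l != 0 -> act (partial_inv l) Z =
  Z - 2 *: (et *m e) - (Z l l)^-1 *: ((row l Z - e)^T *m (row l Z - e)).
Proof.
move=> Zs z0; set q := row l Z - e.
rewrite /act /jnum /partial_inv map_block_mx block_mxKul block_mxKur -/(partial_inv l).
rewrite cmx_delta1 jfac_pinv_inv// -/q.
have -> : cmx (- delta_mx l l : 'M[int]_g) = - (et *m e).
  rewrite -(scaleN1r (delta_mx l l)) -(scaleN1r (et *m e)) delta_et_e.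
  by rewrite -cmx_delta; apply/matrixP => i j; rewrite !mxE /intC rmorphM.
rewrite -delta_et_e [(1%:M - _) *m Z]mulmxBl mul1mx -mulmxA e_row.
have -> : Z - et *m row l Z - et *m e = Z - 2 *: (et *m e) - et *m q.
  by rewrite /q mulmxBr; apply/matrixP => i j; rewrite !mxE; ring.
rewrite mulmxBr mulmx1 -scalemxAr mulmxA.
have -> : (Z - 2 *: (et *m e) - et *m q) *m et = q^T - Z l l *: et.
  rewrite !mulmxBl -scalemxAl -[et *m e *m et]mulmxA -[et *m q *m et]mulmxA.
  have -> : e *m et = 1%:M by rewrite [e *m et]mx11_scalar -colE !mxE !eqxx.
  have -> : q *m et = (Z l l - 1)%:M by rewrite [q *m et]mx11_scalar zeta_et.
  have -> : Z *m et = (row l Z)^T by rewrite tr_row Zs -colE.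
  rewrite mulmx1 mul_mx_scalar /q; apply/matrixP => i j; rewrite ord1 !mxE.
  by rewrite eqxx andbT; ring.
rewrite mulmxBl scalerBr -scalemxAl scalerA mulVf// scale1r.
by rewrite opprB addrA subrK.
Qed.

Lemma bil_pinv Z p : Z^T = Z -> Z l l != 0 -> bil (act (partial_inv l) Z) p p =
  bil Z p p - 2 * p 0 l ^+ 2 - (Z l l)^-1 * (dot p (row l Z) - p 0 l) ^+ 2.
Proof.
move=> Zs z0; rewrite act_pinv//.
have r1 (u v : 'rV[C]_g) : bil (u^T *m v) p p = dot p u * dot p v.
  rewrite /bil mulmxA -mulmxA [p *m u^T]mx11_scalar [v *m p^T]mx11_scalar.
  by rewrite mul_scalar_mx [LHS]mxE [X in _ * X]mxE eqxx mulr1n [dot p v]dotC.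
have r2 (Q : 'M[C]_g) (c : C) (u v : 'rV[C]_g) :
    bil (Q - c *: (u^T *m v)) p p = bil Q p p - c * (dot p u * dot p v).
  by rewrite bilQD -scaleNr bilQZ r1 mulNr.
have -> : et *m e = e^T *m e by rewrite trmx_delta.
rewrite r2.
rewrite r2.
have -> : dot p (row l Z - e) = dot p (row l Z) - p 0 l by rewrite dotDr dotNr dot_delta.
by rewrite dot_delta -(expr2 (p 0 l)) -expr2.
Qed.

End PartialInversion.

Section ThetaInversion.
Variables (R : realType) (g : nat).
Local Notation C := (Num.NumField.sort (R[i])).
Local Notation toC := (map_mx (real_complex R)).
Local Notation cmx := (map_mx (@intC R)).
Implicit Types (a b : 'rV[R]_g) (Z : 'M[C]_g) (W P : 'rV[C]_g) (n : 'rV[int]_g).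
Variable l : 'I_g.

(** The lattice as pairs (n, k) with n_l = 0; extension by zero to all pairs gives a product index
    set, as [has_sum_pair] requires. *)
Definition fibre (u : 'rV[int]_g -> C) (p : 'rV[int]_g * int) : C :=
  if p.1 0 l == 0 then u (p.1 + p.2 *: delta_mx 0 l) else 0.

Lemma summ_fibre u : summ u -> summ (fibre u).
Proof.
move=> su; apply: (@summ_reindex _ _ _ (fun n => (n - n 0 l *: delta_mx 0 l, n 0 l))).
- by move=> n n' [h1 h2]; move: h1; rewrite h2 => /addIr.
- move=> [n k]; rewrite /fibre /=; case: ifP => [/eqP n0 _|]; last by rewrite eqxx.
  have E : (n + k *: delta_mx 0 l) 0 l = k.
    by rewrite !mxE n0 !eqxx add0r mulr1.
  by exists (n + k *: delta_mx 0 l); rewrite E addrK.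
- apply: eq_summ su => n; rewrite /fibre /= !mxE !eqxx mulr1 subrr eqxx subrK.
  by [].
Qed.

Lemma has_sum_fibre u : summ u -> has_sum (fun n => csum (fun k => fibre u (n, k))) (csum u).
Proof.
move=> su; apply: (@has_sum_pair _ _ _ (fibre u)).
- apply: (@has_sum_reindex _ _ _ (fun n => (n - n 0 l *: delta_mx 0 l, n 0 l))).
  + by move=> n n' [h1 h2]; move: h1; rewrite h2 => /addIr.
  + move=> [n k]; rewrite /fibre /=; case: ifP => [/eqP n0 _|]; last by rewrite eqxx.
    have E : (n + k *: delta_mx 0 l) 0 l = k.
      by rewrite !mxE n0 !eqxx add0r mulr1.
    by exists (n + k *: delta_mx 0 l); rewrite E addrK.
  + apply: eq_has_sum (csumP su) => n; rewrite /fibre /= !mxE !eqxx mulr1 subrr eqxx subrK.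
    by [].
- move=> n; apply: csumP.
  by apply: (@summ_comp_inj _ _ _ (fun k => (n, k)) (fibre u)) (summ_fibre su) => k k' [].
Qed.

Lemma csumZ_neq0 (I : eqType) (c : C) (v : I -> C) : c != 0 -> summ (fun i => c * v i) ->
  summ v /\ csum (fun i => c * v i) = c * csum v.
Proof.
move=> c0 h; suff sv : summ v by split=> //; exact: csumZ.
by have := summZ c^-1 h; apply: eq_summ => i; rewrite mulrA mulVf// mul1r.
Qed.

Lemma summ_fibre_row (u : 'rV[int]_g -> C) n : summ u -> n 0 l = 0 -> summ (fun k => u (n + k *: delta_mx 0 l)).
Proof.
move=> su n0; have := summ_fibre su => /(@summ_comp_inj _ _ _ (fun k => (n, k))).
by move=> h; apply: eq_summ (h _) => [k|k k' [] //]; rewrite /fibre /= n0 eqxx.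
Qed.

Lemma csum_fibre u u' (c : C) : summ u -> summ u' ->
  (forall n, n 0 l = 0 -> csum (fun k => u (n + k *: delta_mx 0 l)) =
     c * csum (fun k => u' (n + k *: delta_mx 0 l))) -> csum u = c * csum u'.
Proof.
move=> su su' h; apply: has_sum_val (has_sum_fibre su) _.
apply: eq_has_sum (has_sumZ c (has_sum_fibre su')) => n.
have [n0|n0] := eqVneq (n 0 l) 0.
  have E v : (fun k => fibre v (n, k)) = (fun k => v (n + k *: delta_mx 0 l)).
    by apply: funext => k; rewrite /fibre /= n0 eqxx.
  by rewrite !E h.
have E v : (fun k => fibre v (n, k)) = (fun=> 0).
  by apply: funext => k; rewrite /fibre /= (negPf n0).
by rewrite !E (csumE (has_sum0 _)) mulr0.
Qed.

(* In the l-th coordinate (a, b) becomes (- b, a). *)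
Definition swap_a a b : 'rV[R]_g := a - (a 0 l + b 0 l) *: delta_mx 0 l.
Definition swap_b a b : 'rV[R]_g := b + (a 0 l - b 0 l) *: delta_mx 0 l.

Lemma texp_fibre Z P (s : C) : Z^T = Z ->
  bil Z (P + s *: delta_mx 0 l) (P + s *: delta_mx 0 l) =
    bil Z P P + 2 * s * dot P (row l Z) + s ^+ 2 * Z l l /\
  (forall V, dot (P + s *: delta_mx 0 l) V = dot P V + s * V 0 l).
Proof.
move=> Zs.
have h1 : bil Z (delta_mx 0 l) P = dot P (row l Z).
  by rewrite bil_dot -rowE dotC.
have h2 : bil Z (delta_mx 0 l) (delta_mx 0 l) = Z l l.
  by rewrite bil_dot -rowE dot_delta mxE.
split.
  rewrite !bilDl !bilDr !bilZl !bilZr (bil_sym P (delta_mx 0 l) Zs) h1 h2.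
  by move: (bil _ _ _) (dot _ _) (Z l l) => *; ring.
by move=> V; rewrite dotDl dotZl [dot (delta_mx _ _) _]dotC dot_delta.
Qed.

Lemma toC_delta (p : 'rV[R]_g) (s : R) :
  toC (p + s *: delta_mx 0 l) = toC p + s%:C *: delta_mx 0 l :> 'rV[C]_g.
Proof.
apply/matrixP => i j; rewrite !mxE rmorphD rmorphM /=; congr (_ + _ * _).
by case: (_ && _).
Qed.

Lemma rvec_delta n (k : int) a (s : R) : rvec (n + k *: delta_mx 0 l) (a - s *: delta_mx 0 l) =
  rvec n (a - a 0 l *: delta_mx 0 l) + (k%:~R + a 0 l - s) *: delta_mx 0 l.
Proof.
apply/matrixP => i j; rewrite !mxE rmorphD rmorphM /=.
have -> : ((i == 0) && (j == l))%:R%:~R = ((i == 0) && (j == l))%:R :> R by case: (_ && _).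
by move: ((_ && _)%:R) => d; ring.
Qed.

(** On the right stand the part common to both sums, the automorphy factor, and the exponent of the
    dual Gaussian; only the last involves k. *)
Lemma inversion_exponent (z BP y DW Db w k al bl s : C) : z != 0 -> s = k - bl ->
  2^-1 * (BP + 2 * s * y + s ^+ 2 * z - 2 * s ^+ 2 - z^-1 * (y + s * z - s) ^+ 2) +
    (DW + s * w - w / z * (y + s * z - s) + (Db + s * al)) =
  (2^-1 * BP + (DW + Db)) + (2^-1 * w ^+ 2 / z - al * bl) +
    (2^-1 * (- z^-1) * (y + w + bl - k) ^+ 2 + k * al).
Proof. by move=> z0 ->; field. Qed.

(** Along the l-th coordinate the series is a one-variable theta series with tau = Z_ll, and the
    transformed one is its Gaussian dual. On each such line [theta1_inversion] applies, the other
    coordinates contributing the same factor e(A) on both sides. *)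
Lemma theta_partial_inv a b Z W : siegelH Z ->
  theta (swap_a a b) (swap_b a b) (act (partial_inv l) Z)
    (W *m invmx (jfac (partial_inv l) Z)) =
  eC (2^-1 * W 0 l ^+ 2 / Z l l - (a 0 l)%:C * (b 0 l)%:C) * kappa (Z l l) * theta a b Z W.
Proof.
move=> HZ; have uz := siegel_diag_upper l HZ; have z0 := upper_neq0 uz.
have Zs : Z^T = Z by case: HZ.
have HZ' : siegelH (act (partial_inv l) Z).
  by apply: act_siegelH => //; exact: in_Sp_partial_inv.
set c := eC _.
have s1 := summ_tterm (swap_a a b) (swap_b a b) (W *m invmx (jfac (partial_inv l) Z)) HZ'.
have s2 := summ_tterm a b W HZ.
rewrite /theta; apply: (csum_fibre s1 s2) => n n0.
pose P : 'rV[C]_g := toC (rvec n (a - a 0 l *: delta_mx 0 l)).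
have Pl : P 0 l = 0.
  by rewrite /P !mxE !eqxx n0 mulr1 subrr addr0.
pose y := dot P (row l Z); pose v := y + W 0 l + (b 0 l)%:C.
pose A := 2^-1 * bil Z P P + (dot P W + dot P (toC b)).
have E1 k : tterm a b Z W (n + k *: delta_mx 0 l) =
   eC A * eC (2^-1 * Z l l * (k%:~R + (a 0 l)%:C) ^+ 2 + (k%:~R + (a 0 l)%:C) * v).
  rewrite /tterm -eCD; congr eC; rewrite /texp.
  have -> : toC (rvec (n + k *: delta_mx 0 l) a) = P + (k%:~R + (a 0 l)%:C) *: delta_mx 0 l.
    have := rvec_delta n k a 0; rewrite scale0r !subr0 => ->.
    by rewrite toC_delta rmorphD /= -int_realC.
  have [hb hd] := texp_fibre P (k%:~R + (a 0 l)%:C) Zs.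
  rewrite hb dotDr !hd [toC b 0 l]mxE /A /v -/y.
  move: (bil _ _ _) (dot P W) (dot P _) => *.
  by field.
pose G (k : int) : C := gau (- (Z l l)^-1) (v - k%:~R) * eC (k%:~R * (a 0 l)%:C).
have E2 k : tterm (swap_a a b) (swap_b a b) (act (partial_inv l) Z)
    (W *m invmx (jfac (partial_inv l) Z)) (n + k *: delta_mx 0 l) = eC A * c * G k.
  rewrite /tterm /G /gau /c -!eCD; congr eC; rewrite /texp.
  set s : C := k%:~R - (b 0 l)%:C.
  have -> : toC (rvec (n + k *: delta_mx 0 l) (swap_a a b)) = P + s *: delta_mx 0 l.
    rewrite /swap_a rvec_delta toC_delta opprD addrA addrK rmorphB /=.
    by rewrite -int_realC.
  have [hb hd] := texp_fibre P s Zs.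
  have hz : dot (P + s *: delta_mx 0 l) (row l Z) = y + s * Z l l.
    by rewrite hd mxE.
  have hl : (P + s *: delta_mx 0 l) 0 l = s by rewrite mxE Pl !mxE !eqxx mulr1 add0r.
  have hsb : dot (P + s *: delta_mx 0 l) (toC (swap_b a b)) = dot P (toC b) + s * (a 0 l)%:C.
    have hbl : toC (swap_b a b) 0 l = (a 0 l)%:C.
      by rewrite !mxE !eqxx mulr1 addrC subrK.
    rewrite hd hbl; congr (_ + _).
    by rewrite /swap_b toC_delta dotDr dotZr dot_delta Pl mulr0 addr0.
  rewrite bil_pinv// W_pinv// hl hz hb dotDr hsb dotDr dotNr dotZr dotDr dotNr hz dot_delta hl hd.
  by apply: (inversion_exponent _ y).
apply: (etrans (eq_csum E2)); apply: etrans (congr1 _ (esym (eq_csum E1))).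
have A0 : eC A * c != 0 by rewrite mulf_neq0 ?eC_neq0.
have S1 := eq_summ E2 (summ_fibre_row s1 n0).
have S2 := eq_summ E1 (summ_fibre_row s2 n0).
have [SG ->] := csumZ_neq0 A0 S1; have [SH ->] := csumZ_neq0 (eC_neq0 A) S2.
(* The sign of the summation index is reversed to match [theta1_inversion]. *)
have -> : csum G = csum (fun r : int => gau (- (Z l l)^-1) (v + r%:~R) * eC (- (r%:~R * (a 0 l)%:C))).
  rewrite -(@csum_bij _ _ _ (fun r : int => - r) (fun r => - r) G opprK opprK SG).
  by congr (csum _); apply: funext => r; rewrite /G /= rmorphN opprK mulNr.
have alg (x1 x2 x3 x4 : C) : x1 * x2 * (x3 * x4) = x2 * x3 * (x1 * x4) by ring.
rewrite theta1_inversion//; exact: alg.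
Qed.

End ThetaInversion.

(** * An Sp(2g, Z)-invariant sum of theta powers *)

Section ResidueSum.
Variables (g N : nat) (V : zmodType).
Hypothesis N0 : (0 < N)%N.
Implicit Types (x y : 'rV[int]_g) (r : 'rV['I_N]_g).

Definition cong x y := forall i, x 0 i - y 0 i \in dvdz N%:Z.

Lemma res_subproof (k : int) : (absz (k %% N%:Z)%Z < N)%N.
Proof.
have N1 : N%:Z != 0 by rewrite eqz_nat -lt0n.
by have := ltz_pmod k (d := N%:Z); rewrite ltz_nat => /(_ N0); have := modz_ge0 k N1; lia.
Qed.

Definition red x : 'rV['I_N]_g := \row_i Ordinal (res_subproof (x 0 i)).
Definition lift r : 'rV[int]_g := \row_i (r 0 i : nat)%:Z.

Lemma cong_lift_red x : cong (lift (red x)) x.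
Proof.
move=> i; rewrite !mxE /=; have N1 : N%:Z != 0 by rewrite eqz_nat -lt0n.
rewrite gez0_abs ?modz_ge0// {2}(divz_eq (x 0 i) N%:Z) opprD addrA addrAC subrr sub0r.
by rewrite -mulNr dvdz_mull.
Qed.

Lemma cong_sym x y : cong x y -> cong y x.
Proof. by move=> h i; rewrite -opprB rpredN. Qed.

Lemma cong_trans x y z : cong x y -> cong y z -> cong x z.
Proof. by move=> h h' i; rewrite -(subrKA (y 0 i)) rpredD. Qed.

Lemma cong_lift r r' : cong (lift r) (lift r') -> r = r'.
Proof.
move=> h; apply/matrixP => i j; rewrite ord1; apply: val_inj => /=.
have := h j; rewrite !mxE => hd.
have := ltn_ord (r 0 j); have := ltn_ord (r' 0 j).
move: hd; rewrite dvdzE /=; move: (nat_of_ord (r 0 j)) (nat_of_ord (r' 0 j)) => p q hd p1 q1.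
apply/eqP; have : (absz (p%:Z - q%:Z) < N)%N by lia.
case: (posnP (absz (p%:Z - q%:Z))) => [|z]; first by lia.
by have := dvdn_leq z hd; lia.
Qed.

Definition resum (F : 'rV[int]_g -> 'rV[int]_g -> V) : V :=
  \sum_(p : 'rV['I_N]_g * 'rV['I_N]_g) F (lift p.1) (lift p.2).

(** Injectivity of [rho] modulo N makes it a permutation of the finite set of residue pairs, and [F]
    does not see the choice of representatives. *)
Lemma resum_reindex (F : 'rV[int]_g -> 'rV[int]_g -> V)
    (rho : 'rV[int]_g -> 'rV[int]_g -> 'rV[int]_g * 'rV[int]_g) :
  (forall x x' y y', cong x x' -> cong y y' -> F x y = F x' y') ->
  (forall x y x' y', cong (rho x y).1 (rho x' y').1 -> cong (rho x y).2 (rho x' y').2 ->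
     cong x x' /\ cong y y') ->
  resum (fun x y => F (rho x y).1 (rho x y).2) = resum F.
Proof.
move=> hF hr.
pose s (p : 'rV['I_N]_g * 'rV['I_N]_g) :=
  (red (rho (lift p.1) (lift p.2)).1, red (rho (lift p.1) (lift p.2)).2).
have inj : injective s.
  move=> [p q] [p' q'] [h1 h2].
  have c1 : cong (rho (lift p) (lift q)).1 (rho (lift p') (lift q')).1.
    apply: cong_trans (cong_lift_red _); rewrite -h1; exact: cong_sym (cong_lift_red _).
  have c2 : cong (rho (lift p) (lift q)).2 (rho (lift p') (lift q')).2.
    apply: cong_trans (cong_lift_red _); rewrite -h2; exact: cong_sym (cong_lift_red _).
  by have [/cong_lift -> /cong_lift ->] := hr _ _ _ _ c1 c2.
rewrite /resum [RHS](reindex_inj inj) /=; apply: eq_bigr => p _.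
by apply: hF; apply: cong_sym; apply: cong_lift_red.
Qed.

End ResidueSum.

Section Witness.
Variables (R : realType) (g N m : nat).
Local Notation C := (Num.NumField.sort (R[i])).
Local Notation toC := (map_mx (real_complex R)).
Local Notation cmx := (map_mx (@intC R)).
Implicit Types (Z : 'M[C]_g) (W : 'rV[C]_g) (al be nu mu : 'rV[int]_g).
Hypotheses (N0 : (0 < N)%N) (Neven : (2 %| N)%N).

Definition chr al : 'rV[R]_g := N%:R^-1 *: map_mx intr al.
(* The power 8 N^2 m makes every root of unity in the transformation formulas of
   theta[al/N, be/N] disappear, so that F(al, be) = theta_pow al be depends on al, be
   mod N only, and Sp(2g, Z) permutes the F(al, be). *)
Definition wexp : nat := locked (8 * N ^ 2 * m)%N.
(** Half of [wexp], since theta functions with characteristics have weight and index 1/2. *)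
Definition wwt : nat := locked (4 * N ^ 2 * m)%N.

Lemma wexpE (K : comNzRingType) : wexp%:R = 8 * N%:R ^+ 2 * m%:R :> K.
Proof. by rewrite /wexp -lock !natrM expr2. Qed.

Lemma wwtE (K : comNzRingType) : wwt%:R = 4 * N%:R ^+ 2 * m%:R :> K.
Proof. by rewrite /wwt -lock !natrM expr2. Qed.

Definition theta_pow al be Z W : C := theta (chr al) (chr be) Z W ^+ wexp.
Definition theta_sum Z W : C := @resum g N _ (fun al be => theta_pow al be Z W).

Let NR : N%:R != 0 :> R. Proof. by rewrite pnatr_eq0 -lt0n. Qed.
Let NC : N%:R != 0 :> C. Proof. by rewrite pnatr_eq0 -lt0n. Qed.

Lemma toC_chr al : toC (chr al) = N%:R^-1 *: cmx al.
Proof.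
apply/matrixP => i j; rewrite !mxE rmorphM fmorphV rmorph_nat /=.
by rewrite /intC int_realC.
Qed.

Lemma chr_cong al al' : cong N al al' -> exists nu, chr al = rvec nu (chr al').
Proof.
move=> h; exists (\row_i divz (al 0 i - al' 0 i) N%:Z); apply/matrixP => i j.
rewrite ord1 !mxE; have := divzK (h j).
move: ((_ - _) %/ _)%Z => q hq; have -> : al 0 j = q * N%:Z + al' 0 j by rewrite hq subrK.
rewrite rmorphD rmorphM /= mulrDr; congr (_ + _).
by rewrite mulrC mulfK.
Qed.

Lemma eC_wexp (z : C) (n : int) : wexp%:R * z = n%:~R -> eC z ^+ wexp = 1.
Proof. by move=> h; rewrite eCX h eC_int. Qed.

Lemma theta_pow_cong al al' be be' Z W : siegelH Z -> cong N al al' -> cong N be be' ->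
  theta_pow al be Z W = theta_pow al' be' Z W.
Proof.
move=> HZ /chr_cong [nu h1] /chr_cong [mu h2]; rewrite /theta_pow h1 h2.
rewrite (theta_shift_a _ _ _ _ HZ) (theta_shift_b _ _ _ _ HZ) exprMn.
rewrite (@eC_wexp _ ((8 * N * m)%N%:Z * dot al' mu)) ?mul1r//.
rewrite wexpE toC_chr dotZl dot_cmx rmorphM /= -pmulrn.
by rewrite mulrA; congr (_ * _); rewrite !natrM; field.
Qed.

Lemma wexp_half : wexp%:R * 2^-1 = wwt%:R :> C.
Proof. by rewrite wexpE wwtE; field. Qed.

Lemma theta_pow_transl (S : 'M[int]_g) al be Z W : S^T = S -> siegelH Z ->
  theta_pow al be (Z + cmx S) W =
  theta_pow al (be + al *m S + (N %/ 2)%N%:Z *: diag_row S) Z W.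
Proof.
move=> Ss HZ; rewrite /theta_pow theta_transl// exprMn eCN exprVn.
rewrite (@eC_wexp _ ((4 * m)%N%:Z * (bil S al al + N%:Z * dot al (diag_row S)))); last first.
  rewrite toC_chr bilZl bilZr dotZl bil_cmx dot_cmx.
  rewrite [RHS]rmorphM /= [(_ + _ * _)%:~R]rmorphD /= [(Posz N * _)%:~R]rmorphM /=.
  have P n : (Posz n)%:~R = n%:R :> C by [].
  rewrite !P [wexp%:R * (2^-1 * _)]mulrA wexp_half wwtE.
  move: ((bil _ _ _)%:~R : C) ((dot _ _)%:~R : C) => p q.
  by rewrite !natrM; field.
(* Evenness of [N] makes the shift by half the diagonal an integral shift of [be]. *)
have e2 : (N %/ 2)%N%:R = N%:R / 2 :> R.
  by rewrite -[in RHS](divnK Neven) natrM mulfK.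
have -> : chr be + chr al *m map_mx intr S + 2^-1 *: map_mx intr (diag_row S) =
    chr (be + al *m S + (N %/ 2)%N%:Z *: diag_row S).
  apply/matrixP => i j; rewrite !mxE !rmorphD rmorphM /= rmorph_sum /= -pmulrn e2 !mulrDr.
  congr (_ + _ + _); last by field.
  rewrite mulr_sumr; apply: eq_bigr => k _; rewrite !mxE rmorphM mulrA.
  by [].
by rewrite invr1 mul1r.
Qed.

Lemma theta_sum_transl (S : 'M[int]_g) Z W : S^T = S -> siegelH Z ->
  theta_sum (Z + cmx S) W = theta_sum Z W.
Proof.
move=> Ss HZ; pose rho (al be : 'rV[int]_g) := (al, be + al *m S + (N %/ 2)%N%:Z *: diag_row S).
have := @resum_reindex g N C N0 (fun al be => theta_pow al be Z W) rho.
move=> E; apply: etrans _ (E _ _).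
- by apply: eq_bigr => p _; rewrite theta_pow_transl.
- by move=> x x' y y' h h'; apply: theta_pow_cong.
move=> x y x' y' h h'; split; [exact: h|move=> i].
have hs : (x *m S) 0 i - (x' *m S) 0 i \in dvdz N%:Z.
  rewrite !mxE -sumrB; apply: rpred_sum => k _; rewrite -mulrBl.
  exact: dvdz_mulr (h k).
have -> : y 0 i - y' 0 i =
    (rho x y).2 0 i - (rho x' y').2 0 i - ((x *m S) 0 i - (x' *m S) 0 i).
  have e (u v : 'rV[int]_g) : (rho u v).2 0 i =
      v 0 i + (u *m S) 0 i + ((N %/ 2)%N%:Z *: diag_row S) 0 i.
    by rewrite /rho [LHS]mxE [X in X + _]mxE.
  have alg (p q r s t : int) : p - q = p + r + t - (q + s + t) - (r - s) by ring.
  by rewrite !e; exact: alg.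
exact: rpredB (h' i) hs.
Qed.

Lemma chr_swap l al be :
  swap_a l (chr al) (chr be) = chr (al - (al 0 l + be 0 l) *: delta_mx 0 l) /\
  swap_b l (chr al) (chr be) = chr (be + (al 0 l - be 0 l) *: delta_mx 0 l).
Proof.
have d (i : 'I_1) (j : 'I_g) : ((i == 0) && (j == l))%:R%:~R = ((i == 0) && (j == l))%:R :> R.
  by case: (_ && _).
split; apply/matrixP => i j; rewrite !mxE rmorphD ?rmorphN rmorphM /= d.
  by rewrite rmorphD /=; ring.
by rewrite rmorphB /=; ring.
Qed.

Lemma theta_pow_partial_inv l al be Z W : siegelH Z ->
  theta_pow (al - (al 0 l + be 0 l) *: delta_mx 0 l) (be + (al 0 l - be 0 l) *: delta_mx 0 l)
    (act (partial_inv l) Z) (W *m invmx (jfac (partial_inv l) Z)) =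
  eC (wwt%:R * (W 0 l ^+ 2 / Z l l)) * Z l l ^+ wwt * theta_pow al be Z W.
Proof.
move=> HZ; have [ha hb] := chr_swap l al be; rewrite /theta_pow -ha -hb theta_partial_inv//.
rewrite [LHS]exprMn; congr (_ * _); rewrite [LHS]exprMn; congr (_ * _).
  rewrite eCB expr_div_n (@eC_wexp ((chr al 0 l)%:C * (chr be 0 l)%:C) ((8 * m)%N%:Z * (al 0 l * be 0 l))).
    have e (x y z : C) : x * (2^-1 * y / z) = x / 2 * (y / z) by rewrite !mulrA.
    by rewrite divr1 eCX e wexp_half.
  have P n : (Posz n)%:~R = n%:R :> C by [].
  rewrite wexpE [RHS]rmorphM /= [(al 0 l * _)%:~R]rmorphM /= P !mxE natrM.
  by rewrite !rmorphM /= fmorphV rmorph_nat -!int_realC; field.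
(* The exponent is even, so only kappa^2 = -i Z_ll enters; its half is divisible by 4, so the powers
   of -i disappear. *)
have -> : wexp = (2 * wwt)%N by rewrite /wexp /wwt -!lock !mulnA.
rewrite exprM kappa_sq ?siegel_diag_upper// exprMn.
have -> : wwt = (4 * (N ^ 2 * m))%N by rewrite /wwt -lock !mulnA.
have i4 : (- 'i%C : C) ^+ 4 = 1.
  by rewrite exprNn -signr_odd /= mul1r (exprM _ 2 2) complexiE sqrCi -signr_odd.
by rewrite [(- _) ^+ _]exprM i4 expr1n mul1r.
Qed.

Lemma theta_sum_partial_inv l Z W : siegelH Z ->
  slash wwt wwt (partial_inv l) theta_sum Z W = theta_sum Z W.
Proof.
move=> HZ; have uz := siegel_diag_upper l HZ; have z0 := upper_neq0 uz.
rewrite slashE jfac_pinv_det jker_pinv//.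
set Z' := act _ _; set W' := _ *m _.
(* In the l-th coordinate (al, be) becomes (- be, al), a permutation of residues. *)
pose rho (al be : 'rV[int]_g) :=
  (al - (al 0 l + be 0 l) *: delta_mx 0 l, be + (al 0 l - be 0 l) *: delta_mx 0 l).
have HZ' : siegelH Z' by apply: act_siegelH => //; exact: in_Sp_partial_inv.
have -> : theta_sum Z' W' = eC (wwt%:R * (W 0 l ^+ 2 / Z l l)) * Z l l ^+ wwt * theta_sum Z W.
  have E := @resum_reindex g N C N0 (fun al be => theta_pow al be Z' W') rho.
  apply: etrans (esym (E _ _)) _.
  - by move=> x x' y y' h h'; apply: theta_pow_cong.
  - move=> x y x' y' h h'.
    have hl := h l; have hl' := h' l.
    have e1 (u v : 'rV[int]_g) : (rho u v).1 0 l = - v 0 l.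
      by rewrite /rho /= !mxE !eqxx mulr1; ring.
    have e2 (u v : 'rV[int]_g) : (rho u v).2 0 l = u 0 l.
      by rewrite /rho /= !mxE !eqxx mulr1; ring.
    rewrite !e1 in hl; rewrite !e2 in hl'.
    have e3 (u v : 'rV[int]_g) i : i != l -> (rho u v).1 0 i = u 0 i.
      by move=> il; rewrite /rho /= !mxE (negPf il) andbF mulr0 subr0.
    have e4 (u v : 'rV[int]_g) i : i != l -> (rho u v).2 0 i = v 0 i.
      by move=> il; rewrite /rho /= !mxE (negPf il) andbF mulr0 addr0.
    split=> i; have [->|il] := eqVneq i l.
    + exact: hl'.
    + by have := h i; rewrite !e3.
    + by rewrite -rpredN; move: hl; rewrite opprB opprK addrC.
    + by have := h' i; rewrite !e4.
  rewrite /theta_sum /resum mulr_sumr; apply: eq_bigr => p _.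
  exact: theta_pow_partial_inv.
rewrite eCN; have alg (x z t : C) : x != 0 -> z != 0 -> z^-1 * x^-1 * (x * z * t) = t.
  by move=> x0 zn; field; rewrite x0.
by apply: alg; rewrite ?eC_neq0 ?expf_neq0.
Qed.

Lemma theta_sum_Sp M Z W : in_Sp M -> siegelH Z ->
  slash wwt wwt M theta_sum Z W = theta_sum Z W.
Proof.
move=> spM HZ; apply: slash_Sp => //.
  by move=> S Z1 W1 Ss H1; rewrite slash_transl theta_sum_transl.
by move=> l Z1 W1 H1; exact: theta_sum_partial_inv.
Qed.

Lemma theta_sum_heis nu mu (x : int) Z W : siegelH Z ->
  heis wwt nu mu x theta_sum Z W = theta_sum Z W.
Proof.
move=> HZ; rewrite /heis /theta_sum /resum mulr_sumr; apply: eq_bigr => p _.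
set al := lift _; set be := lift _; rewrite /theta_pow theta_heis// exprMn.
set t := theta _ _ _ _ ^+ _; rewrite mulrA -[RHS]mul1r; congr (_ * _).
rewrite eCX -eCD.
(* The terms in W and nu Z nu^T cancel; the characteristics enter with denominator N, which [wexp]
   clears. *)
rewrite (@eC_eqint _ _ 0 (wwt%:Z * (x + dot mu nu) + (8 * N * m)%N%:Z * (dot al mu - dot nu be))).
  exact: eC0.
have P n : (Posz n)%:~R = n%:R :> C by [].
rewrite subr0 [RHS]rmorphD /= ![(_ * _)%:~R]rmorphM /= rmorphD rmorphB /= !P -!dot_cmx.
rewrite !toC_chr dotZl dotZr wexpE wwtE !natrM -/(bil Z (cmx nu) (cmx nu)) -/(dot (cmx nu) W).
rewrite -/(dot (cmx mu) (cmx nu)) /intC.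
move: (bil _ _ _) (dot (cmx nu) W) (dot (cmx mu) _) (dot (cmx al) _) (dot (cmx nu) _) (x%:~R : C) => *.
by field.
Qed.

End Witness.

(** * Holomorphy *)

Section Holomorphy.
Variables (R : realType) (g : nat).
Local Notation C := (Num.NumField.sort (R[i])).
Implicit Types (phi psi : fn R g) (Z dZ : 'M[C]_g) (W dW : 'rV[C]_g).

Definition cont_at phi Z W := forall e : R, 0 < e -> exists2 d : R, 0 < d &
  forall dZ dW, (forall i j, nrm (dZ i j) <= d) -> (forall j, nrm (dW 0 j) <= d) ->
    nrm (phi (Z + dZ) (W + dW) - phi Z W) <= e.

(** A form of holomorphy that passes easily to sums, products and the substitution of s W for W: one
    continuity estimate in all entries, and derivatives along every complex line in (Z, W), with dZ
    symmetric or not. *)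
Definition hol phi := forall Z W, siegelH Z -> cont_at phi Z W /\
  forall dZ dW, derivable (fun t : C => phi (Z + t *: dZ) (W + t *: dW)) 0 1.

Lemma eq_derivable (f h : C -> C) : (forall t, f t = h t) -> derivable f 0 1 -> derivable h 0 1.
Proof. by move=> /funext ->. Qed.

Lemma hol_const c : hol (fun _ _ => c).
Proof.
move=> Z W _; split; last by move=> dZ dW; exact: derivable_cst.
by move=> e e0; exists 1 => // *; rewrite subrr nrm0 ltW.
Qed.

Lemma hol_add phi psi : hol phi -> hol psi -> hol (fun Z W => phi Z W + psi Z W).
Proof.
move=> h1 h2 Z W HZ; have [c1 d1] := h1 Z W HZ; have [c2 d2] := h2 Z W HZ; split; last first.
  by move=> dZ dW; apply: derivableD.
move=> e e0; have e2 : 0 < e / 2 by rewrite divr_gt0.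
have [d d0 hd] := c1 _ e2; have [d' d'0 hd'] := c2 _ e2.
exists (Num.min d d'); first by rewrite lt_min d0.
move=> dZ dW hZ hW; rewrite opprD addrACA; apply: (le_trans (nrmD _ _)).
rewrite [leRHS]splitr lerD//.
  by apply: hd => *; [apply: le_trans (hZ _ _) _|apply: le_trans (hW _) _]; rewrite ge_min lexx.
by apply: hd' => *; [apply: le_trans (hZ _ _) _|apply: le_trans (hW _) _]; rewrite ge_min lexx orbT.
Qed.

Lemma product_bound (e e' p q x1 x2 x3 : R) : 0 < e' -> 0 <= p -> 0 <= q ->
  e' * (2 * (1 + p + q)) <= e -> x1 <= e' * 1 -> x2 <= e' * q -> x3 <= e' * p ->
  x1 + x2 + x3 <= e.
Proof.
move=> e0 p0 q0; have -> : e' * (2 * (1 + p + q)) = 2 * (e' * 1) + 2 * (e' * p) + 2 * (e' * q).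
  by ring.
have := mulr_ge0 (ltW e0) p0; have := mulr_ge0 (ltW e0) q0; rewrite mulr1.
by move: (e' * p) (e' * q) => *; lra.
Qed.

Lemma hol_mul phi psi : hol phi -> hol psi -> hol (fun Z W => phi Z W * psi Z W).
Proof.
move=> h1 h2 Z W HZ; have [c1 d1] := h1 Z W HZ; have [c2 d2] := h2 Z W HZ; split; last first.
  by move=> dZ dW; apply: derivableM.
move=> e e0; set p := phi Z W; set q := psi Z W.
pose M := 1 + nrm p + nrm q.
have M0 : 0 < M by rewrite /M -addrA ltr_pwDl// addr_ge0 ?nrm_ge0.
pose e' := Num.min 1 (e / (2 * M)).
have e'0 : 0 < e' by rewrite lt_min ltr01 divr_gt0// mulr_gt0.
have [d d0 hd] := c1 _ e'0; have [d' d'0 hd'] := c2 _ e'0.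
exists (Num.min d d'); first by rewrite lt_min d0.
move=> dZ dW hZ hW.
have a1 : nrm (phi (Z + dZ) (W + dW) - p) <= e'.
  by apply: hd => *; [apply: le_trans (hZ _ _) _|apply: le_trans (hW _) _]; rewrite ge_min lexx.
have a2 : nrm (psi (Z + dZ) (W + dW) - q) <= e'.
  by apply: hd' => *; [apply: le_trans (hZ _ _) _|apply: le_trans (hW _) _]; rewrite ge_min lexx orbT.
move: a1 a2; move: (phi (Z + dZ) _) (psi (Z + dZ) _) => x y a1 a2.
have -> : x * y - p * q = (x - p) * (y - q) + (x - p) * q + p * (y - q) by ring.
have e1 : e' <= 1 by rewrite ge_min lexx.
have eM : e' * (2 * M) <= e by rewrite -ler_pdivlMr ?mulr_gt0// ge_min lexx orbT.
apply: (le_trans (nrmD _ _)); rewrite nrmM.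
apply: (le_trans (lerD (nrmD _ _) (lexx _))); rewrite !nrmM.
have b1 : nrm (x - p) * nrm (y - q) <= e' * 1.
  by apply: ler_pM => //; [exact: nrm_ge0|exact: nrm_ge0|exact: le_trans a2 e1].
have b2 : nrm (x - p) * nrm q <= e' * nrm q by rewrite ler_wpM2r ?nrm_ge0.
have b3 : nrm p * nrm (y - q) <= e' * nrm p by rewrite mulrC ler_wpM2r ?nrm_ge0.
exact: product_bound e'0 (nrm_ge0 _) (nrm_ge0 _) eM b1 b2 b3.
Qed.

Lemma hol_sum (I : Type) (r : seq I) (F : I -> fn R g) : (forall i, hol (F i)) ->
  hol (fun Z W => \sum_(i <- r) F i Z W).
Proof.
move=> h; elim: r => [|i r IH].
  have -> : (fun Z W => \sum_(i <- [::]) F i Z W) = (fun _ _ => 0).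
    by apply: funext => Z; apply: funext => W; rewrite big_nil.
  exact: hol_const.
have -> : (fun Z W => \sum_(j <- i :: r) F j Z W) = (fun Z W => F i Z W + \sum_(j <- r) F j Z W).
  by apply: funext => Z; apply: funext => W; rewrite big_cons.
exact: hol_add (h i) IH.
Qed.

Lemma hol_pow phi n : hol phi -> hol (fun Z W => phi Z W ^+ n).
Proof.
move=> h; elim: n => [|n IH].
  have -> : (fun Z W => phi Z W ^+ 0) = (fun _ _ => 1) by [].
  exact: hol_const.
have -> : (fun Z W => phi Z W ^+ n.+1) = (fun Z W => phi Z W * phi Z W ^+ n).
  by apply: funext => Z; apply: funext => W; rewrite exprS.
exact: hol_mul h IH.
Qed.

Lemma hol_scale phi (s : nat) : hol phi -> hol (fun Z W => phi Z (s%:R *: W)).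
Proof.
move=> h Z W HZ; have [c1 d1] := h Z (s%:R *: W) HZ; split; last first.
  move=> dZ dW; apply: eq_derivable (d1 dZ (s%:R *: dW)) => t.
  by rewrite scalerDr !scalerA [t * _]mulrC.
move=> e e0; have [d d0 hd] := c1 e e0.
exists (d / s.+1%:R); first by rewrite divr_gt0.
move=> dZ dW hZ hW; rewrite scalerDr; apply: hd => [i j|j].
  apply: le_trans (hZ i j) _; rewrite ler_pdivrMr// ler_peMr ?(ltW d0)//.
  by rewrite ler1n.
rewrite mxE nrmM nrm_nat; apply: le_trans (ler_wpM2l _ (hW j)) _ => //.
rewrite mulrCA ler_piMr ?(ltW d0)// ler_pdivrMr// mul1r ler_nat.
exact: leqnSn.
Qed.

Lemma hol_theta a b : hol (theta a b : fn R g).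
Proof.
move=> Z W HZ; split; last first.
  by move=> dZ dW; have [D []] := theta_derive a b W dZ dW HZ.
have [K K0 [d d0 hd]] := theta_lip a b W HZ; move=> e e0.
exists (Num.min d (e / K)); first by rewrite lt_min d0 divr_gt0.
move=> dZ dW hZ hW; apply: (le_trans (hd dZ dW _ _ _ hZ hW)).
- by rewrite le_min ltW// ltW// divr_gt0.
- by rewrite ge_min lexx.
by rewrite mulrC -ler_pdivlMr// ge_min lexx orbT.
Qed.

Lemma hol_holo phi : hol phi -> holo phi.
Proof.
move=> h; split; last first.
  move=> Z W HZ; have [_ d] := h Z W HZ; split=> [i j|j].
    apply: eq_derivable (d (delta_mx i j + delta_mx j i) 0) => t.
    by rewrite scaler0 addr0.
  apply: eq_derivable (d 0 (delta_mx 0 j)) => t.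
  by rewrite scaler0 addr0.
apply: continuous_in_subspaceT => -[Z W]; rewrite inE /= => HZ.
have [c _] := h Z W HZ.
apply/cvgrPdist_le => /= eps /complex_pos [e [e0 ->]].
have [d d0 hd] := c e e0.
have dC : 0 < d%:C :> C by rewrite ltcR.
exists (ball (Z : 'M[C]_g) d%:C, ball (W : 'rV[C]_g) d%:C).
  split; rewrite /=.
    exact: (@nbhsx_ballx _ 'M[C]_g Z _ dC).
  exact: (@nbhsx_ballx _ 'rV[C]_g W _ dC).
move=> [Z' W'] [/= hZ hW].
rewrite nrmE lecR nrm_distC.
have -> : Z' = Z + (Z' - Z) by rewrite addrC subrK.
have -> : W' = W + (W' - W) by rewrite addrC subrK.
apply: hd => [i j|j].
  have := hZ.2 i j; rewrite /ball /= !mxE nrmE ltcR nrm_distC => /ltW; by rewrite nrm_distC.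
have := hW.2 0 j; rewrite /ball /= !mxE nrmE ltcR => /ltW; by rewrite nrm_distC.
Qed.

End Holomorphy.

(** * Weight and index under products and scaling of W *)

Section Invariance.
Variables (R : realType) (g : nat).
Local Notation C := (Num.NumField.sort (R[i])).
Local Notation cmx := (map_mx (@intC R)).
Implicit Types (phi psi : fn R g) (Z : 'M[C]_g) (W : 'rV[C]_g).

Definition slash_inv k m phi := forall M Z W, in_Sp M -> siegelH Z ->
  slash k m M phi Z W = phi Z W.

Definition heis_inv m phi := forall lam mu x Z W, siegelH Z ->
  heis m lam mu x phi Z W = phi Z W.

Lemma slash_inv_mul k1 m1 k2 m2 phi psi : slash_inv k1 m1 phi -> slash_inv k2 m2 psi ->
  slash_inv (k1 + k2) (m1 + m2) (fun Z W => phi Z W * psi Z W).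
Proof.
move=> h1 h2 M Z W spM HZ; rewrite -(h1 M Z W spM HZ) -(h2 M Z W spM HZ) !slashE.
rewrite exprD invfM natrD mulrDl opprD eCD.
have alg (a b c d e f : C) : a * b * (c * d) * (e * f) = a * c * e * (b * d * f) by ring.
exact: alg.
Qed.

Lemma heis_inv_mul m1 m2 phi psi : heis_inv m1 phi -> heis_inv m2 psi ->
  heis_inv (m1 + m2) (fun Z W => phi Z W * psi Z W).
Proof.
move=> h1 h2 lam mu x Z W HZ; rewrite -(h1 lam mu x Z W HZ) -(h2 lam mu x Z W HZ) /heis.
by rewrite natrD mulrDl eCD mulrACA.
Qed.

Lemma slash_inv_pow k m phi n : slash_inv k m phi ->
  slash_inv (n * k) (n * m) (fun Z W => phi Z W ^+ n).
Proof.
move=> h; elim: n => [|n IH].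
  move=> M Z W _ _; rewrite slashE !mul0n expr0 invr1 mul0r oppr0 eC0 !mulr1 expr0.
  by [].
have := slash_inv_mul h IH; rewrite -!mulSn; congr slash_inv.
by apply: funext => Z; apply: funext => W; rewrite exprS.
Qed.

Lemma heis_inv_pow m phi n : heis_inv m phi -> heis_inv (n * m) (fun Z W => phi Z W ^+ n).
Proof.
move=> h; elim: n => [|n IH].
  by move=> lam mu x Z W _; rewrite /heis !mul0n mul0r eC0 mul1r expr0.
have := heis_inv_mul h IH; rewrite -!mulSn; congr heis_inv.
by apply: funext => Z; apply: funext => W; rewrite exprS.
Qed.

(** The exponent is quadratic in W, so scaling changes the index and not the weight; s = 0 gives
    index 0, the case of A(Z, 0). *)
Lemma slash_inv_scale k m phi s : slash_inv k m phi ->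
  slash_inv k (s ^ 2 * m) (fun Z W => phi Z (s%:R *: W)).
Proof.
move=> h M Z W spM HZ; rewrite -(h M Z (s%:R *: W) spM HZ) !slashE bilZl bilZr -scalemxAl.
congr (_ * eC _ * _); rewrite natrM natrX; congr (- _).
by move: (bil _ _ _) => x; ring.
Qed.

Lemma heisE m lam mu x phi Z W : heis m lam mu x phi Z W =
  eC (m%:R * (bil Z (cmx lam) (cmx lam) + 2 * dot (cmx lam) W + intC R x +
              dot (cmx mu) (cmx lam))) * phi Z (W + cmx lam *m Z + cmx mu).
Proof. by []. Qed.

(** The element ((lam, mu), x) acts on the scaled function as ((s lam, s mu), s^2 x) does on
    [phi]. *)
Lemma heis_inv_scale m phi s : heis_inv m phi ->
  heis_inv (s ^ 2 * m) (fun Z W => phi Z (s%:R *: W)).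
Proof.
move=> h lam mu x Z W HZ.
rewrite -(h (s%:Z *: lam) (s%:Z *: mu) (s%:Z ^+ 2 * x) Z (s%:R *: W) HZ) !heisE.
have E (v : 'rV[int]_g) : cmx (s%:Z *: v) = s%:R *: cmx v.
  by apply/matrixP => i j; rewrite !mxE /intC rmorphM.
have EW : s%:R *: (W + cmx lam *m Z + cmx mu) =
    s%:R *: W + cmx (s%:Z *: lam) *m Z + cmx (s%:Z *: mu) by rewrite !E -scalemxAl !scalerDr.
have nE : (s ^ 2 * m)%:R = s%:R ^+ 2 * m%:R :> C by rewrite natrM natrX.
have xE : intC R (s%:Z ^+ 2 * x) = s%:R ^+ 2 * intC R x :> C.
  by rewrite /intC rmorphM rmorphXn.
have alg (c1 c2 b1 d1 d2 y : C) : c1 ^+ 2 * c2 * (b1 + 2 * d1 + y + d2) =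
    c2 * (c1 * (c1 * b1) + 2 * (c1 * (c1 * d1)) + c1 ^+ 2 * y + c1 * (c1 * d2)) by ring.
have H : (s ^ 2 * m)%:R * (bil Z (cmx lam) (cmx lam) + 2 * dot (cmx lam) W + intC R x +
      dot (cmx mu) (cmx lam)) =
    m%:R * (bil Z (cmx (s%:Z *: lam)) (cmx (s%:Z *: lam)) +
      2 * dot (cmx (s%:Z *: lam)) (s%:R *: W) + intC R (s%:Z ^+ 2 * x) +
      dot (cmx (s%:Z *: mu)) (cmx (s%:Z *: lam))).
  rewrite (E lam) (E mu) xE nE bilZl bilZr dotZl dotZr dotZl dotZr.
  exact: alg.
by rewrite EW H.
Qed.

End Invariance.

(** * Fourier expansions *)

Section FourierExpansion.
Variables (R : realType) (g : nat).
Local Notation C := (Num.NumField.sort (R[i])).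
Local Notation toC := (map_mx (real_complex R)).
Implicit Types (psi : fn R g) (Z : 'M[C]_g) (W : 'rV[C]_g) (N : 'M[int]_g).

Definition freq lam N (v : 'rV[R]_g) Z W : C :=
  eC (\tr (map_mx (fun z => intC R z / 2) N *m Z) / lam%:R) * eC (dot W (toC v)).

(* Positivity of the block matrix in fourier_block, for a real index mu (theta has index 1/2). *)
Definition index_pos lam (mu : R) N (v : 'rV[R]_g) :=
  forall (u : 'rV[R]_g) (s : R),
    0 <= bil (map_mx intr N) u u / (2 * lam%:R) + s * dot u v + mu * s ^+ 2.

(** An arbitrary index set and real frequencies accommodate fractional characteristics and products;
    equal frequencies are collected only at the end, by [fexp_push]. *)
Definition fexp_of (I : eqType) (c : I -> C) (Nf : I -> 'M[int]_g) (vf : I -> 'rV[R]_g)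
    lam mu psi :=
  (forall i, c i != 0 -> twice_halfint (Nf i) /\ index_pos lam mu (Nf i) (vf i)) /\
  forall Z W, siegelH Z -> has_sum (fun i => c i * freq lam (Nf i) (vf i) Z W) (psi Z W).

Lemma fourier_block_form lam m N (Rv : 'cV[int]_g) (u : 'rV[R]_g) (s : R) :
  (row_mx u s%:M *m fourier_block R lam m N Rv *m (row_mx u s%:M)^T) 0 0 =
  bil (map_mx intr N) u u / (2 * lam%:R) + s * dot u (map_mx intr Rv^T) + m%:R * s ^+ 2.
Proof.
have -> : fourier_block R lam m N Rv = block_mx ((2 * lam%:R)^-1 *: map_mx intr N)
    (2^-1 *: (map_mx intr Rv^T)^T) (2^-1 *: map_mx intr Rv^T) (m%:R)%:M.
  rewrite /fourier_block; congr block_mx; apply/matrixP => x y; rewrite !mxE /intR mulrC //.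
rewrite mul_row_block tr_row_mx mul_row_col tr_scalar_mx mul_mx_scalar.
have mD (X Y : 'M[R]_1) : (X + Y) 0 0 = X 0 0 + Y 0 0 by rewrite mxE.
set A := map_mx intr N; set r := map_mx intr Rv^T.
have p1 (c : R) : (u *m (c *: A) *m u^T) 0 0 = c * bil A u u.
  by rewrite -scalemxAr -scalemxAl mxE.
have p2 (c : R) : (s%:M *m (c *: r) *m u^T) 0 0 = s * (c * dot u r).
  by rewrite mul_scalar_mx -scalemxAl mxE -scalemxAl mxE dotC.
have p3 (c : R) : (s *: (u *m (c *: r^T))) 0 0 = s * (c * dot u r).
  by rewrite mxE -scalemxAr mxE.
have p4 : (s *: (s%:M *m (m%:R)%:M) : 'M[R]_1) 0 0 = s * (s * m%:R).
  by rewrite mxE -scalar_mxM mxE eqxx.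
rewrite mulmxDl scalerDr !mD p1 p2 p3 p4; move: (bil _ _ _) (dot _ _) => x y.
by rewrite invfM; move: (lam%:R^-1) => z; field.
Qed.

Lemma fourier_blockE lam m N (Rv : 'cV[int]_g) : (0 < lam)%N ->
  psd (fourier_block R lam m N Rv) <->
  N^T = N /\ index_pos lam m%:R N (map_mx intr Rv^T).
Proof.
move=> lam0; split=> [[Fs Fp]|[Ns q]].
  split=> [|u s]; last by rewrite -fourier_block_form; exact: Fp.
  apply/matrixP => i j.
  have := congr1 (fun Y : 'M[R]_(g + 1) => Y (lshift 1 j) (lshift 1 i)) Fs.
  rewrite mxE /fourier_block !block_mxEul !mxE /intR => /(mulIf _) h.
  by apply/eqP; rewrite -(eqr_int R); apply/eqP/esym/h; rewrite invr_eq0 mulf_neq0 ?pnatr_eq0 -?lt0n.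
split; last first.
  move=> x; rewrite -(hsubmxK x) [rsubmx x]mx11_scalar fourier_block_form.
  exact: q.
rewrite /fourier_block tr_block_mx; congr block_mx.
- by apply/matrixP => i j; rewrite !mxE -[in RHS]Ns mxE.
- by apply/matrixP => i j; rewrite !mxE.
- by apply/matrixP => i j; rewrite !mxE.
by rewrite tr_scalar_mx.
Qed.

Lemma freqD lam N N' v v' Z W : freq lam (N + N') (v + v') Z W = freq lam N v Z W * freq lam N' v' Z W.
Proof.
have e1 : \tr (map_mx (fun z => intC R z / 2) (N + N') *m Z) / lam%:R =
    \tr (map_mx (fun z => intC R z / 2) N *m Z) / lam%:R +
    \tr (map_mx (fun z => intC R z / 2) N' *m Z) / lam%:R.
  rewrite -mulrDl -mxtraceD -mulmxDl; congr (\tr (_ *m _) / _).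
  by apply/matrixP => i j; rewrite !mxE /intC rmorphD mulrDl.
have e2 : dot W (toC (v + v')) = dot W (toC v) + dot W (toC v').
  by rewrite -dotDr; congr dot; apply/matrixP => i j; rewrite !mxE rmorphD.
by rewrite /freq e1 e2 !eCD mulrACA.
Qed.

Lemma fexp_mul (I J : eqType) c (Nf : I -> 'M[int]_g) vf c' (Nf' : J -> 'M[int]_g) vf' lam mu mu' psi psi' :
  fexp_of c Nf vf lam mu psi -> fexp_of c' Nf' vf' lam mu' psi' ->
  fexp_of (fun p : I * J => c p.1 * c' p.2) (fun p => Nf p.1 + Nf' p.2) (fun p => vf p.1 + vf' p.2)
    lam (mu + mu') (fun Z W => psi Z W * psi' Z W).
Proof.
move=> [s1 h1] [s2 h2]; split=> [[i j] /=|Z W HZ].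
  rewrite mulf_eq0 negb_or => /andP[/s1 [[t1 d1] q1] /s2 [[t2 d2] q2]]; split.
    by split=> [|l]; rewrite ?trmxD ?t1 ?t2// mxE rpredD.
  move=> u s; have := addr_ge0 (q1 u s) (q2 u s).
  have -> : map_mx intr (Nf i + Nf' j) = map_mx intr (Nf i) + map_mx intr (Nf' j) :> 'M[R]_g.
    by apply/matrixP => x y; rewrite !mxE rmorphD.
  rewrite bilQD dotDr; move: (bil _ _ _) (bil _ _ _) (dot _ _) (dot _ _) => x1 x2 x3 x4.
  by congr (0 <= _); rewrite !mulrDl !mulrDr; ring.
apply: eq_has_sum (has_sumM (h1 Z W HZ) (h2 Z W HZ)) => -[i j] /=.
by rewrite freqD mulrACA.
Qed.

Lemma fexp_scale (I : eqType) c (Nf : I -> 'M[int]_g) vf lam mu psi (s : nat) :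
  fexp_of c Nf vf lam mu psi ->
  fexp_of c Nf (fun i => s%:R *: vf i) lam (s%:R ^+ 2 * mu) (fun Z W => psi Z (s%:R *: W)).
Proof.
move=> [s1 h1]; split=> [i /s1 [t q]|Z W HZ].
  split=> // u r; have := q u (s%:R * r).
  by rewrite dotZr; congr (0 <= _); ring.
apply: eq_has_sum (h1 Z (s%:R *: W) HZ) => i; congr (_ * (_ * eC _)).
rewrite dotZl -dotZr; congr dot; apply/matrixP => x y; rewrite !mxE rmorphM /=.
by rewrite rmorph_nat.
Qed.

(** Coefficients of equal frequency are added up. Their sum converges since the expansion does and
    its exponential factor is a nonzero constant on each class; a nonzero sum has a nonzero summand,
    from which the support conditions are inherited. *)
Lemma fexp_push (I : eqType) c (Nf : I -> 'M[int]_g) vf lam m psi (Rf : I -> 'cV[int]_g) :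
  (0 < lam)%N -> (forall i, vf i = map_mx intr (Rf i)^T) ->
  fexp_of c Nf vf lam m%:R psi -> fourier_cond m lam psi.
Proof.
move=> lam0 hR [s1 h1].
pose key i := (Nf i, Rf i).
pose c' K := csum (fun i => if key i == K then c i else 0).
exists (fun N Rv => c' (N, Rv)); split.
  move=> N Rv cn0.
  have [i [ki ci]] : exists i, key i = (N, Rv) /\ c i != 0.
    apply: contrapT => hn; move/eqP: cn0; apply; rewrite /c'.
    rewrite (_ : (fun i => _) = fun=> 0); first exact: csumE (@has_sum0 R I).
    apply: funext => i; case: eqP => // ki; apply/eqP; apply: contrapT => ci.
    by apply: hn; exists i; split=> //; apply/negP.
  have [t q] := s1 i ci; move: ki => [e1 e2]; rewrite -e1 -e2; split=> //.
  by apply/fourier_blockE => //; split; [case: t|rewrite -hR].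
move=> Z W HZ.
pose e (K : 'M[int]_g * 'cV[int]_g) := freq lam K.1 (map_mx intr K.2^T) Z W.
(* Supported on the graph of [key]: the total is [psi Z W] by reindexing, and the row sums are the
   terms of the collected series. *)
pose w (p : ('M[int]_g * 'cV[int]_g) * I) := if key p.2 == p.1 then c p.2 * e p.1 else 0.
have hs : has_sum w (psi Z W).
  apply: (@has_sum_reindex _ _ _ (fun i => (key i, i))); first by move=> i j [].
    by move=> [K i]; rewrite /w /=; case: (key i =P K) => [e1 _|_ /eqP//]; exists i; rewrite e1.
  apply: eq_has_sum (h1 Z W HZ) => i; rewrite /w /= eqxx /e /=.
  by rewrite -hR.
have hK K : has_sum (fun i => w (K, i)) (c' K * e K).
  have e0 : e K != 0 by rewrite mulf_neq0 ?eC_neq0.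
  have E i : w (K, i) = e K * (if key i == K then c i else 0).
    by rewrite /w /=; case: eqP => _; rewrite ?mulr0 1?mulrC.
  have sw : summ (fun i => w (K, i)).
    by apply: (@summ_comp_inj _ _ _ (fun i => (K, i)) w) (has_sum_summ hs) => i j [].
  have [sc _] := csumZ_neq0 e0 (eq_summ E sw).
  rewrite mulrC; apply: eq_has_sum (has_sumZ (e K) (csumP sc)) => i.
  by rewrite E.
apply: eq_has_sum (has_sum_pair hs hK) => -[N Rv] /=.
rewrite /e /freq /= -mulrA; congr (_ * (_ * eC _)).
have ET : (toC (map_mx intr Rv^T))^T = map_mx (@intC R) Rv.
  by apply/matrixP => x y; rewrite !mxE /intC -int_realC.
by rewrite /dot ET.
Qed.

End FourierExpansion.

Section FourierClosure.
Variables (R : realType) (g : nat).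
Local Notation C := (Num.NumField.sort (R[i])).
Local Notation toC := (map_mx (real_complex R)).
Local Notation cmx := (map_mx (@intC R)).
Implicit Types (phi psi : fn R g) (Z : 'M[C]_g) (W : 'rV[C]_g).

Lemma toC_int_tr (Rv : 'cV[int]_g) : (toC (map_mx intr Rv^T))^T = cmx Rv.
Proof. by apply/matrixP => x y; rewrite !mxE /intC -int_realC. Qed.

Lemma fourier_cond_fexp m lam psi : (0 < lam)%N -> fourier_cond m lam psi ->
  exists c : 'M[int]_g * 'cV[int]_g -> C,
    fexp_of c fst (fun K => map_mx intr K.2^T) lam m%:R psi.
Proof.
move=> lam0 [c [h1 h2]]; exists (fun K => c K.1 K.2); split=> [[N Rv] /= /h1 [t]|Z W HZ].
  by move=> hp; have [_ q] := (fourier_blockE R m N Rv lam0).1 hp.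
apply: eq_has_sum (h2 Z W HZ) => -[N Rv] /=.
by rewrite /freq /dot toC_int_tr -[LHS]mulrA.
Qed.

Lemma eq_fourier_cond m lam phi psi : (forall Z W, siegelH Z -> phi Z W = psi Z W) ->
  fourier_cond m lam phi -> fourier_cond m lam psi.
Proof. by move=> e [c [h1 h2]]; exists c; split=> // Z W HZ; rewrite -e//; exact: h2. Qed.

Lemma fourier_cond_mul m1 m2 lam phi psi : (0 < lam)%N ->
  fourier_cond m1 lam phi -> fourier_cond m2 lam psi ->
  fourier_cond (m1 + m2) lam (fun Z W => phi Z W * psi Z W).
Proof.
move=> lam0 /(fourier_cond_fexp lam0) [c1 h1] /(fourier_cond_fexp lam0) [c2 h2].
have := fexp_mul h1 h2; rewrite -natrD; apply: (@fexp_push _ _ _ _ _ _ _ _ _ (fun p => p.1.2 + p.2.2)) => //.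
by move=> [[N Rv] [N' Rv']] /=; apply/matrixP => i j; rewrite !mxE rmorphD.
Qed.

Lemma fourier_cond_scale m lam phi (s : nat) : (0 < lam)%N ->
  fourier_cond m lam phi -> fourier_cond (s ^ 2 * m) lam (fun Z W => phi Z (s%:R *: W)).
Proof.
move=> lam0 /(fourier_cond_fexp lam0) [c1 h1].
have := fexp_scale s h1; rewrite -natrX -natrM.
apply: (@fexp_push _ _ _ _ _ _ _ _ _ (fun p => s%:Z *: p.2)) => //.
by move=> [N Rv] /=; apply/matrixP => i j; rewrite !mxE rmorphM.
Qed.

Lemma fourier_cond0 m lam : fourier_cond m lam (fun (_ : 'M[C]_g) (_ : 'rV[C]_g) => 0 : C).
Proof.
exists (fun _ _ => 0); split=> [N Rv|Z W _]; first by rewrite eqxx.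
by apply: eq_has_sum (@has_sum0 R _) => K; rewrite !mul0r.
Qed.

Lemma fourier_cond_add m lam phi psi : fourier_cond m lam phi -> fourier_cond m lam psi ->
  fourier_cond m lam (fun Z W => phi Z W + psi Z W).
Proof.
move=> [c [h1 h2]] [c' [h1' h2']]; exists (fun N Rv => c N Rv + c' N Rv); split=> [N Rv cc|Z W HZ].
  have [c0|] := eqVneq (c N Rv) 0; last exact: h1.
  by apply: h1'; move: cc; rewrite c0 add0r.
by apply: eq_has_sum (has_sumD (h2 Z W HZ) (h2' Z W HZ)) => K; rewrite !mulrDl.
Qed.

Lemma fourier_cond_sum (I : Type) (r : seq I) (F : I -> fn R g) m lam :
  (forall i, fourier_cond m lam (F i)) -> fourier_cond m lam (fun Z W => \sum_(i <- r) F i Z W).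
Proof.
move=> h; elim: r => [|i r IH].
  by apply: eq_fourier_cond (fourier_cond0 m lam) => Z W _; rewrite big_nil.
by apply: eq_fourier_cond (fourier_cond_add (h i) IH) => Z W _; rewrite big_cons.
Qed.

Lemma fexp1 lam : fexp_of (fun _ : unit => 1) (fun=> 0) (fun=> 0) lam 0
  (fun (Z : 'M[C]_g) (W : 'rV[C]_g) => 1).
Proof.
split=> [_ _|Z W _].
  split; first by split=> [|i]; rewrite ?trmx0// mxE.
  move=> u s; rewrite (_ : map_mx intr 0 = 0) ?map_mx0//.
  by rewrite /bil /dot mulmx0 mul0mx trmx0 mulmx0 !mxE mul0r mulr0 mul0r !addr0.
have E : 1 * freq lam 0 0 Z W = 1.
  rewrite mul1r /freq (_ : map_mx _ 0 = 0); last first.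
    by apply/matrixP => x y; rewrite !mxE /intC mul0r.
  rewrite mul0mx mxtrace0 mul0r eC0 mul1r (_ : toC 0 = 0) ?map_mx0//.
  by rewrite /dot trmx0 mulmx0 mxE eC0.
apply/has_sumP => e e0; exists [:: tt] => F uF sF.
have -> : F = [:: tt].
  have := sF tt; rewrite inE eqxx => /(_ isT); case: F uF {sF} => // -[] F /= /andP[hF uF] _.
  by case: F hF uF => // -[].
by rewrite big_seq1 [1 * _]E subrr nrm0.
Qed.

Lemma fourier_cond1 lam : (0 < lam)%N -> fourier_cond 0 lam (fun (Z : 'M[C]_g) (W : 'rV[C]_g) => 1).
Proof.
move=> lam0; apply: (@fexp_push R g unit _ _ _ lam 0 _ (fun=> 0) lam0 _ (fexp1 lam)) => _.
by apply/matrixP => i j; rewrite !mxE.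
Qed.

Lemma fourier_cond_pow m lam phi n : (0 < lam)%N -> fourier_cond m lam phi ->
  fourier_cond (n * m) lam (fun Z W => phi Z W ^+ n).
Proof.
move=> lam0 h; elim: n => [|n IH]; first exact: fourier_cond1.
by apply: eq_fourier_cond (fourier_cond_mul lam0 h IH) => Z W _; rewrite exprS.
Qed.

End FourierClosure.

(** * Fourier expansion of powers of theta functions *)

Section ThetaFourier.
Variables (R : realType) (g N m : nat).
Local Notation C := (Num.NumField.sort (R[i])).
Local Notation toC := (map_mx (real_complex R)).
Local Notation cmx := (map_mx (@intC R)).
Implicit Types (Z : 'M[C]_g) (W : 'rV[C]_g) (al be : 'rV[int]_g).
Hypothesis N0 : (0 < N)%N.

Let NR : N%:R != 0 :> R. Proof. by rewrite pnatr_eq0 -lt0n. Qed.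
Let NC : N%:R != 0 :> C. Proof. by rewrite pnatr_eq0 -lt0n. Qed.

(* 2 N^2 rather than N^2: the exponents are then tr(T Z) / tlam with 2T = 2 y^T y,
   whose diagonal is even. *)
Definition tlam : nat := (2 * N ^ 2)%N.
Definition tnum al (n : 'rV[int]_g) : 'rV[int]_g := N%:Z *: n + al.

Lemma rvec_chr al n : rvec n (chr R N al) = N%:R^-1 *: map_mx intr (tnum al n).
Proof.
apply/matrixP => i j; rewrite !mxE rmorphD rmorphM /= mulrDr; congr (_ + _).
by rewrite mulKf.
Qed.

Lemma tlamE (K : comNzRingType) : tlam%:R = 2 * N%:R ^+ 2 :> K.
Proof. by rewrite /tlam natrM natrX. Qed.

(** The matrix T / [tlam] of each term is the rank-one matrix y^T y / (2 N^2), so the form to be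
    tested is the square (d / N + s)^2 / 2. *)
Lemma theta_fexp al be : fexp_of
  (fun n => eC (dot (toC (rvec n (chr R N al))) (toC (chr R N be))))
  (fun n => 2 *: ((tnum al n)^T *m tnum al n)) (fun n => rvec n (chr R N al))
  tlam (2^-1) (theta (chr R N al) (chr R N be)).
Proof.
split=> [n _|Z W HZ].
  split.
    split=> [|i]; first by rewrite linearZ /= trmx_mul trmxK.
    by rewrite mxE dvdz_mulr.
  move=> u s; rewrite rvec_chr dotZr tlamE; set y := tnum al n.
  have -> : bil (map_mx intr (2 *: (y^T *m y))) u u = 2 * dot u (map_mx intr y) ^+ 2.
    have -> : map_mx intr (2 *: (y^T *m y)) = 2 *: ((map_mx intr y)^T *m map_mx intr y) :> 'M[R]_g.
      by rewrite map_trmx -map_mxM; apply/matrixP => i j; rewrite !mxE rmorphM.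
    rewrite bilQZ expr2; congr (_ * _).
    rewrite /bil mulmxA -mulmxA [u *m _]mx11_scalar [map_mx intr y *m _]mx11_scalar.
    by rewrite mul_scalar_mx [LHS]mxE [X in _ * X]mxE eqxx mulr1n; congr (_ * _); exact: dotC.
  set d := dot u _.
  have -> : 2 * d ^+ 2 / (2 * (2 * N%:R ^+ 2)) + s * (N%:R^-1 * d) + 2^-1 * s ^+ 2 =
    2^-1 * (d / N%:R + s) ^+ 2 by field.
  by rewrite mulr_ge0 ?sqr_ge0// invr_ge0.
have := csumP (summ_tterm (chr R N al) (chr R N be) W HZ); rewrite -/(theta _ _ _ _).
apply: eq_has_sum => n; rewrite /tterm /freq -!eCD; congr eC.
rewrite /texp dotDr addrA [RHS]addrC (dotC W).
suff -> : 2^-1 * bil Z (toC (rvec n (chr R N al))) (toC (rvec n (chr R N al))) =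
    \tr (map_mx (fun z => intC R z / 2) (2 *: ((tnum al n)^T *m tnum al n)) *m Z) / tlam%:R by [].
rewrite rvec_chr tlamE; set y := tnum al n.
have -> : toC (N%:R^-1 *: map_mx intr y) = N%:R^-1 *: cmx y.
  apply/matrixP => i j; rewrite !mxE rmorphM fmorphV rmorph_nat /=.
  by rewrite /intC int_realC.
rewrite bilZl bilZr.
have -> : map_mx (fun z => intC R z / 2) (2 *: (y^T *m y)) = (cmx y)^T *m cmx y.
  rewrite map_trmx -cmxM; apply/matrixP => i j; rewrite !mxE /intC rmorphM /= mulrC mulKf//.
rewrite -mulmxA mxtrace_mulC -mulmxA.
have -> : \tr (cmx y *m (Z *m (cmx y)^T)) = bil Z (cmx y) (cmx y).
  by rewrite /bil mulmxA /mxtrace big_ord1.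
by move: (bil _ _ _) => x; field.
Qed.

(** The frequencies of a P-th power lie in P al / N plus integral vectors; they become integral once
    P = [wexp]. *)
Lemma theta_pow_fexp al be (P : nat) : exists (I : eqType) c (Nf : I -> 'M[int]_g) vf,
  fexp_of c Nf vf tlam (P%:R * 2^-1) (fun Z W => theta (chr R N al) (chr R N be) Z W ^+ P) /\
  forall i, exists nu : 'rV[int]_g, vf i = rvec nu (P%:R *: chr R N al).
Proof.
elim: P => [|P [I [c [Nf [vf [h hv]]]]]].
  exists unit, (fun=> 1), (fun=> 0), (fun=> 0); split; first by rewrite mul0r; exact: fexp1.
  by move=> _; exists 0; apply/matrixP => i j; rewrite !mxE mul0r addr0.
have H := fexp_mul (theta_fexp al be) h.
do 4 eexists; split.
  have -> : P.+1%:R * 2^-1 = 2^-1 + P%:R * 2^-1 :> R by rewrite -natr1; field.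
  have -> : (fun Z W => theta (chr R N al) (chr R N be) Z W ^+ P.+1) =
    (fun Z W => theta (chr R N al) (chr R N be) Z W * theta (chr R N al) (chr R N be) Z W ^+ P).
    by apply: funext => Z; apply: funext => W; rewrite exprS.
  exact: H.
move=> [n i] /=; have [nu ->] := hv i; exists (n + nu); apply/matrixP => x y.
by rewrite !mxE rmorphD /= -natr1; ring.
Qed.

Lemma theta_pow_fourier al be : fourier_cond (wwt N m) tlam (theta_pow (R := R) (g := g) N m al be).
Proof.
have [I [c [Nf [vf [h hv]]]]] := theta_pow_fexp al be (wexp N m).
have lam0 : (0 < tlam)%N by rewrite /tlam muln_gt0 expn_gt0 N0.
have hR i : exists Rv : 'cV[int]_g, vf i = map_mx intr Rv^T.
  have [nu ->] := hv i; exists (nu + ((8 * N * m)%N%:Z *: al))^T; rewrite trmxK.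
  apply/matrixP => x y; rewrite !mxE rmorphD rmorphM /= wexpE -pmulrn !natrM; congr (_ + _).
  by field.
have [Rf hRf] := choice hR.
apply: (fexp_push lam0 hRf); have -> : (wwt N m)%:R = (wexp N m)%:R * 2^-1 :> R.
  by rewrite wexpE wwtE; field.
exact: h.
Qed.

Lemma theta_sum_fourier : fourier_cond (wwt N m) tlam (theta_sum (R := R) (g := g) N m).
Proof. by apply: fourier_cond_sum => p; exact: theta_pow_fourier. Qed.

Lemma theta_sum_hol : hol (theta_sum (R := R) (g := g) N m).
Proof. by apply: hol_sum => p; apply: hol_pow; exact: hol_theta. Qed.

End ThetaFourier.

(** * Restriction to a path towards the cusp *)

Section Limits.
Variable R : realType.
Local Notation C := (Num.NumField.sort (R[i])).
Implicit Types x y : nat -> C.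

Definition ebounded x := exists B : R, exists n0, forall n, (n0 <= n)%N -> nrm (x n) <= B.

Lemma tends0_ebounded x : tends0 x -> ebounded x.
Proof. by move=> /(_ 1 ltr01) [n0 h]; exists 1, n0 => n /h /ltW. Qed.

Lemma tends0D x y : tends0 x -> tends0 y -> tends0 (fun n => x n + y n).
Proof.
move=> hx hy e e0; have e2 : 0 < e / 2 by rewrite divr_gt0.
have [n0 h0] := hx _ e2; have [n1 h1] := hy _ e2; exists (maxn n0 n1) => n.
rewrite geq_max => /andP[/h0 a /h1 b]; apply: le_lt_trans (nrmD _ _) _.
by rewrite [ltRHS]splitr ltrD.
Qed.

Lemma tends0_mul_bounded x y : tends0 x -> ebounded y -> tends0 (fun n => x n * y n).
Proof.
move=> hx [B [n1 h1]] e e0.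
have B0 : 0 < `|B| + 1 by rewrite ltr_wpDl.
have [n0 h0] := hx _ (divr_gt0 e0 B0); exists (maxn n0 n1) => n.
rewrite geq_max => /andP[/h0 a /h1 b]; rewrite nrmM.
apply: le_lt_trans (_ : nrm (x n) * (`|B| + 1) < e); last by rewrite -ltr_pdivlMr.
rewrite ler_wpM2l ?nrm_ge0//; apply: (le_trans b); apply: le_trans (ler_norm _) _.
by rewrite lerDl.
Qed.

Lemma eboundedD x y : ebounded x -> ebounded y -> ebounded (fun n => x n + y n).
Proof.
move=> [B [n0 h0]] [B' [n1 h1]]; exists (B + B'), (maxn n0 n1) => n.
rewrite geq_max => /andP[/h0 a /h1 b]; apply: le_trans (nrmD _ _) _.
exact: lerD.
Qed.

Lemma eboundedM x y : ebounded x -> ebounded y -> ebounded (fun n => x n * y n).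
Proof.
move=> [B [n0 h0]] [B' [n1 h1]]; exists (B * B'), (maxn n0 n1) => n.
rewrite geq_max => /andP[/h0 a /h1 b]; rewrite nrmM.
by apply: ler_pM; rewrite ?nrm_ge0.
Qed.

Lemma ebounded_const (c : C) : ebounded (fun=> c).
Proof. by exists (nrm c), 0%N. Qed.

Lemma eq_tends0 x y : x =1 y -> tends0 x -> tends0 y.
Proof. by move=> /funext ->. Qed.

Lemma lim_mul x y (a b : C) : tends0 (fun n => x n - a) -> tends0 (fun n => y n - b) ->
  tends0 (fun n => x n * y n - a * b).
Proof.
move=> hx hy.
have by_ : ebounded y.
  have := eboundedD (tends0_ebounded hy) (ebounded_const b).
  by congr ebounded; apply: funext => n; rewrite subrK.
have h1 := tends0_mul_bounded hx by_.
have h2 := tends0_mul_bounded hy (ebounded_const a).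
by apply: eq_tends0 (tends0D h1 h2) => n; ring.
Qed.

Lemma lim_pow x (a : C) k : tends0 (fun n => x n - a) -> tends0 (fun n => x n ^+ k - a ^+ k).
Proof.
move=> h; elim: k => [|k IH].
  by move=> e e0; exists 0%N => n _; rewrite !expr0 subrr nrm0.
by apply: eq_tends0 (lim_mul h IH) => n; rewrite !exprS.
Qed.

Lemma lim_unique x (a : C) : tends0 x -> tends0 (fun n => x n - a) -> a = 0.
Proof.
move=> h1 h2; apply/eqP; apply: contrapT => /negP a0.
have na : 0 < nrm a / 2 by rewrite divr_gt0// nrm_gt0.
have [n0 h0] := h1 _ na; have [n1 h3] := h2 _ na.
have := h0 _ (leq_maxl n0 n1); have := h3 _ (leq_maxr n0 n1).
have := nrmB (x (maxn n0 n1)) (x (maxn n0 n1) - a); rewrite opprB addrC subrK.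
by lra.
Qed.

Lemma expR_decay (c : C) (a : R) : 0 < a ->
  tends0 (fun n => c * (expR (- (a * n.+1%:R)))%:C).
Proof.
move=> a0 e e0.
have q0 : 0 <= nrm c / (a * e) by rewrite divr_ge0 ?nrm_ge0// mulr_ge0// ltW.
exists (Num.bound (nrm c / (a * e))) => n hn.
rewrite nrmM nrm_real ger0_norm ?expR_ge0// expRN ltr_pdivrMr ?expR_gt0//.
have h1 : a * n.+1%:R < expR (a * n.+1%:R).
  by apply: lt_le_trans (expR_ge1Dx _); rewrite ltrDr.
have h2 : nrm c / (a * e) < n.+1%:R.
  apply: lt_le_trans (archi_boundP q0) _; rewrite ler_nat.
  exact: leq_trans hn (leqnSn n).
rewrite ltr_pdivrMr ?mulr_gt0// in h2.
apply: lt_trans h2 _; rewrite mulrA mulrC [_ * a]mulrC ltr_pM2l//.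
Qed.

End Limits.

(** * Fourier expansions and theta sums along the path *)

Section CuspPath.
Variables (R : realType) (g N : nat) (i0 : 'I_g).
Local Notation C := (Num.NumField.sort (R[i])).
Local Notation toC := (map_mx (real_complex R)).
Local Notation cmx := (map_mx (@intC R)).
Implicit Types (phi : fn R g).
Hypothesis N0 : (0 < N)%N.

Let NR : N%:R != 0 :> R. Proof. by rewrite pnatr_eq0 -lt0n. Qed.
Let NC : N%:R != 0 :> C. Proof. by rewrite pnatr_eq0 -lt0n. Qed.

(* The path Z = i t I, W = v Z with v = e_{i0} / N and t = n + 1. *)
Definition cusp_Z (n : nat) : 'M[C]_g := ('i%C * (n.+1%:R : R)%:C)%:M.
Definition cusp_v : 'rV[R]_g := N%:R^-1 *: delta_mx 0 i0.

(* The factor e(M v Z v^T) makes restr multiplicative in phi (indices add), and turns a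
   Fourier coefficient c(T, R) into c(T, R) exp(- 2 pi t E) with E >= 0. *)
Definition restr (M : nat) phi (n : nat) : C :=
  eC (M%:R * bil (cusp_Z n) (toC cusp_v) (toC cusp_v)) * phi (cusp_Z n) (toC cusp_v *m cusp_Z n).

Lemma Im_cusp_Z n : map_mx (@complex.Im R) (cusp_Z n) = (n.+1%:R)%:M.
Proof.
apply/matrixP => i j; rewrite !mxE; case: (i == j) => /=; last by [].
by rewrite !mulr1n /= mul0r mul1r add0r.
Qed.

Lemma dot_sqn (x : 'rV[R]_g) : dot x x = sqn x.
Proof. by rewrite dot_sum /sqn; apply: eq_bigr => i _; rewrite expr2. Qed.

Lemma siegelH_cusp_Z n : siegelH (cusp_Z n).
Proof.
split; first by rewrite tr_scalar_mx.
move=> x x0; rewrite Im_cusp_Z mul_mx_scalar -scalemxAl mxE mulr_gt0// -/(dot x x) dot_sqn.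
by rewrite lt_neqAle sqn_ge0 andbT eq_sym; apply: contra_neq x0; exact: sqn_eq0.
Qed.

(** E(T, R) = tr T / lam + v R + M v v^T, summed by coordinates: positivity at u = e_j, s = v_j
    makes each summand nonnegative. *)
Definition cusp_exp (M lam : nat) (K : 'M[int]_g * 'cV[int]_g) : R :=
  \sum_j ((K.1 j j)%:~R / (2 * lam%:R) + cusp_v 0 j * (K.2 j 0)%:~R + M%:R * cusp_v 0 j ^+ 2).

Lemma freq_restr M lam (K : 'M[int]_g * 'cV[int]_g) n :
  eC (M%:R * bil (cusp_Z n) (toC cusp_v) (toC cusp_v)) *
  freq lam K.1 (map_mx intr K.2^T) (cusp_Z n) (toC cusp_v *m cusp_Z n) =
  (expR (- (2 * pi * cusp_exp M lam K * n.+1%:R)))%:C.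
Proof.
rewrite -(mulrA (2 * pi)) -eC_imag /freq -!eCD; congr eC.
rewrite bil_dot !mul_mx_scalar mxtraceZ !dotZl rmorphM /= [(cusp_exp _ _ _)%:C * _]mulrC mulrA.
have alg (z d t l r : C) : M%:R * z * d + (z * t / l + z * r) = z * (t / l + r + M%:R * d).
  by rewrite !mulrDr mulrA [M%:R * z]mulrC -!mulrA addrC.
rewrite alg -mulrA; congr (_ * (_ * _)).
rewrite /cusp_exp !big_split /= !rmorphD !rmorph_sum /=; congr (_ + _ + _).
- rewrite /mxtrace mulr_suml; apply: eq_bigr => j _; rewrite mxE rmorphM /=.
  by rewrite fmorphV rmorphM /= !rmorph_nat /intC int_realC invfM mulrA.
- by rewrite dot_sum; apply: eq_bigr => j _; rewrite rmorphM; congr (_ * _); rewrite !mxE.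
by rewrite dot_sum mulr_sumr; apply: eq_bigr => j _; rewrite [toC _ 0 j]mxE rmorphM rmorphXn rmorph_nat expr2.
Qed.

Lemma index_pos_diag lam (mu : R) (Nm : 'M[int]_g) (v : 'rV[R]_g) j s :
  index_pos lam mu Nm v -> 0 <= (Nm j j)%:~R / (2 * lam%:R) + s * v 0 j + mu * s ^+ 2.
Proof.
move=> h; have := h (delta_mx 0 j) s.
by rewrite bil_dot -rowE [dot (delta_mx _ _) v]dotC !dot_delta !mxE.
Qed.

Lemma cusp_exp_ge0 M lam K : index_pos lam (M%:R : R) K.1 (map_mx intr K.2^T) -> 0 <= cusp_exp M lam K.
Proof.
move=> h; apply: sumr_ge0 => j _; have := index_pos_diag j (cusp_v 0 j) h.
by rewrite !mxE.
Qed.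

(* Completing the square with the positivity of the block matrix, E >= |R + 2 M v|^2 / (4 M),
   which is bounded below as 2 M v is not integral. *)
Lemma cusp_exp_ge M lam K : (0 < M)%N -> ~~ (N %| 2 * M)%N ->
  index_pos lam (M%:R : R) K.1 (map_mx intr K.2^T) ->
  (4 * M%:R * N%:R ^+ 2)^-1 <= cusp_exp M lam K.
Proof.
move=> M0 Nd h; have MR : 0 < M%:R :> R by rewrite ltr0n.
have NR0 : 0 < N%:R :> R by rewrite ltr0n.
rewrite /cusp_exp (bigD1 i0)//=; apply: ler_wpDr.
  by apply: sumr_ge0 => j _; have := index_pos_diag j (cusp_v 0 j) h; rewrite !mxE.
have -> : cusp_v 0 i0 = N%:R^-1 by rewrite !mxE !eqxx mulr1.
set r : int := K.2 i0 0; set q := (K.1 i0 i0)%:~R / _.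
(* The minimum of the form over s, which gives q >= r^2 / (4M). *)
have := index_pos_diag i0 (- (r%:~R / (2 * M%:R))) h.
have -> : (map_mx intr K.2^T : 'rV[R]_g) 0 i0 = r%:~R by rewrite !mxE.
rewrite -/q => hq.
(* An integer that is nonzero because N does not divide 2M. *)
have h1 : 1 <= (N%:Z * r + (2 * M)%N%:Z) ^+ 2.
  suff : N%:Z * r + (2 * M)%N%:Z != 0 by move=> z; rewrite -gtz0_ge1 exprn_even_gt0.
  apply: contra Nd => /eqP z; have : (N%:Z %| (2 * M)%N%:Z)%Z.
    by apply/dvdzP; exists (- r); rewrite mulNr mulrC; apply/eqP; rewrite -addr_eq0 addrC z.
  by rewrite dvdzE.
have h2 : 1 <= (N%:R * r%:~R + 2 * M%:R) ^+ 2 :> R.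
  by move: h1; rewrite -(ler_int R) rmorphXn rmorphD rmorphM /= -!pmulrn natrM.
have e1 : (4 * M%:R * N%:R ^+ 2)^-1 <= (4 * M%:R * N%:R ^+ 2)^-1 * (N%:R * r%:~R + 2 * M%:R) ^+ 2 :> R.
  by rewrite ler_peMr// invr_ge0 !mulr_ge0// exprn_ge0.
apply: (le_trans e1).
have e2 : (4 * M%:R * N%:R ^+ 2)^-1 * (N%:R * r%:~R + 2 * M%:R) ^+ 2 =
   (4 * M%:R)^-1 * r%:~R ^+ 2 + N%:R^-1 * r%:~R + M%:R * N%:R^-1 ^+ 2 :> R.
  by field; rewrite NR gt_eqF.
have e3 : q + - (r%:~R / (2 * M%:R)) * r%:~R + M%:R * (- (r%:~R / (2 * M%:R))) ^+ 2 =
   q - (4 * M%:R)^-1 * r%:~R ^+ 2 :> R.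
  by field; rewrite gt_eqF.
by rewrite e2; move: hq; rewrite e3; lra.
Qed.

Section FormLimit.
Variables (M lam : nat) (phi : fn R g).
Hypotheses (lam0 : (0 < lam)%N) (hphi : fourier_cond M lam phi).

Lemma restr_expansion : exists c : 'M[int]_g * 'cV[int]_g -> C,
  (forall K, c K != 0 -> index_pos lam (M%:R : R) K.1 (map_mx intr K.2^T)) /\
  forall n, has_sum (fun K => c K * (expR (- (2 * pi * cusp_exp M lam K * n.+1%:R)))%:C)
    (restr M phi n).
Proof.
have [c [h1 h2]] := fourier_cond_fexp lam0 hphi.
exists c; split=> [K /h1 [] //|n].
apply: eq_has_sum (has_sumZ _ (h2 _ _ (siegelH_cusp_Z n))) => K.
by rewrite mulrCA freq_restr.
Qed.

(** The exponents E are nonnegative, so the norms of the terms at the first point of the path, t =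
    1, dominate all later ones. *)
Lemma restr_dominated : exists c : 'M[int]_g * 'cV[int]_g -> C, exists D : 'M[int]_g * 'cV[int]_g -> R, exists B : R,
  [/\ forall K, c K != 0 -> index_pos lam (M%:R : R) K.1 (map_mx intr K.2^T), psum_le D B,
   forall n K, nrm (c K * (expR (- (2 * pi * cusp_exp M lam K * n.+1%:R)))%:C) <= D K &
   forall n, has_sum (fun K => c K * (expR (- (2 * pi * cusp_exp M lam K * n.+1%:R)))%:C)
    (restr M phi n)].
Proof.
have [c [h1 h2]] := restr_expansion.
have [B hB] := has_sum_summ (h2 0%N).
exists c, (fun K => nrm (c K * (expR (- (2 * pi * cusp_exp M lam K * 1%:R)))%:C)), B.
split=> // n K; rewrite !nrmM; have [->|c0] := eqVneq (c K) 0; first by rewrite nrm0 !mul0r.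
rewrite ler_wpM2l ?nrm_ge0// !nrm_real !ger0_norm ?expR_ge0// ler_expR lerN2.
rewrite ler_wpM2l ?ler_nat//; apply: mulr_ge0; first by rewrite mulr_ge0// ltW// pi_gt0.
by apply: cusp_exp_ge0; exact: h1.
Qed.

Lemma restr_bounded : ebounded (restr M phi).
Proof.
have [c [D [B [h1 hB hD hs]]]] := restr_dominated; exists B, 0%N => n _.
by apply: has_sum_le (hs n) _; apply: psum_le_le hB => K; exact: hD.
Qed.

Lemma restr_tends0 : (0 < M)%N -> ~~ (N %| 2 * M)%N -> tends0 (restr M phi).
Proof.
move=> M0 Nd; have [c [D [B [h1 hB hD hs]]]] := restr_dominated.
apply: (tannery hB hD _ hs) => K; have [->|c0] := eqVneq (c K) 0.
  by move=> e e0; exists 0%N => n _; rewrite mul0r nrm0.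
apply: expR_decay; rewrite mulr_gt0//; first by rewrite mulr_gt0// pi_gt0.
apply: lt_le_trans (cusp_exp_ge M0 Nd (h1 K c0)).
by rewrite invr_gt0 !mulr_gt0 ?exprn_gt0 ?ltr0n.
Qed.

End FormLimit.

Section WitnessLimit.
Variable m : nat.

(** Completing the square at W = c Z moves [c] into the first characteristic. *)
Lemma theta_restr (a b c : 'rV[R]_g) (Z : 'M[C]_g) : siegelH Z ->
  eC (2^-1 * bil Z (toC c) (toC c)) * theta a b Z (toC c *m Z) =
  eC (- dot (toC c) (toC b)) * theta (a + c) b Z 0.
Proof.
move=> HZ; have Zs : Z^T = Z by case: HZ.
rewrite /theta -!csumZ; try exact: summ_tterm.
apply: eq_csum => n; rewrite /tterm -!eCD; congr eC.
have -> : rvec n (a + c) = rvec n a + c by rewrite /rvec addrA.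
set x := rvec n a; rewrite /texp add0r.
have -> : toC (x + c) = toC x + toC c by apply/matrixP => i j; rewrite !mxE rmorphD.
rewrite bilDl !bilDr dotDl dotDr (bil_sym (toC x) (toC c) Zs).
have -> : dot (toC x) (toC c *m Z) = bil Z (toC c) (toC x) by rewrite dotC -bil_dot.
move: (bil Z (toC x) (toC x)) (bil Z (toC c) (toC x)) (bil Z (toC c) (toC c))
  (dot (toC x) _) (dot (toC c) _) => *.
by field.
Qed.

(** Chosen so that [chr R N dv] is m v, the vector that belongs to the path after W is replaced by m
    W. *)
Let dv : 'rV[int]_g := m%:Z *: delta_mx 0 i0.

Lemma chr_dv : chr R N dv = m%:R *: cusp_v.
Proof.
apply/matrixP => i j; rewrite !mxE rmorphM /= mulrCA; congr (_ * (_ * _)).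
by case: (_ && _).
Qed.

Lemma theta_pow_restr al be (Z : 'M[C]_g) : siegelH Z ->
  eC ((wwt N m)%:R * bil Z (toC (chr R N dv)) (toC (chr R N dv))) *
    theta_pow N m al be Z (toC (chr R N dv) *m Z) =
  theta_pow N m (al + dv) be Z 0.
Proof.
move=> HZ; rewrite /theta_pow; have -> : eC ((wwt N m)%:R * bil Z (toC (chr R N dv)) (toC (chr R N dv))) =
    eC (2^-1 * bil Z (toC (chr R N dv)) (toC (chr R N dv))) ^+ wexp N m.
  by rewrite eCX mulrA wexp_half.
rewrite -exprMn theta_restr// exprMn.
rewrite eCN exprVn (@eC_wexp _ _ _ _ ((8 * m)%N%:Z * dot dv be)); last first.
  rewrite wexpE !toC_chr dotZl dotZr dot_cmx rmorphM /= -pmulrn natrM.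
  by move: ((dot _ _)%:~R : C) => x; field.
rewrite invr1 mul1r; have -> : chr R N al + chr R N dv = chr R N (al + dv).
  by apply/matrixP => i j; rewrite !mxE rmorphD mulrDr.
by [].
Qed.

Lemma theta_sum_restr (Z : 'M[C]_g) : siegelH Z ->
  eC ((wwt N m)%:R * bil Z (toC (chr R N dv)) (toC (chr R N dv))) *
    theta_sum N m Z (toC (chr R N dv) *m Z) = theta_sum N m Z 0.
Proof.
move=> HZ; pose rho (al be : 'rV[int]_g) := (al + dv, be).
have E := @resum_reindex g N C N0 (fun al be => theta_pow N m al be Z 0) rho.
apply: etrans _ (E _ _).
- rewrite /theta_sum /resum mulr_sumr; apply: eq_bigr => p _.
  exact: theta_pow_restr.
- by move=> x x' y y' h h'; apply: theta_pow_cong.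
move=> x y x' y' h h'; split=> [i|]; last exact: h'.
by have := h i; rewrite /rho /= !mxE opprD addrACA subrr addr0.
Qed.

Lemma chr_lift_eq0 (r : 'rV['I_N]_g) (n : 'rV[int]_g) :
  rvec n (chr R N (lift r)) = 0 -> lift r = 0 /\ n = 0.
Proof.
move=> h; have hj j : N%:Z * n 0 j + (r 0 j : nat)%:Z = 0.
  have := congr1 (fun x : 'rV[R]_g => N%:R * x 0 j) h; rewrite !mxE mulr0 mulrDr mulVKf//.
  by move=> e; apply/eqP; rewrite -(eqr_int R) rmorphD rmorphM /= e.
have nj j : n 0 j = 0 by have := hj j; have := ltn_ord (r 0 j); nia.
split; apply/matrixP => i j; rewrite ord1 !mxE; last by rewrite nj.
by have := hj j; rewrite nj mulr0 add0r.
Qed.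

(** Only a term with n + al / N = 0 survives, and as the representatives lie in [0, N) this forces
    al = 0 and n = 0. *)
Lemma theta_lim (r : 'rV['I_N]_g) be :
  tends0 (fun n => theta (chr R N (lift r)) (chr R N be) (cusp_Z n) 0 - (lift r == 0)%:R).
Proof.
set a := chr R N (lift r); set b := chr R N be.
pose d (k : 'rV[int]_g) : C := ((k == 0) && (lift r == 0))%:R.
have hn n k : nrm (tterm a b (cusp_Z n) 0 k) = expR (- (pi * sqn (rvec k a) * n.+1%:R)).
  rewrite nrm_tterm Im_cusp_Z (_ : map_mx _ 0 = 0); last by apply/matrixP => i j; rewrite !mxE.
  have -> : dot (rvec k a) 0 = 0 by rewrite /dot trmx0 mulmx0 mxE.
  have -> : bil (n.+1%:R)%:M (rvec k a) (rvec k a) = n.+1%:R * sqn (rvec k a).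
    by rewrite bil_dot mul_mx_scalar dotZl dot_sqn.
  by rewrite mulr0 addr0 mulrAC mulrA.
have sd : has_sum d (lift r == 0)%:R.
  have := @has_sum_fin R _ d [:: 0] isT; rewrite big_seq1 /d eqxx /=; apply.
  by move=> k; rewrite inE => /negPf ->.
have [B hB] := summ_tterm a b 0 (siegelH_cusp_Z 0).
have [B' hB'] := has_sum_summ sd.
have hs n : has_sum (fun k => tterm a b (cusp_Z n) 0 k - d k)
    (theta a b (cusp_Z n) 0 - (lift r == 0)%:R).
  by apply: has_sumB sd; apply: csumP; apply: summ_tterm; exact: siegelH_cusp_Z.
apply: (@tannery R _ (fun k => nrm (tterm a b (cusp_Z 0) 0 k) + nrm (d k)) (B + B') _ _ _ _ _ hs).
- by move=> F uF; rewrite big_split /= lerD//; [exact: hB|exact: hB'].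
- move=> n k; apply: (le_trans (nrmB _ _)); apply: lerD; last exact: lexx.
  have le2 (x y u v : R) : x = u -> y = v -> u <= v -> x <= y by move=> -> ->.
  apply: (le2 _ _ _ _ (hn n k) (hn 0%N k)); rewrite ler_expR lerN2.
  by rewrite ler_wpM2l ?ler_nat// mulr_ge0 ?sqn_ge0// ltW// pi_gt0.
move=> k; have [x0|x0] := eqVneq (rvec k a) 0.
  have [r0 k0] := chr_lift_eq0 x0.
  move=> e e0; exists 0%N => n _; rewrite /d r0 k0 !eqxx /tterm -k0 x0 /texp.
  have -> : toC (0 : 'rV[R]_g) = 0 by apply/matrixP => i j; rewrite !mxE.
  by rewrite bil_dot mul0mx /dot !mul0mx !mxE mulr0 add0r eC0 subrr nrm0.
have -> : d k = 0.
  rewrite /d; case: eqP => //= k0; case: eqP => //= r0; move/negP: x0; case.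
  by apply/eqP/matrixP => i j; rewrite /a r0 k0 !mxE mulr0 addr0.
have p0 : 0 < pi * sqn (rvec k a).
  rewrite mulr_gt0 ?pi_gt0// lt_neqAle sqn_ge0 andbT eq_sym.
  by apply: contra_neq x0; exact: sqn_eq0.
move=> e e0; have [n0 h0] := expR_decay 1 p0 e0; exists n0 => n /h0.
by rewrite subr0 hn mul1r nrm_real ger0_norm ?expR_ge0.
Qed.

(** No cancellation can occur: the limit is a sum of nonnegative numbers in which the pair (0, 0)
    contributes 1. *)
Lemma theta_sum_lim : exists2 L : C, L != 0 &
  tends0 (fun n => theta_sum N m (cusp_Z n) 0 - L).
Proof.
exists (\sum_(p : 'rV['I_N]_g * 'rV['I_N]_g) ((lift p.1 == 0)%:R : C) ^+ wexp N m).
  pose z : 'rV['I_N]_g := \row_i Ordinal N0.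
  have z0 : lift z = 0 by apply/matrixP => i j; rewrite !mxE.
  rewrite (bigD1 (z, z))//= z0 eqxx expr1n gt_eqF// ltr_wpDr// sumr_ge0// => p _.
pose x (n : nat) (p : 'rV['I_N]_g * 'rV['I_N]_g) : C :=
  theta_pow N m (lift p.1) (lift p.2) (cusp_Z n) 0 - ((lift p.1 == 0)%:R : C) ^+ wexp N m.
apply: eq_tends0 (tends0_sum (index_enum _) (x := x) _) => [n|p]; last first.
  by apply: lim_pow; exact: (theta_lim p.1 (lift p.2)).
by rewrite sumrB.
Qed.

End WitnessLimit.

End CuspPath.

(** * The graded algebra *)

Section Graded.
Variables (R : realType) (g : nat).
Local Notation C := (Num.NumField.sort (R[i])).
Local Notation toC := (map_mx (real_complex R)).
Implicit Types (G : 'M[int]_(g + g) -> Prop) (phi : fn R g) (h : gfn R g).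

Lemma in_Sp1 : in_Sp (1%:M : 'M[int]_(g + g)).
Proof. by rewrite /in_Sp trmx1 mul1mx mulmx1. Qed.

Lemma jacobi_form_of G k m phi lam : is_subgroup_Sp G -> (0 < lam)%N -> hol phi ->
  slash_inv k m phi -> heis_inv m phi -> fourier_cond m lam phi -> jacobi_form G k m phi.
Proof.
move=> [GSp _ _ _] lam0 hh hs hi hf; split.
- exact: hol_holo.
- by move=> M GM Z W HZ; apply: hs => //; exact: GSp.
- exact: hi.
exists lam; split=> // M spM; apply: eq_fourier_cond hf => Z W HZ.
by rewrite hs.
Qed.

Lemma jacobi_form0 G k m : is_subgroup_Sp G ->
  jacobi_form G k m (fun (_ : 'M[C]_g) (_ : 'rV[C]_g) => 0).
Proof.
move=> sG; apply: (@jacobi_form_of G k m _ 1 sG) => //; first exact: hol_const.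
- by move=> M Z W _ _; rewrite slashE mulr0.
- by move=> lam mu x Z W _; rewrite /heis mulr0.
exact: fourier_cond0.
Qed.

Lemma jacobi_form_fourier G k m phi : jacobi_form G k m phi ->
  exists2 lam, (0 < lam)%N & fourier_cond m lam phi.
Proof.
move=> [_ _ _ [lam [lam0 hf]]]; exists lam => //.
by apply: eq_fourier_cond (hf _ in_Sp1) => Z W _; exact: slash1.
Qed.

Lemma wwt_gt0 N m : (0 < N)%N -> (0 < m)%N -> (0 < wwt N m)%N.
Proof. by move=> N0 m0; rewrite /wwt -lock !muln_gt0 N0 m0. Qed.

Section WitnessForm.
Variables (N k m : nat).
Hypotheses (N0 : (0 < N)%N) (Neven : (2 %| N)%N) (k0 : (0 < k)%N) (m0 : (0 < m)%N).

(** Writing [0%:R *: W] for 0 makes both factors instances of the substitution of s W for W. *)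
Definition witness : fn R g := fun Z W =>
  theta_sum N m Z (m%:R *: W) * theta_sum N m Z (0%:R *: W) ^+ (m * k).-1.

Lemma mk_gt0 : (0 < m * k)%N. Proof. by rewrite muln_gt0 m0. Qed.

Lemma witness_weight : (wwt N m + (m * k).-1 * wwt N m = wwt N m * m * k)%N.
Proof. by rewrite -mulSn prednK ?mk_gt0// mulnC mulnA. Qed.

Lemma witness_index :
  (m ^ 2 * wwt N m + (m * k).-1 * (0 ^ 2 * wwt N m) = wwt N m * m * m)%N.
Proof. by rewrite exp0n// mul0n muln0 addn0 mulnC -mulnA mulnn. Qed.

Lemma witness_jacobi G : is_subgroup_Sp G ->
  jacobi_form G (wwt N m * m * k) (wwt N m * m * m) witness.
Proof.
move=> sG; have lam0 : (0 < tlam N)%N by rewrite /tlam muln_gt0 expn_gt0 N0.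
have hh : hol (theta_sum (R := R) (g := g) N m) by exact: theta_sum_hol.
have hf : fourier_cond (wwt N m) (tlam N) (theta_sum (R := R) (g := g) N m).
  exact: theta_sum_fourier.
have hs : slash_inv (wwt N m) (wwt N m) (theta_sum (R := R) (g := g) N m).
  by move=> M Z W; exact: theta_sum_Sp.
have hi : heis_inv (wwt N m) (theta_sum (R := R) (g := g) N m).
  by move=> lam mu x Z W; exact: theta_sum_heis.
apply: (jacobi_form_of sG lam0).
- by apply: hol_mul; [exact: hol_scale|apply: hol_pow; exact: hol_scale].
- rewrite -witness_weight -witness_index.
  by apply: slash_inv_mul; [|apply: slash_inv_pow]; exact: slash_inv_scale.
- rewrite -witness_index.
  by apply: heis_inv_mul; [|apply: heis_inv_pow]; exact: heis_inv_scale.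
rewrite -witness_index.
by apply: fourier_cond_mul; [|exact: fourier_cond_scale|apply: fourier_cond_pow; [|exact: fourier_cond_scale]].
Qed.

Variable i0 : 'I_g.

(** The index is m^2 [wwt], so the normalising factor at v is that of A at m v; the factors A(Z, 0)
    need none. *)
Lemma witness_restr n : restr N i0 (wwt N m * m * m) witness n =
  theta_sum N m (cusp_Z R g n) 0 ^+ (m * k).
Proof.
have E : m%:R *: toC (cusp_v R N i0) = toC (chr R N (m%:Z *: delta_mx 0 i0)).
  rewrite chr_dv; apply/matrixP => i j; rewrite [LHS]mxE [X in _ * X]mxE [RHS]mxE.
  have -> : (m%:R *: cusp_v R N i0) i j = m%:R * cusp_v R N i0 i j by rewrite mxE.
  by rewrite rmorphM rmorph_nat.
have HZ := siegelH_cusp_Z R g n.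
rewrite /restr /witness scale0r -{2}(prednK mk_gt0) exprS mulrA; congr (_ * _).
have H := theta_sum_restr i0 N0 m HZ; rewrite -E bilZl bilZr -scalemxAl in H.
apply: etrans _ H; set b := bil _ _ _.
suff -> : (wwt N m * m * m)%:R * b = (wwt N m)%:R * (m%:R * (m%:R * b)) by [].
by rewrite !natrM !mulrA.
Qed.

Lemma witness_lim : exists2 L : C, L != 0 &
  tends0 (fun n => restr N i0 (wwt N m * m * m) witness n - L).
Proof.
have [L L0 hL] : exists2 L : C, L != 0 & tends0 (fun n => theta_sum N m (cusp_Z R g n) 0 - L).
  exact: theta_sum_lim.
exists (L ^+ (m * k)); first by rewrite expf_neq0.
by apply: eq_tends0 (lim_pow (m * k) hL) => n; rewrite witness_restr.
Qed.

End WitnessForm.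

Section CuspFiltration.
Variables (G : 'M[int]_(g + g) -> Prop) (k m N : nat) (i0 : 'I_g).
Hypothesis N0 : (0 < N)%N.

(** Degree 0 is only required to be bounded, so that constants qualify. In a product of positive
    degree each summand has a factor of positive degree, which tends to 0, and a bounded one. *)
Definition cuspidal h := ebounded (restr N i0 (0 * m) (h 0%N)) /\
  forall l, (0 < l)%N -> tends0 (restr N i0 (l * m) (h l)).

Lemma tends0_0 : tends0 (fun=> 0 : C).
Proof. by move=> e e0; exists 0%N => n _; rewrite nrm0. Qed.

Lemma cuspidal_ebounded h l : cuspidal h -> ebounded (restr N i0 (l * m) (h l)).
Proof. by move=> [h0 h1]; case: l => // l; apply: tends0_ebounded; exact: h1. Qed.

Lemma cuspidal_const (c : C) : cuspidal (gconst c).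
Proof.
split=> [|l l0].
  exists (nrm c), 0%N => n _.
  by rewrite /restr mul0n mul0r eC0 mul1r.
by apply: eq_tends0 tends0_0 => n; rewrite /restr /gconst gtn_eqF// mulr0.
Qed.

Lemma cuspidal_add h h' : cuspidal h -> cuspidal h' -> cuspidal (gadd h h').
Proof.
move=> [h0 h1] [h0' h1'].
have E l : restr N i0 (l * m) (gadd h h' l) =
    (fun n => restr N i0 (l * m) (h l) n + restr N i0 (l * m) (h' l) n).
  by apply: funext => n; rewrite /restr /gadd mulrDr.
split=> [|l l0]; rewrite E; first exact: eboundedD.
by apply: tends0D; [exact: h1|exact: h1'].
Qed.

Lemma restr_gmul h h' l : restr N i0 (l * m) (gmul h h' l) =
  (fun n => \sum_(i < l.+1) restr N i0 (i * m) (h i) n * restr N i0 ((l - i) * m) (h' (l - i)%N) n).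
Proof.
apply: funext => n; rewrite /restr /gmul mulr_sumr; apply: eq_bigr => i _.
have il : (i <= l)%N by rewrite -ltnS.
rewrite [RHS]mulrACA; congr (_ * _).
by rewrite -{1}(subnKC il) mulnDl natrD mulrDl eCD.
Qed.

Lemma cuspidal_mul h h' : cuspidal h -> cuspidal h' -> cuspidal (gmul h h').
Proof.
move=> ch ch'; split=> [|l l0]; rewrite restr_gmul.
  under eq_fun do rewrite big_ord1 subnn.
  by apply: eboundedM; [case: ch|case: ch'].
apply: tends0_sum => i; have [i1|i1] := posnP i.
  have l1 : (0 < l - i)%N by rewrite i1 subn0.
  have := tends0_mul_bounded (ch'.2 _ l1) (cuspidal_ebounded i ch).
  by apply: eq_tends0 => n; rewrite mulrC.
by apply: tends0_mul_bounded; [exact: ch.2|exact: cuspidal_ebounded].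
Qed.

(** For 0 < l < L the index l m satisfies 0 < 2 l m < N, so N does not divide 2 l m and
    [restr_tends0] applies. *)
Lemma cuspidal_gen h L : (0 < m)%N -> (2 * (m * L) < N)%N -> in_galg G k m h ->
  (forall l, (L <= l)%N -> forall Z W, siegelH Z -> h l Z W = 0) -> cuspidal h.
Proof.
move=> m0 NL [hj _] hz; split=> [|l l0].
  by have [lam lam0 hf] := jacobi_form_fourier (hj 0%N); exact: restr_bounded hf.
have [Ll|lL] := leqP L l.
  apply: eq_tends0 tends0_0 => n; rewrite /restr hz// ?mulr0//.
  exact: siegelH_cusp_Z.
have [lam lam0 hf] := jacobi_form_fourier (hj l).
apply: (restr_tends0 i0 N0 lam0 hf); first by rewrite muln_gt0 l0.
rewrite gtnNdvd ?muln_gt0 ?l0//.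
by apply: leq_ltn_trans NL; rewrite leq_mul2l /= mulnC leq_mul2l (ltnW lL) orbT.
Qed.

Lemma cuspidal_gen_by gens : (forall f, List.In f gens -> cuspidal f) ->
  forall h, gen_by gens h -> cuspidal h.
Proof.
move=> hg h; elim=> {h}.
- exact: hg.
- exact: cuspidal_const.
- by move=> f h _ hf _ hh; exact: cuspidal_add.
by move=> f h _ hf _ hh; exact: cuspidal_mul.
Qed.

End CuspFiltration.

Lemma gens_degree_bound G k m (gens : seq (gfn R g)) :
  (forall f, List.In f gens -> in_galg G k m f) ->
  exists L, forall f, List.In f gens ->
    forall l, (L <= l)%N -> forall Z W, siegelH Z -> f l Z W = 0.
Proof.
elim: gens => [|f gens IH] hg; first by exists 0%N.
have [L hL] := IH (fun f' hf' => hg f' (or_intror hf')).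
have [_ [L' hL']] := hg f (or_introl erefl).
exists (maxn L L') => f' [<-|hf'] l; rewrite geq_max => /andP[l1 l2]; [exact: hL'|exact: hL hf' _ l1].
Qed.

End Graded.

Theorem theorem6p9 (R : realType) (g : nat) (G : 'M[int]_(g + g) -> Prop)
    (k m : nat) :
  (0 < g)%N -> is_subgroup_Sp G -> finite_index_Sp G -> neat R G ->
  (0 < k)%N -> (0 < m)%N ->
  ~ galg_fin_gen R G k m.
Proof.
move=> g0 sG _ _ k0 m0 [gens [hg hgen]].
have [L hL] := gens_degree_bound hg.
(* Even, for [theta_sum], and larger than 2 m L, for [cuspidal_gen]; all generators vanish from
   degree [L] on. *)
pose N := (2 * (m * L).+1)%N; pose i0 := Ordinal g0.
have N0 : (0 < N)%N by [].
have Neven : (2 %| N)%N by rewrite dvdn_mulr.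
have NL : (2 * (m * L) < N)%N by rewrite ltn_pmul2l.
pose l0 := (wwt N m * m)%N.
have l0_gt0 : (0 < l0)%N.
  by rewrite muln_gt0 m0 wwt_gt0.
pose f : gfn R g := fun l => if l == l0 then witness N k m else fun _ _ => 0.
have fin : in_galg G k m f.
  split=> [l|].
    rewrite /f; case: eqP => [->|_]; last exact: jacobi_form0.
    exact: witness_jacobi.
  by exists l0.+1 => l hl Z W _; rewrite /f gtn_eqF.
have [h [hh hfh]] := hgen f fin.
have ch : cuspidal m N i0 h.
  apply: cuspidal_gen_by hh => f' hf'.
  by apply: (cuspidal_gen i0 N0 m0 NL (hg f' hf')); exact: hL.
have [Lim Lim0 hlim] := witness_lim R N0 k0 m0 i0.
(* As a component of positive degree of [h], the witness must tend to 0, against [witness_lim]. *)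
have t0 : tends0 (restr N i0 (l0 * m) (witness N k m : fn R g)).
  apply: eq_tends0 (ch.2 _ l0_gt0) => n.
  rewrite /restr -hfh; last exact: siegelH_cusp_Z.
  by rewrite /f eqxx.
by move/eqP: Lim0; apply; exact: lim_unique t0 hlim.
Qed.
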